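(* If $G$ is a benzenoid system with boundary cycle $Z$, then the indices $wSz(G)$, $wPI_v(G)$, $wSz_e(G)$ and $wPI(G)$ can be computed in $O(|Z|)$ time, where $|Z|$ is the number of vertices of $Z$.
   Context: A benzenoid system is the graph induced by the vertices and edges of the hexagonal lattice lying on a cycle $Z$ of the lattice (its boundary cycle, given as input) and in its interior. For an edge $e=uv$, with $d(u,f)=\min\{d(u,x),d(u,y)\}$ for an edge $f=xy$: $n_u(e)$ is the number of vertices strictly closer to $u$ than to $v$, and $m_u(e)$ the number of edges $f$ with $d(u,f)<d(v,f)$. $wSz(G)=\sum_{e=uv}(\deg u+\deg v)n_u(e)n_v(e)$, $wPI_v(G)=\sum_{e=uv}(\deg u+\deg v)(n_u(e)+n_v(e))$, $wSz_e(G)=\sum_{e=uv}(\deg u+\deg v)m_u(e)m_v(e)$, $wPI(G)=\sum_{e=uv}(\deg u+\deg v)(m_u(e)+m_v(e))$. Arithmetic operations take constant time. *)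

(* Defs.v *)
From mathcomp Require Import all_boot all_order all_algebra.
From Stdlib Require Import Relation_Operators.

Set Implicit Arguments.
Unset Strict Implicit.
Unset Printing Implicit Defensive.

Import Order.TTheory GRing.Theory Num.Theory.

(** * Degree-weighted Szeged and PI indices of a finite simple graph *)

(* Length of a shortest [e]-path from [u] to [v] ([#|T|] if there is none). *)
Definition gdist (T : finType) (e : rel T) (u v : T) : nat :=
  find (fun n => [exists p : n.-tuple T, path e u p && (last u p == v)])
       (iota 0 #|T|).

Definition gdeg (T : finType) (e : rel T) (u : T) : nat := #|[set v | e u v]|.

(* Each undirected edge is represented once, by the pair of its end vertices
   listed in the order of the enumeration of [T].  All the summands below are
   symmetric in the two end vertices. *)
Definition gedges (T : finType) (e : rel T) : {set T * T} :=
  [set f : T * T | e f.1 f.2 && (enum_rank f.1 < enum_rank f.2)].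

Definition gdist_edge (T : finType) (e : rel T) (u : T) (f : T * T) : nat :=
  minn (gdist e u f.1) (gdist e u f.2).

(* For an edge uv, [n_closer e u v] and [m_closer e u v] are n_u(uv) and
   m_u(uv). *)
Definition n_closer (T : finType) (e : rel T) (u v : T) : nat :=
  #|[set x | gdist e x u < gdist e x v]|.

Definition m_closer (T : finType) (e : rel T) (u v : T) : nat :=
  #|[set f in gedges e | gdist_edge e u f < gdist_edge e v f]|.

Definition wSz (T : finType) (e : rel T) : nat :=
  \sum_(f in gedges e) (gdeg e f.1 + gdeg e f.2) *
     (n_closer e f.1 f.2 * n_closer e f.2 f.1).

Definition wPIv (T : finType) (e : rel T) : nat :=
  \sum_(f in gedges e) (gdeg e f.1 + gdeg e f.2) *
     (n_closer e f.1 f.2 + n_closer e f.2 f.1).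

Definition wSze (T : finType) (e : rel T) : nat :=
  \sum_(f in gedges e) (gdeg e f.1 + gdeg e f.2) *
     (m_closer e f.1 f.2 * m_closer e f.2 f.1).

Definition wPI (T : finType) (e : rel T) : nat :=
  \sum_(f in gedges e) (gdeg e f.1 + gdeg e f.2) *
     (m_closer e f.1 f.2 + m_closer e f.2 f.1).

(** * The hexagonal lattice *)

Local Open Scope ring_scope.

(* The hexagon (a, b) is the face centred at a (1, 0) + b (1/2, sqrt 3 / 2). *)
Definition hexagon : Type := (int * int)%type.

(* A vertex is the common corner of three pairwise adjacent hexagons: (a, b),
   (a+1, b), (a, b+1) for (a, b, false), and (a+1, b), (a, b+1), (a+1, b+1) for
   (a, b, true). *)
Definition hvertex : Type := (int * int * bool)%type.

Definition hexagons_at (v : hvertex) : seq hexagon :=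
  let: (a, b, s) := v in
  if s then [:: (a + 1, b); (a, b + 1); (a + 1, b + 1)]
  else [:: (a, b); (a + 1, b); (a, b + 1)].

Definition hneighbours (v : hvertex) : seq hvertex :=
  let: (a, b, s) := v in
  if s then [:: (a, b, false); (a + 1, b, false); (a, b + 1, false)]
  else [:: (a, b, true); (a - 1, b, true); (a, b - 1, true)].

Definition hadj : rel hvertex := fun u v => v \in hneighbours u.

(* The edge uv is a side of exactly two hexagons, those having both u and v as
   corners. *)
Definition is_side (u v : hvertex) (h : hexagon) : bool :=
  (h \in hexagons_at u) && (h \in hexagons_at v).

(** * Cycles of the lattice and their interiors *)

Definition lattice_cycle (Z : seq hvertex) : bool :=
  [&& (2 < size Z)%N, uniq Z & cycle hadj Z].

Definition edge_on (Z : seq hvertex) (u v : hvertex) : bool :=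
  [&& u \in Z, v \in Z & (next Z u == v) || (next Z v == u)].

Definition cross (Z : seq hvertex) (h h' : hexagon) : Prop :=
  exists u v, [/\ hadj u v, ~~ edge_on Z u v, is_side u v h & is_side u v h'].

(* [h] and [h'] lie in the same connected component of the plane minus [Z]. *)
Definition same_region (Z : seq hvertex) : hexagon -> hexagon -> Prop :=
  clos_refl_trans hexagon (cross Z).

(* [h] lies in the bounded component of the plane minus [Z]. *)
Definition interior_hexagon (Z : seq hvertex) (h : hexagon) : Prop :=
  exists N : nat, forall h', same_region Z h h' ->
    `|h'.1| <= N%:Z /\ `|h'.2| <= N%:Z.

(* Vertices and edges lying on [Z] or in its interior.  A vertex (edge) that is
   not on [Z] lies in the same region as all the hexagons it is incident with,
   so it is in the interior iff one of them is. *)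
Definition vertex_within (Z : seq hvertex) (v : hvertex) : Prop :=
  v \in Z \/ exists2 h, h \in hexagons_at v & interior_hexagon Z h.

Definition edge_within (Z : seq hvertex) (u v : hvertex) : Prop :=
  hadj u v /\ (edge_on Z u v \/ exists2 h, is_side u v h & interior_hexagon Z h).

(* The graph (T, e) is, up to the naming [pos] of its vertices, the benzenoid
   system with boundary cycle [Z]. *)
Definition benzenoid_system (T : finType) (e : rel T) (Z : seq hvertex) : Prop :=
  lattice_cycle Z /\
  exists pos : T -> hvertex,
    [/\ injective pos,
        forall v, vertex_within Z v <-> exists x, pos x = v
      & forall x y, e x y <-> edge_within Z (pos x) (pos y)].

(** * Unit-cost random access machines, as structured programs *)

(* The cells are indexed by the integers and hold integers.  [Read] gives
   indirect addressing; registers are cells with constant addresses. *)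
Definition memory : Type := int -> int.

Inductive exp : Type :=
  | Const of int
  | Read of exp
  | Add of exp & exp
  | Sub of exp & exp
  | Mul of exp & exp
  | Leq of exp & exp.

Fixpoint eval (m : memory) (a : exp) : int :=
  match a with
  | Const z => z
  | Read a1 => m (eval m a1)
  | Add a1 a2 => eval m a1 + eval m a2
  | Sub a1 a2 => eval m a1 - eval m a2
  | Mul a1 a2 => eval m a1 * eval m a2
  | Leq a1 a2 => if eval m a1 <= eval m a2 then 1 else 0
  end.

(* One unit of time for each operation performed. *)
Fixpoint exp_time (a : exp) : nat :=
  match a with
  | Const _ => 1
  | Read a1 => (exp_time a1).+1
  | Add a1 a2 | Sub a1 a2 | Mul a1 a2 | Leq a1 a2 =>
      (exp_time a1 + exp_time a2).+1
  end.

Inductive program : Type :=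
  | Skip
  | Write of exp & exp
  | Seq of program & program
  | If of exp & program & program
  | While of exp & program.

Definition update (m : memory) (i z : int) : memory :=
  fun j => if j == i then z else m j.

(* [exec p m t m']: started in memory [m], the program [p] halts after time [t]
   in memory [m'].  A test succeeds when its value is nonzero. *)
Inductive exec : program -> memory -> nat -> memory -> Prop :=
  | ExecSkip m : exec Skip m 1 m
  | ExecWrite a1 a2 m :
      exec (Write a1 a2) m (exp_time a1 + exp_time a2).+1
           (update m (eval m a1) (eval m a2))
  | ExecSeq p1 p2 m m1 m2 t1 t2 :
      exec p1 m t1 m1 -> exec p2 m1 t2 m2 ->
      exec (Seq p1 p2) m (t1 + t2)%N m2
  | ExecIfTrue a p1 p2 m m' t :
      eval m a != 0 -> exec p1 m t m' ->
      exec (If a p1 p2) m (exp_time a + t).+1 m'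
  | ExecIfFalse a p1 p2 m m' t :
      eval m a = 0 -> exec p2 m t m' ->
      exec (If a p1 p2) m (exp_time a + t).+1 m'
  | ExecWhileTrue a p m m1 m2 t1 t2 :
      eval m a != 0 -> exec p m t1 m1 -> exec (While a p) m1 t2 m2 ->
      exec (While a p) m (exp_time a + t1 + t2).+1 m2
  | ExecWhileFalse a p m :
      eval m a = 0 -> exec (While a p) m (exp_time a).+1 m.

(* Cell 0 holds |Z|, cells 3i+1, 3i+2, 3i+3 hold the coordinates of the i-th
   vertex of [Z] (the boolean as 0 or 1), all other cells hold 0. *)
Definition cycle_input (Z : seq hvertex) : memory := fun i =>
  match i with
  | Posz 0 => (size Z)%:Z
  | Posz n.+1 =>
      nth 0 (flatten [seq [:: v.1.1; v.1.2; (nat_of_bool v.2)%:Z] | v : hvertex <- Z]) n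
  | Negz _ => 0
  end.

(* Main.v *)
Require Import Defs.
From HB Require Import structures.
From mathcomp Require Import all_boot all_order all_algebra.
From mathcomp Require Import zify ring.
From Stdlib Require Import Relation_Operators.

(** The edges of one direction split into orthogonal cuts: maximal rows of parallel
    edges through consecutive interior hexagons, whose first and last edges lie on [Z].
    Deleting a cut leaves two sides, because a closed walk of the graph has the same
    crossing parity (zero) around the exterior hexagons at the two ends of the row; and a
    vertex is closer to [u] than to [v], for [uv] in the cut, iff it is on the side of
    [u], because a path that crosses the cut can be shifted to the zigzag along it.  So
    all edges of a cut contribute the same products and sums, and the degrees along it
    are 3 except perhaps at its two extreme edges.

    The vertices (edges) of one side are counted by telescoping along the zigzags of the
    side, which leaves a sum over the part of [Z] in that side, i.e. over an arc of [Z]: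
    a difference of two prefix sums.  The two extreme edges of each cut are matched by
    scanning the edges of [Z] in the order of their position: on each line they
    alternately enter and leave the interior.  Bucket sorting makes this linear, and
    rotating the lattice reduces the other two directions to the first. *)

Set Implicit Arguments.
Unset Strict Implicit.
Unset Printing Implicit Defensive.

Import Order.TTheory GRing.Theory Num.Theory.

Local Open Scope ring_scope.

(** The interior is defined by boundedness of regions, which gives neither a procedure nor a means
    of counting. Everything rests on replacing it by the decidable crossing parity [inside], which
    amounts to a discrete Jordan curve theorem. Parity is taken along arbitrary closed walks, not
    only along [Z], since the same argument shows that a cut separates the graph.

    The program never builds the graph, whose size may be quadratic in that of [Z]: all it needs at
    a vertex of [Z] follows from the directions of two consecutive steps and from one global bit,
    the side of [Z] on which the interior lies. That bit is not part of the input; a step of least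
    position reveals it.

    Linear time also relies on tables indexed directly by lattice coordinates, in cells that
    initially hold 0. The sweep leaves its tables zero again, so the same code can run once per
    direction and add to the same four totals. *)

(** * Directions of edges and the hexagons around a vertex *)

Inductive dir := D0 | D1 | D2.

Definition nx (k : dir) : dir := match k with D0 => D1 | D1 => D2 | D2 => D0 end.

Definition code (k : dir) : nat := match k with D0 => 0 | D1 => 1 | D2 => 2 end.

Definition uncode (n : nat) : dir := match n with 0 => D0 | 1 => D1 | _ => D2 end.

Lemma codeK : cancel code uncode. Proof. by case. Qed.

HB.instance Definition _ := Equality.copy dir (can_type codeK).

Definition nb (v : hvertex) (k : dir) : hvertex :=
  let: (a, b, s) := v in
  if s then match k with
            | D0 => (a + 1, b, false) | D1 => (a, b + 1, false) | D2 => (a, b, false)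
            end
  else match k with
       | D0 => (a - 1, b, true) | D1 => (a, b - 1, true) | D2 => (a, b, true)
       end.

(* The hexagon at [v] that does not have the edge [v (nb v k)] as a side. *)
Definition hx (v : hvertex) (k : dir) : hexagon :=
  let: (a, b, s) := v in
  if s then match k with
            | D0 => (a, b + 1) | D1 => (a + 1, b) | D2 => (a + 1, b + 1)
            end
  else match k with
       | D0 => (a + 1, b) | D1 => (a, b + 1) | D2 => (a, b)
       end.

Lemma nx3 k : nx (nx (nx k)) = k. Proof. by case: k. Qed.

Lemma nbK v k : nb (nb v k) k = v.
Proof. by case: v => [[a b] []]; case: k => /=; congr pair; congr pair; lia. Qed.

Lemma nb_side v k : (nb v k).2 = ~~ v.2.
Proof. by case: v => [[a b] []]; case: k. Qed.

Lemma nb_inj v : injective (nb v).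
Proof.
by case: v => [[a b] []] [] [] //= /eqP; rewrite !xpair_eqE /=; lia.
Qed.

Lemma hadjP u v : reflect (exists k, v = nb u k) (hadj u v).
Proof.
rewrite /hadj; case: u => [[a b] []] /=; rewrite !inE; apply: (iffP or3P).
- case=> /eqP ->; [by exists D2|by exists D0|by exists D1].
- by case=> -[] ->; [constructor 2|constructor 3|constructor 1].
- case=> /eqP ->; [by exists D2|by exists D0|by exists D1].
- by case=> -[] ->; [constructor 2|constructor 3|constructor 1].
Qed.

Lemma hadj_nb v k : hadj v (nb v k). Proof. by apply/hadjP; exists k. Qed.

(** [nx] turns the same way at both kinds of vertices, so the two sides of an edge are exchanged
    when it is traversed backwards. *)
Lemma hx_nb1 v k : hx (nb v k) (nx k) = hx v (nx (nx k)).
Proof. by case: v => [[a b] []]; case: k => /=; congr pair; lia. Qed.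

Lemma hx_nb2 v k : hx (nb v k) (nx (nx k)) = hx v (nx k).
Proof. by case: v => [[a b] []]; case: k => /=; congr pair; lia. Qed.

Lemma hexagons_atP v h : reflect (exists k, h = hx v k) (h \in hexagons_at v).
Proof.
case: v => [[a b] []] /=; rewrite !inE; apply: (iffP or3P).
- case=> /eqP ->; [by exists D1|by exists D0|by exists D2].
- by case=> -[] ->; [constructor 2|constructor 1|constructor 3].
- case=> /eqP ->; [by exists D2|by exists D0|by exists D1].
- by case=> -[] ->; [constructor 2|constructor 3|constructor 1].
Qed.

Lemma is_sideE v k h :
  is_side v (nb v k) h = (h == hx v (nx k)) || (h == hx v (nx (nx k))).
Proof.
rewrite /is_side; apply/andP/orP.
  case=> /hexagons_atP [j ->] /hexagons_atP [i].
  have [->|] := eqVneq j k.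
    move=> E; exfalso; move: E; case: v => [[a b] []]; case: k; case: i => /= -[]; lia.
  case: j; case: k => /= + E; rewrite ?eqxx // => _; by [left|right].
case=> /eqP ->; split; apply/hexagons_atP.
- by exists (nx k).
- by exists (nx (nx k)); rewrite hx_nb2.
- by exists (nx (nx k)).
- by exists (nx k); rewrite hx_nb1.
Qed.

(** * Rotation *)

(** Rotation by a third of a turn about the vertex [(0, 0, false)]; [rhoh] is its action on
    hexagons. Edges of direction [nx k] become edges of direction [k]. *)
Definition rho (v : hvertex) : hvertex :=
  let: (a, b, s) := v in (b, - a - b - (s : nat)%:Z, s).

Definition rhoh (h : hexagon) : hexagon := (h.2, 1 - h.1 - h.2).

Lemma rho3 v : rho (rho (rho v)) = v.
Proof. by case: v => [[a b] []] /=; congr pair; congr pair; lia. Qed.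

Lemma rhoh3 h : rhoh (rhoh (rhoh h)) = h.
Proof. by case: h => a b; rewrite /rhoh /=; congr pair; lia. Qed.

Lemma rho_inj : injective rho.
Proof. by move=> u v E; rewrite -(rho3 u) E rho3. Qed.

Lemma rhoh_inj : injective rhoh.
Proof. by move=> u v E; rewrite -(rhoh3 u) E rhoh3. Qed.

Lemma nb_rho v k : nb (rho v) k = rho (nb v (nx k)).
Proof. by case: v => [[a b] []]; case: k => /=; congr pair; congr pair; lia. Qed.

Lemma hx_rho v k : hx (rho v) k = rhoh (hx v (nx k)).
Proof. by case: v => [[a b] []]; case: k; rewrite /rhoh /=; congr pair; lia. Qed.

Lemma hadj_rho u v : hadj (rho u) (rho v) = hadj u v.
Proof.
apply/hadjP/hadjP => -[k].
  by rewrite nb_rho => /rho_inj ->; exists (nx k).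
by move=> ->; exists (nx (nx k)); rewrite nb_rho nx3.
Qed.

Lemma at_rho v h : (rhoh h \in hexagons_at (rho v)) = (h \in hexagons_at v).
Proof.
apply/hexagons_atP/hexagons_atP => -[k].
  by rewrite hx_rho => /rhoh_inj ->; exists (nx k).
by move=> ->; exists (nx (nx k)); rewrite hx_rho nx3.
Qed.

Lemma side_rho u v h : is_side (rho u) (rho v) (rhoh h) = is_side u v h.
Proof. by rewrite /is_side !at_rho. Qed.

Lemma edge_on_rho Z u v : uniq Z -> edge_on (map rho Z) (rho u) (rho v) = edge_on Z u v.
Proof.
move=> uZ; rewrite /edge_on !mem_map; try exact: rho_inj.
by rewrite !next_map ?uZ //; try exact: rho_inj; rewrite !(inj_eq rho_inj).
Qed.

Lemma same_region_rho Z h h' : uniq Z ->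
  same_region Z h h' -> same_region (map rho Z) (rhoh h) (rhoh h').
Proof.
move=> uZ; elim=> [x y [u [v [Huv Hn s1 s2]]]|x|x y z _ H1 _ H2].
- apply: rt_step; exists (rho u), (rho v).
  by rewrite hadj_rho edge_on_rho // !side_rho.
- exact: rt_refl.
- exact: rt_trans H1 H2.
Qed.

Lemma map_rho3 Z : map rho (map rho (map rho Z)) = Z.
Proof. by rewrite -!map_comp -[RHS]map_id; apply: eq_map => v /=; rewrite rho3. Qed.

Lemma interior_rho_imp Z h : uniq Z ->
  interior_hexagon Z h -> interior_hexagon (map rho Z) (rhoh h).
Proof.
move=> uZ [N HN]; exists (2 * N + 1)%N => h' Hr.
have uZ' : uniq (map rho Z) by rewrite map_inj_uniq //; exact: rho_inj.
have uZ2 : uniq (map rho (map rho Z)) by rewrite map_inj_uniq //; exact: rho_inj.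
have H1 := same_region_rho uZ2 (same_region_rho uZ' Hr).
rewrite map_rho3 rhoh3 in H1; have := HN _ H1.
by rewrite /rhoh /=; case: h' {Hr H1} => x y /= [H1 H2]; split; lia.
Qed.

Lemma interior_rho Z h : uniq Z ->
  interior_hexagon (map rho Z) (rhoh h) <-> interior_hexagon Z h.
Proof.
move=> uZ; split; last exact: interior_rho_imp.
have uZ' : uniq (map rho Z) by rewrite map_inj_uniq //; exact: rho_inj.
have uZ2 : uniq (map rho (map rho Z)) by rewrite map_inj_uniq //; exact: rho_inj.
move=> /(interior_rho_imp uZ') /(interior_rho_imp uZ2).
by rewrite map_rho3 rhoh3.
Qed.

(** Only the naming of the vertices changes: [e], and with it the indices, is the same for all three
    rotations. *)
Lemma benzenoid_rho (T : finType) (e : rel T) Z (pos : T -> hvertex) :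
  lattice_cycle Z ->
  [/\ injective pos,
        forall v, vertex_within Z v <-> exists x, pos x = v
      & forall x y, e x y <-> edge_within Z (pos x) (pos y)] ->
  lattice_cycle (map rho Z) /\
  [/\ injective (rho \o pos),
        forall v, vertex_within (map rho Z) v <-> exists x, rho (pos x) = v
      & forall x y, e x y <-> edge_within (map rho Z) (rho (pos x)) (rho (pos y))].
Proof.
case/and3P => sZ uZ cZ [pI pV pE]; split.
  apply/and3P; split; [by rewrite size_map|by rewrite map_inj_uniq //; exact: rho_inj|].
  have: cycle hadj Z by [].
  by case: (Z) => //= z0 Z0; rewrite -map_rcons path_map;
    apply: sub_path => u v /=; rewrite hadj_rho.
split.
- exact: inj_comp rho_inj pI.
- move=> v; rewrite -[v]rho3; set w := rho (rho v).
  suff -> : vertex_within (map rho Z) (rho w) <-> vertex_within Z w.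
    rewrite pV; split=> -[x Hx]; exists x; [by rewrite Hx|exact: rho_inj].
  rewrite /vertex_within mem_map; last exact: rho_inj.
  split=> -[H|[h H1 H2]]; [by left|right|by left|right].
    exists (rhoh (rhoh h)).
      by rewrite -at_rho rhoh3.
    by apply/(interior_rho _ uZ); rewrite rhoh3.
  exists (rhoh h); first by rewrite at_rho.
  exact/(interior_rho _ uZ).
- move=> x y; rewrite pE /edge_within hadj_rho edge_on_rho //.
  split=> -[H0 [H|[h H1 H2]]]; split=> //; [by left|right|by left|right].
    exists (rhoh h); first by rewrite side_rho.
    exact/(interior_rho _ uZ).
  exists (rhoh (rhoh h)).
    by rewrite -side_rho rhoh3.
  by apply/(interior_rho _ uZ); rewrite rhoh3.
Qed.

(** * Crossing parities of closed walks *)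

(* The step [u v] crosses the ray that leaves [h] in direction (-1, 1). *)
Definition crosses (h : hexagon) (u v : hvertex) : bool :=
  [&& u.1 == v.1, u.1.1 + u.1.2 + 1 == h.1 + h.2 & u.1.1 < h.1].

Definition same_edge (x y u v : hvertex) : bool :=
  (u == x) && (v == y) || (u == y) && (v == x).

Definition xsum (n : nat) (w : nat -> hvertex) (f : hvertex -> hvertex -> bool) :=
  \big[addb/false]_(i < n) f (w i) (w i.+1).

Definition par (n : nat) (w : nat -> hvertex) (h : hexagon) : bool :=
  xsum n w (crosses h).

Definition closed_walk (n : nat) (w : nat -> hvertex) : Prop :=
  w n = w 0%N /\ forall i, (i < n)%N -> hadj (w i) (w i.+1).

Lemma addb_false_eq a b : a (+) b = false -> a = b.
Proof. by case: a; case: b. Qed.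

Lemma xsum_tele n w (g : hvertex -> bool) :
  xsum n w (fun u v => g u (+) g v) = g (w 0%N) (+) g (w n).
Proof.
rewrite /xsum; elim: n => [|n IH]; first by rewrite big_ord0 addbb.
by rewrite big_ord_recr /= IH addbA -(addbA (g (w 0%N))) addbb addbF.
Qed.

Lemma xsum_add n w f f' :
  xsum n w (fun u v => f u v (+) f' u v) = xsum n w f (+) xsum n w f'.
Proof. by rewrite /xsum big_split. Qed.

Lemma eq_xsum n w f f' : closed_walk n w ->
  (forall u k, f u (nb u k) = f' u (nb u k)) -> xsum n w f = xsum n w f'.
Proof.
move=> [_ Hw] E; apply: eq_bigr => i _.
by have /hadjP [k ->] := Hw _ (ltn_ord i).
Qed.

Lemma same_edgeC x y u v : same_edge x y u v = same_edge y x u v.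
Proof. by rewrite /same_edge orbC. Qed.

(* The parity jumps exactly at traversed edges because, step by step, the jump
   is the difference of a function of the vertices: the indicator of the part of
   a horizontal zigzag that lies on one side of the edge. *)
Lemma par_jump n w x k : closed_walk n w ->
  par n w (hx x (nx k)) (+) par n w (hx x (nx (nx k))) =
  xsum n w (same_edge x (nb x k)).
Proof.
wlog: x / x.2 = false => [Hwlog|].
  case Ex: x.2; last exact: Hwlog.
  move=> Hw; have := Hwlog (nb x k); rewrite nb_side Ex => /(_ erefl Hw).
  rewrite hx_nb1 hx_nb2 nbK addbC => ->.
  by apply: eq_xsum => // u j; rewrite same_edgeC.
case: x => [[a b] s] /= ->; move=> Hw.
(* For [D2] both hexagons lie on one ray, and the two crossing counts differ by the edge itself. For
   [D0] and [D1] the rays are parallel neighbours, and [g] marks a part of the zigzag between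
   them. *)
pose g (u : hvertex) : bool := match k with
  | D0 => (u.1.1 + u.1.2 + (u.2 : nat)%:Z == a + b) &&
          (2 * u.1.1 + (u.2 : nat)%:Z <= 2 * a - 1)
  | D1 => (u.1.1 + u.1.2 + (u.2 : nat)%:Z == a + b) &&
          (2 * u.1.1 + (u.2 : nat)%:Z <= 2 * a)
  | D2 => false end.
apply: addb_false_eq; rewrite /par -!xsum_add.
suff E : forall u j, crosses (hx (a, b, false) (nx k)) u (nb u j) (+)
     crosses (hx (a, b, false) (nx (nx k))) u (nb u j) (+)
     same_edge (a, b, false) (nb (a, b, false) k) u (nb u j) = g u (+) g (nb u j).
  apply: etrans (eq_xsum (f' := fun u v => g u (+) g v) Hw E) _.
  by rewrite xsum_tele; case: Hw => -> _; rewrite addbb.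
rewrite /g /crosses /same_edge => {g Hw} [[[a' b'] s'] j].
case: k; case: s'; case: j; rewrite /= ?xpair_eqE /=; lia.
Qed.

Lemma par_far_left n w h :
  (forall i, (i < n)%N -> h.1 <= (w i).1.1) -> par n w h = false.
Proof.
move=> H; rewrite /par /xsum big1 // => i _.
by rewrite /crosses ltNge H ?ltn_ord // !andbF.
Qed.

(** To the right of the walk the ray counts the crossings of a whole line, and a closed walk changes
    half-planes an even number of times. *)
Lemma par_far_right n w h : closed_walk n w ->
  (forall i, (i < n)%N -> (w i).1.1 < h.1) -> par n w h = false.
Proof.
move=> Hw H; rewrite /par.
pose g (u : hvertex) : bool := h.1 + h.2 <= u.1.1 + u.1.2 + (u.2 : nat)%:Z.
have -> : xsum n w (crosses h) = xsum n w (fun u v => g u (+) g v).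
  apply: eq_bigr => i _; case: Hw => _ /(_ _ (ltn_ord i)) /hadjP [k ->].
  have := H _ (ltn_ord i); rewrite /crosses /g; case: (w i) => [[a b] s] /=.
  by case: k; case: s; rewrite /= ?xpair_eqE /=; lia.
by rewrite xsum_tele; case: Hw => -> _; rewrite addbb.
Qed.

(** An odd parity requires a crossing step, which bounds [h.1] from below and fixes [h.1 + h.2], and
    a vertex of the walk not to the left of [h], which bounds [h.1] from above. *)
Lemma par_bounded n w : closed_walk n w ->
  exists N : nat, forall h, par n w h -> `|h.1| <= N%:Z /\ `|h.2| <= N%:Z.
Proof.
move=> Hw.
have [M HM] : exists M : nat, forall i, (i < n)%N ->
    `|(w i).1.1| <= M%:Z /\ `|(w i).1.2| <= M%:Z.
  elim: (n) => [|m [M HM]]; first by exists 0%N.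
  exists (M + `|(w m).1.1| + `|(w m).1.2|)%N => i; rewrite ltnS leq_eqVlt.
  by case/orP => [/eqP ->|/HM [H1 H2]]; split; lia.
exists (4 * M + 4)%N => h Hp.
have [i /and3P [_ H1 H2]] : exists i : 'I_n, crosses h (w i) (w i.+1).
  apply/existsP; apply: contraTT Hp; rewrite negb_exists => /forallP H.
  by rewrite /par /xsum big1 // => i _; apply/negbTE.
have [j Hj] : exists j : 'I_n, h.1 <= (w j).1.1.
  apply/existsP; apply: contraTT Hp; rewrite negb_exists => /forallP H.
  rewrite par_far_right // => k Hk; have := H (Ordinal Hk); rewrite /=; lia.
have := HM _ (ltn_ord i); have := HM _ (ltn_ord j).
move: H1 H2 Hj; case: (w i) => [[a b] s] /=; case: (w j) => [[a' b'] s'] /=.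
case: h {Hp} => x y /= ? ? ? [? ?] [? ?]; split; lia.
Qed.

(** * The two sides of a lattice cycle *)

Definition zv (Z : seq hvertex) (i : nat) : hvertex :=
  nth (0, 0, false) Z (i %% size Z).

Definition dirn (u v : hvertex) : dir :=
  if v == nb u D0 then D0 else if v == nb u D1 then D1 else D2.

Lemma dirn_nb u k : dirn u (nb u k) = k.
Proof. by rewrite /dirn !(inj_eq (@nb_inj u)); case: k. Qed.

Lemma nb_dirn u v : hadj u v -> nb u (dirn u v) = v.
Proof. by case/hadjP => k ->; rewrite dirn_nb. Qed.

Definition zd (Z : seq hvertex) (i : nat) : dir := dirn (zv Z i) (zv Z i.+1).

Definition lft (Z : seq hvertex) (i : nat) : hexagon := hx (zv Z i) (nx (zd Z i)).
Definition rgt (Z : seq hvertex) (i : nat) : hexagon := hx (zv Z i) (nx (nx (zd Z i))).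

(** The decidable substitute for [interior_hexagon]; [interiorP] shows that they agree. *)
Definition inside (Z : seq hvertex) : hexagon -> bool := par (size Z) (zv Z).

Lemma cross_sym Z h h' : cross Z h h' -> cross Z h' h.
Proof. by case=> u [v [? ? ? ?]]; exists u, v. Qed.

Lemma same_region_sym Z h h' : same_region Z h h' -> same_region Z h' h.
Proof.
elim=> [x y H|x|x y z _ H1 _ H2]; first exact/rt_step/cross_sym.
  exact: rt_refl.
exact: rt_trans H2 H1.
Qed.

Section Cycle.

Variable Z : seq hvertex.
Hypothesis HZ : lattice_cycle Z.

Let n := size Z.
Let V := zv Z.

Lemma size_cycle : (2 < n)%N. Proof. by case/and3P: HZ. Qed.

Lemma size_cycle_gt0 : (0 < n)%N. Proof. exact: ltn_trans size_cycle. Qed.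

Lemma modn_succ i : (i < n)%N -> (i.+1 %% n)%N = if i.+1 == n then 0%N else i.+1.
Proof. by move=> Hi; case: eqP => [->|E]; rewrite ?modnn // modn_small //; lia. Qed.

Lemma zv_mod i : V (i %% n) = V i.
Proof. by rewrite /V /zv modn_mod. Qed.

Lemma zv_in i : V i \in Z.
Proof. by rewrite mem_nth // ltn_mod size_cycle_gt0. Qed.

Lemma zv_eq i j : (V i == V j) = (i == j %[mod n]).
Proof.
by rewrite nth_uniq ?ltn_mod ?size_cycle_gt0 //; case/and3P: HZ.
Qed.

Lemma zvP v : v \in Z -> exists2 i, (i < n)%N & v = V i.
Proof.
move=> Hv; exists (index v Z); first by rewrite index_mem.
by rewrite /V /zv modn_small ?index_mem // nth_index.
Qed.

Lemma next_zv i : next Z (V i) = V i.+1.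
Proof.
rewrite -zv_mod; have := ltn_pmod i size_cycle_gt0; set j := (i %% n)%N => Hj.
have -> : V i.+1 = V j.+1 by apply/eqP; rewrite zv_eq -(addn1 i) -(addn1 j) modnDml.
have uZ : uniq Z by case/and3P: HZ.
rewrite next_nth zv_in /V /zv (modn_small Hj) index_uniq // /n.
move: Hj; rewrite /n; case: (Z) => //= z0 Z0 Hj.
rewrite ltnS leq_eqVlt in Hj; case/orP: Hj => [/eqP ->|Hj].
  by rewrite modnn nth_default.
by rewrite modn_small //=; apply: set_nth_default.
Qed.

Lemma zv_adj i : hadj (V i) (V i.+1).
Proof. by rewrite -next_zv next_cycle ?zv_in //; case/and3P: HZ. Qed.

Lemma nb_zd i : nb (V i) (zd Z i) = V i.+1.
Proof. by rewrite nb_dirn ?zv_adj. Qed.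

Lemma nb_zd_prev i : nb (V i.+1) (zd Z i) = V i.
Proof. by rewrite -nb_zd nbK. Qed.

Lemma zv_walk : closed_walk n V.
Proof. by split=> [|i _]; [rewrite -zv_mod modnn|exact: zv_adj]. Qed.

Lemma edge_onP u v : reflect (exists2 i, (i < n)%N & same_edge u v (V i) (V i.+1))
  (edge_on Z u v).
Proof.
rewrite /edge_on /same_edge; apply: (iffP and3P).
  case=> /zvP [i Hi ->] /zvP [j Hj ->]; rewrite !next_zv => /orP [] /eqP E.
    by exists i => //; rewrite E !eqxx.
  by exists j => //; rewrite E !eqxx orbT.
by case=> i _ /orP [] /andP [/eqP <- /eqP <-]; rewrite !zv_in !next_zv eqxx ?orbT.
Qed.

(** If one edge were traversed in both directions, [n] would divide 2; this is where the length of
    the cycle matters. *)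
Lemma same_edge_uniq u v i j : (i < n)%N -> (j < n)%N ->
  same_edge u v (V i) (V i.+1) -> same_edge u v (V j) (V j.+1) -> i = j.
Proof.
move=> Hi Hj; have n2 := size_cycle.
rewrite /same_edge => /orP [] /andP [/eqP Ei /eqP Ei'] /orP [] /andP [/eqP Ej /eqP Ej'].
- by apply/eqP; move: (zv_eq i j); rewrite !modn_small // Ei Ej eqxx => <-.
- have := zv_eq i j.+1; have := zv_eq i.+1 j; rewrite Ei Ei' Ej Ej' !eqxx.
  by rewrite !modn_succ // !(modn_small Hi, modn_small Hj); do 2 case: ifP; lia.
- have := zv_eq i j.+1; have := zv_eq i.+1 j; rewrite Ei Ei' Ej Ej' !eqxx.
  by rewrite !modn_succ // !(modn_small Hi, modn_small Hj); do 2 case: ifP; lia.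
- by apply/eqP; move: (zv_eq i j); rewrite !modn_small // Ei Ej eqxx => <-.
Qed.

Lemma xsum_edge_on u v : xsum n V (same_edge u v) = edge_on Z u v.
Proof.
apply/idP/edge_onP.
  move=> H; suff /existsP [i Hi] : [exists i : 'I_n, same_edge u v (V i) (V i.+1)].
    by exists i.
  apply: contraTT H; rewrite negb_exists => /forallP H.
  by rewrite /xsum big1 // => i _; apply/negbTE.
case=> i Hi E; rewrite /xsum (bigD1 (Ordinal Hi)) //= E big1 // => j Hj.
apply/negbTE; apply: contra Hj => Hj; apply/eqP/val_inj => /=.
exact: same_edge_uniq (ltn_ord j) Hi Hj E.
Qed.

Lemma inside_jump x k :
  inside Z (hx x (nx k)) (+) inside Z (hx x (nx (nx k))) = edge_on Z x (nb x k).
Proof. by rewrite par_jump ?xsum_edge_on //; exact: zv_walk. Qed.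

Lemma same_region_inside h h' : same_region Z h h' -> inside Z h = inside Z h'.
Proof.
elim=> [x y [u [v [/hadjP [k ->]]]]|//|x y z _ -> _ //].
rewrite -inside_jump !is_sideE => /negbTE /addb_false_eq E.
by do 2!case/orP=> /eqP ->.
Qed.

Lemma same_region_across x k : ~~ edge_on Z x (nb x k) ->
  same_region Z (hx x (nx k)) (hx x (nx (nx k))).
Proof.
move=> He; apply: rt_step; exists x, (nb x k).
by rewrite hadj_nb !is_sideE !eqxx orbT.
Qed.

Lemma zd_neq i : zd Z i.+1 != zd Z i.
Proof.
apply/eqP => E; have := nb_zd i.+1; rewrite E nb_zd_prev => /eqP.
rewrite eq_sym zv_eq; have := eqn_modDl i 2 0 n; rewrite addn2 addn0 => ->.
by rewrite mod0n modn_small // size_cycle.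
Qed.

Lemma zv_edge_on i k : edge_on Z (V i.+1) (nb (V i.+1) k) =
  (k == zd Z i) || (k == zd Z i.+1).
Proof.
rewrite /edge_on zv_in /= next_zv; apply/andP/orP => [[]|[] /eqP ->].
- case/zvP=> j _ Ej; rewrite Ej next_zv => /orP [] /eqP E.
    by right; rewrite -(inj_eq (@nb_inj (V i.+1))) Ej nb_zd E.
  left; rewrite -(inj_eq (@nb_inj (V i.+1))) Ej nb_zd_prev.
  by move/eqP: E; rewrite !zv_eq -(addn1 i) -(addn1 j) eqn_modDr.
- by rewrite nb_zd_prev zv_in next_zv eqxx orbT.
- by rewrite nb_zd zv_in eqxx.
Qed.

Lemma lftS i : lft Z i = hx (V i.+1) (nx (nx (zd Z i))).
Proof. by rewrite -nb_zd hx_nb2. Qed.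

Lemma rgtS i : rgt Z i = hx (V i.+1) (nx (zd Z i)).
Proof. by rewrite -nb_zd hx_nb1. Qed.

Lemma zd_cases i : zd Z i.+1 = nx (zd Z i) \/ zd Z i.+1 = nx (nx (zd Z i)).
Proof. by have := zd_neq i; case: (zd Z i); case: (zd Z i.+1); auto. Qed.

Lemma third_edge i : zd Z i.+1 = nx (zd Z i) ->
  ~~ edge_on Z (V i.+1) (nb (V i.+1) (nx (nx (zd Z i)))).
Proof. by rewrite zv_edge_on => ->; case: (zd Z i). Qed.

Lemma third_edge' i : zd Z i.+1 = nx (nx (zd Z i)) ->
  ~~ edge_on Z (V i.+1) (nb (V i.+1) (nx (zd Z i))).
Proof. by rewrite zv_edge_on => ->; case: (zd Z i). Qed.

(** At the common vertex the two hexagons either coincide or are the sides of the third edge, which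
    is not on [Z]. *)
Lemma lft_region i : same_region Z (lft Z i) (lft Z i.+1).
Proof.
rewrite lftS /lft; case: (zd_cases i) => E; rewrite E; first exact: rt_refl.
exact: same_region_across (third_edge' E).
Qed.

Lemma rgt_region i : same_region Z (rgt Z i) (rgt Z i.+1).
Proof.
rewrite rgtS /rgt; case: (zd_cases i) => E; rewrite E ?nx3; last exact: rt_refl.
have := same_region_across (third_edge E); rewrite nx3; exact: same_region_sym.
Qed.

Lemma lft_regions i j : same_region Z (lft Z i) (lft Z j).
Proof.
wlog: i j / (i <= j)%N => [H|].
  by case/orP: (leq_total i j) => /H //; exact: same_region_sym.
move/subnK <-; elim: (j - i)%N => [|d IH]; first exact: rt_refl.
exact: rt_trans IH (lft_region _).
Qed.

Lemma rgt_regions i j : same_region Z (rgt Z i) (rgt Z j).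
Proof.
wlog: i j / (i <= j)%N => [H|].
  by case/orP: (leq_total i j) => /H //; exact: same_region_sym.
move/subnK <-; elim: (j - i)%N => [|d IH]; first exact: rt_refl.
exact: rt_trans IH (rgt_region _).
Qed.

Lemma inside_lft i j : inside Z (lft Z i) = inside Z (lft Z j).
Proof. exact/same_region_inside/lft_regions. Qed.

Lemma inside_lft_rgt i : inside Z (rgt Z i) = ~~ inside Z (lft Z i).
Proof.
have := inside_jump (V i) (zd Z i); rewrite nb_zd.
have -> : edge_on Z (V i) (V i.+1) by rewrite /edge_on !zv_in next_zv eqxx.
by rewrite -/(lft Z i) -/(rgt Z i); do 2!case: (inside Z _).
Qed.

Definition unbounded_region (h : hexagon) : Prop :=
  forall N : nat, exists2 h', same_region Z h h' & N%:Z < `|h'.1|.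

Lemma unbounded_region_trans h h' :
  same_region Z h h' -> unbounded_region h' -> unbounded_region h.
Proof. by move=> H U N; have [h2 H2 ?] := U N; exists h2 => //; exact: rt_trans H H2. Qed.

Lemma step_left h : ~~ edge_on Z (h.1 - 1, h.2, false) (h.1 - 1, h.2, true) ->
  same_region Z h (h.1 - 1, h.2 + 1).
Proof.
move=> He; have := @same_region_across (h.1 - 1, h.2, false) D2 He.
by rewrite /= subrK -surjective_pairing.
Qed.

Lemma unbounded_left h :
  (forall i, h.1 <= (V i).1.1) -> unbounded_region h.
Proof.
move=> Hh N; exists (h.1 - (N + `|h.1| + 1)%N%:Z, h.2 + (N + `|h.1| + 1)%N%:Z); last by rewrite /=; lia.
elim: (N + `|h.1| + 1)%N => [|m IH].
  by rewrite subr0 addr0 -surjective_pairing; exact: rt_refl.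
apply: rt_trans IH _; set h' := (_, _).
have -> : (h.1 - m.+1%:Z, h.2 + m.+1%:Z) = (h'.1 - 1, h'.2 + 1).
  by rewrite /h' /=; congr pair; lia.
apply: step_left; apply/negP => /and3P [/zvP [i _ E] _ _].
by have := Hh i; rewrite -E /h' /=; lia.
Qed.

Lemma zv_bounded : exists M : nat, forall i, - M%:Z <= (V i).1.1 <= M%:Z.
Proof.
suff [M HM] : exists M : nat, forall v, v \in Z -> - M%:Z <= v.1.1 <= M%:Z.
  by exists M => i; apply/HM/zv_in.
elim: (Z) => [|z s [M HM]]; first by exists 0%N.
exists (M + `|z.1.1|)%N => v; rewrite inE => /orP [/eqP ->|/HM]; clear HM.
  by move: z.1.1 => x; lia.
by move: z.1.1 v.1.1 => x y; lia.
Qed.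

(** A walk from [h] in direction (-1, 1) either meets an edge of [Z], and then [h] is in the region
    of one of its sides, or passes to the left of [Z] and escapes. *)
Lemma walk_left h : unbounded_region h \/
  exists i, same_region Z h (lft Z i) \/ same_region Z h (rgt Z i).
Proof.
have [M HM] := zv_bounded.
have [m Hm] : exists m : nat, h.1 <= m%:Z - M%:Z by exists (`|h.1| + M)%N; lia.
elim: m h Hm => [|m IH] h Hm; first by left; apply: unbounded_left => i; apply: le_trans Hm _; rewrite sub0r; case/andP: (HM i).
have [He|He] := boolP (edge_on Z (h.1 - 1, h.2, false) (h.1 - 1, h.2, true)).
  right; case/edge_onP: He => i _; rewrite /same_edge => E; exists i.
  have Hh : h = hx (h.1 - 1, h.2, false) D0 by rewrite /= subrK -surjective_pairing.
  case/orP: E => /andP [/eqP E1 /eqP E2].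
    left; rewrite /lft /zd -/V E1 E2 (dirn_nb _ D2) -Hh; exact: rt_refl.
  right; rewrite /rgt /zd -/V E1 E2 (dirn_nb _ D2) /= subrK -surjective_pairing.
  exact: rt_refl.
have R := step_left He; have [||] := IH (h.1 - 1, h.2 + 1); first by move: Hm => /=; move: h.1 => x; lia.
  by move=> U; left; exact: unbounded_region_trans R U.
case=> i [H|H]; right; exists i; [left|right]; exact: rt_trans R H.
Qed.

Lemma hexagon_at_cycle i k : exists j,
  hx (V i.+1) k = lft Z j \/ hx (V i.+1) k = rgt Z j.
Proof.
have [->|E1] := eqVneq k (nx (zd Z i)); first by exists i; right; rewrite rgtS.
have [->|E2] := eqVneq k (nx (nx (zd Z i))); first by exists i; left; rewrite lftS.
have -> : k = zd Z i by move: E1 E2; case: k; case: (zd Z i).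
exists i.+1; rewrite /lft /rgt -/V.
by case: (zd_cases i) => ->; rewrite nx3; auto.
Qed.

(** A vertex of [Z] with least first coordinate has a hexagon with that same coordinate. Its ray
    meets nothing of [Z], so its region is unbounded and its parity even. *)
Lemma outer_side : exists i,
  [\/ unbounded_region (lft Z i) /\ ~~ inside Z (lft Z i)
    | unbounded_region (rgt Z i) /\ ~~ inside Z (rgt Z i)].
Proof.
have [j Hj] : exists j, forall i, (V j.+1).1.1 <= (V i).1.1.
  have [x _ Hx] := @arg_minP _ _ 'I_n (Ordinal size_cycle_gt0) xpredT
                 (fun i : 'I_n => (V i).1.1) isT.
  (* The successor of this index is [x] modulo [n]. *)
  exists (x + n.-1)%N => i; rewrite -addnS prednK ?size_cycle_gt0 //.
  rewrite -zv_mod modnDr modn_small ?ltn_ord // -(zv_mod i).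
  exact: Hx (Ordinal (ltn_pmod i size_cycle_gt0)) isT.
have [k Hk] : exists k, (hx (V j.+1) k).1 = (V j.+1).1.1.
  by case: (V j.+1) => [[a b] []]; [exists D0|exists D2].
have U : unbounded_region (hx (V j.+1) k) by apply: unbounded_left => i; rewrite Hk.
have P : ~~ inside Z (hx (V j.+1) k).
  by rewrite /inside par_far_left // => i _; rewrite Hk.
have [i [E|E]] := hexagon_at_cycle j k; exists i; [left|right]; by rewrite -E.
Qed.

(** The Jordan argument: a region that does not escape is one of the two regions along [Z]. These
    have opposite parities, and [outer_side] shows that the one of even parity is unbounded. *)
Lemma outside_unbounded h : ~~ inside Z h -> unbounded_region h.
Proof.
move=> Hh; have [//|[i Hi]] := walk_left h.
have [j Hj] := outer_side.
case: Hi => R; have := same_region_inside R; rewrite (negbTE Hh) => E;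
  case: Hj => -[U Hj]; apply: (unbounded_region_trans R).
- exact: unbounded_region_trans (lft_regions i j) U.
- by move: Hj; rewrite inside_lft_rgt (inside_lft j i) -E.
- by move: E; rewrite inside_lft_rgt (inside_lft i j) Hj.
- exact: unbounded_region_trans (rgt_regions i j) U.
Qed.

Lemma interiorP h : interior_hexagon Z h <-> inside Z h.
Proof.
split=> [[N HN]|Hh].
  apply/negPn/negP => /outside_unbounded /(_ N) [h' /HN [H1 _]]; lia.
have [N HN] := par_bounded zv_walk; exists N => h' /same_region_inside E.
by apply: HN; rewrite -[par _ _]/(inside Z) -E.
Qed.

End Cycle.

(** * Distances *)

Section Gdist.

Variables (T : finType) (e : rel T).

Lemma gdist_le x p : path e x p -> (gdist e x (last x p) <= size p)%N.
Proof.
move=> Hp; rewrite /gdist; set P := fun n : nat => _.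
have [Hs|Hs] := ltnP (size p) #|T|; last first.
  by apply: leq_trans (find_size _ _) _; rewrite size_iota.
rewrite leqNgt; apply/negP => /(before_find 0%N); rewrite nth_iota //= add0n.
suff -> : P (size p) by [].
by apply/existsP; exists (in_tuple p); rewrite /= Hp eqxx.
Qed.

(** The search over [iota 0 #|T|] succeeds because a path can be shortened to one without repeated
    vertices. *)
Lemma gdist_path x y : connect e x y ->
  exists p, [/\ path e x p, last x p = y & size p = gdist e x y].
Proof.
case/connectP => p0 Hp0 ->; case/shortenP: Hp0 => p Hp up _.
rewrite /gdist; set P := fun n : nat => _.
have Hs : (size p < #|T|)%N by rewrite -[(size p).+1]/(size (x :: p)) -(card_uniqP up) max_card.
have hasP : has P (iota 0 #|T|).
  apply/hasP; exists (size p); first by rewrite mem_iota add0n.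
  by apply/existsP; exists (in_tuple p); rewrite /= Hp eqxx.
have := nth_find 0%N hasP; move: hasP; rewrite has_find size_iota => Hf.
rewrite nth_iota // add0n => /existsP [q /andP [Hq /eqP Eq]].
by exists q; rewrite size_tuple.
Qed.

Lemma gdist_sym : symmetric e -> forall x y, gdist e x y = gdist e y x.
Proof.
move=> eC x y; apply: eq_find => m.
suff H u v : [exists p : m.-tuple T, path e u p && (last u p == v)] ->
             [exists p : m.-tuple T, path e v p && (last v p == u)].
  by apply/idP/idP; apply: H.
case/existsP => p /andP [Hp /eqP <-].
have Hs : size (rev (belast u p)) == m by rewrite size_rev size_belast size_tuple.
apply/existsP; exists (Tuple Hs) => /=; rewrite rev_path.
rewrite (eq_path (e' := e)) ?Hp; last by move=> a b; rewrite eC.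
case: (p : seq T) => [|a l] //=.
by rewrite rev_cons last_rcons eqxx.
Qed.

Lemma path_crossing (A : pred T) x p : path e x p -> A x -> ~~ A (last x p) ->
  exists p1 y z p2, [/\ p = p1 ++ z :: p2, last x p1 = y, A y, ~~ A z & e y z].
Proof.
elim: p x => [|z p IH] x /=; first by move=> _ ->.
case/andP => exz Hp Ax Hl; have [Az|Az] := boolP (A z); last by exists [::], x, z, p.
have [p1 [y [z' [p2 [-> El Ay Az' E]]]]] := IH _ Hp Az Hl.
by exists (z :: p1), y, z', p2.
Qed.

End Gdist.

(** * The graph of a lattice cycle *)

(* The edge of direction [k] at [v] belongs to the benzenoid system: an edge of the
   cycle also has an interior side. *)
Definition esd (Z : seq hvertex) (v : hvertex) (k : dir) : bool :=
  inside Z (hx v (nx k)) || inside Z (hx v (nx (nx k))).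

Definition deficient (Z : seq hvertex) (v : hvertex) : bool :=
  ~~ [&& esd Z v D0, esd Z v D1 & esd Z v D2].

Section Graph.

Variables (T : finType) (e : rel T) (Z : seq hvertex) (pos : T -> hvertex).
Hypothesis HZ : lattice_cycle Z.
Hypothesis HG : [/\ injective pos,
        forall v, vertex_within Z v <-> exists x, pos x = v
      & forall x y, e x y <-> edge_within Z (pos x) (pos y)].

Lemma pos_inj : injective pos. Proof. by case: HG. Qed.

Lemma esd_nb v k : esd Z (nb v k) k = esd Z v k.
Proof. by rewrite /esd hx_nb1 hx_nb2 orbC. Qed.

Lemma edge_on_esd v k : edge_on Z v (nb v k) -> esd Z v k.
Proof. by rewrite -inside_jump // /esd; case: (inside Z _); case: (inside Z _). Qed.

(** A vertex of [Z] also has an interior hexagon, since exactly one side of each edge of [Z] is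
    interior. *)
Lemma posP v : (exists x, pos x = v) <-> exists k, inside Z (hx v k).
Proof.
case: HG => _ <- _; split.
  case=> [/zvP [i Hi ->]|[h /hexagons_atP [k ->] /(interiorP HZ)]]; last by exists k.
  have := @edge_on_esd (zv Z i) (zd Z i); rewrite nb_zd // /edge_on !zv_in // next_zv // eqxx.
  by case/(_ isT)/orP => H; eexists; exact: H.
case=> k Hk; right; exists (hx v k); first by apply/hexagons_atP; exists k.
exact/interiorP.
Qed.

Lemma e_nb x y k : pos y = nb (pos x) k -> e x y = esd Z (pos x) k.
Proof.
move=> Ey; case: HG => _ _ /(_ x y); rewrite Ey /edge_within hadj_nb => E.
apply/idP/idP.
  case/E => _ [/edge_on_esd //|[h]]; rewrite is_sideE => H /(interiorP HZ) Hh.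
  by rewrite /esd; case/orP: H Hh => /eqP -> ->; rewrite ?orbT.
move=> H; apply/E; split=> //; right.
case/orP: H => H; [exists (hx (pos x) (nx k))|exists (hx (pos x) (nx (nx k)))];
  rewrite ?is_sideE ?eqxx ?orbT //; exact/interiorP.
Qed.

Lemma eP x y : e x y -> exists2 k, pos y = nb (pos x) k & esd Z (pos x) k.
Proof.
move=> Exy; have [_ _ /(_ x y) [/(_ Exy) [/hadjP [k Ek] _] _]] := HG.
by exists k => //; rewrite -(e_nb Ek).
Qed.

Lemma e_ex x k : esd Z (pos x) k -> exists2 y, pos y = nb (pos x) k & e x y.
Proof.
move=> H; have [y Hy] : exists y, pos y = nb (pos x) k.
  apply/posP; case/orP: H => H.
    by exists (nx (nx k)); rewrite hx_nb2.
  by exists (nx k); rewrite hx_nb1.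
by exists y => //; rewrite (e_nb Hy).
Qed.

Lemma e_sym : symmetric e.
Proof.
suff H x y : e x y -> e y x by move=> x y; apply/idP/idP; apply: H.
case/eP => k Ek H; rewrite (@e_nb y x k) ?Ek ?nbK //.
by rewrite esd_nb.
Qed.

Lemma pos_inside x : exists k, inside Z (hx (pos x) k).
Proof. by apply/posP; exists x. Qed.

Lemma esd_card x k : #|[set y | (pos y == nb (pos x) k) && e x y]| = esd Z (pos x) k.
Proof.
have [H|H] := boolP (esd Z (pos x) k).
  have [y Hy E] := e_ex H; apply/eqP/cards1P; exists y; apply/setP => z.
  rewrite !inE -Hy (inj_eq pos_inj); by case: eqP => // ->; rewrite E.
apply: eq_card0 => y; rewrite !inE.
by apply/negbTE; apply: contra H => /andP [/eqP H]; rewrite (e_nb H).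
Qed.

(** One interior hexagon at a vertex already gives two edges, so the degree is 2 or 3. *)
Lemma gdegE x : (gdeg e x + deficient Z (pos x))%N = 3.
Proof.
have -> : gdeg e x = (esd Z (pos x) D0 + esd Z (pos x) D1 + esd Z (pos x) D2)%N.
  rewrite -!esd_card -!sum1_card !(big_mkcond (fun i => i \in [set _ | _])) -!big_split /=.
  rewrite /gdeg -sum1_card big_mkcond; apply: eq_bigr => y _; rewrite !inE.
  case E: (e x y); rewrite ?andbF //= !andbT.
  by case/eP: E => k -> _; rewrite !(inj_eq (@nb_inj _)); case: k.
have [k] := pos_inside x; rewrite /deficient /esd /=.
by case: k => /=; case: (inside Z (hx (pos x) D0)) (inside Z (hx (pos x) D1))
  (inside Z (hx (pos x) D2)) => [] [] [].
Qed.

(* The third hexagon at [pos x] is interior and the two sides of the missing edge are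
   not, so the two other edges at [pos x] lie on [Z]. *)
Lemma missing_on_cycle x k : ~~ esd Z (pos x) k -> pos x \in Z.
Proof.
rewrite /esd negb_or => /andP [H1 H2].
have H0 : inside Z (hx (pos x) k).
  have [j] := pos_inside x; move: H1 H2; case: k; case: j => /=;
  by case: (inside Z (hx (pos x) D0)) (inside Z (hx (pos x) D1))
    (inside Z (hx (pos x) D2)) => [] [] [].
have := inside_jump HZ (pos x) (nx k).
by rewrite nx3 H0 (negbTE H2) => /esym /and3P [].
Qed.

End Graph.

(** * Orthogonal cuts *)

Section Connectivity.

Variables (T : finType) (e : rel T) (Z : seq hvertex) (pos : T -> hvertex).
Hypothesis HZ : lattice_cycle Z.
Hypothesis HG : [/\ injective pos,
        forall v, vertex_within Z v <-> exists x, pos x = v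
      & forall x y, e x y <-> edge_within Z (pos x) (pos y)].

Lemma e_connect_sym : connect_sym e.
Proof. exact/sym_connect_sym/(e_sym HZ HG). Qed.

Lemma corner_connected h : inside Z h -> exists u,
  forall x k, hx (pos x) k = h -> connect e u x.
Proof.
move=> Hh.
have walk u k : (hx (pos u) (nx k) == h) || (hx (pos u) (nx (nx k)) == h) ->
    exists2 v, pos v = nb (pos u) k & connect e u v.
  move=> H; have Hs : esd Z (pos u) k.
    by case/orP: H => /eqP E; rewrite /esd E Hh ?orbT.
  by have [v Ev euv] := e_ex HZ HG Hs; exists v => //; exact: connect1.
have [u0 E0] : exists x, pos x = (h.1 - 1, h.2, false).
  by apply/(posP HZ HG); exists D0; rewrite /= subrK -surjective_pairing.
case: h Hh walk E0 => a b Hh walk /= E0.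
have [|u1 E1 C1] := walk u0 D2; first by rewrite E0 /= !xpair_eqE; lia.
have [|u2 E2 C2] := walk u1 D0; first by rewrite E1 E0 /= !xpair_eqE; lia.
have [|u3 E3 C3] := walk u2 D1; first by rewrite E2 E1 E0 /= !xpair_eqE; lia.
have [|u4 E4 C4] := walk u3 D2; first by rewrite E3 E2 E1 E0 /= !xpair_eqE; lia.
have [|u5 E5 C5] := walk u4 D0; first by rewrite E4 E3 E2 E1 E0 /= !xpair_eqE; lia.
have {}C2 := connect_trans C1 C2; have {}C3 := connect_trans C2 C3.
have {}C4 := connect_trans C3 C4; have {}C5 := connect_trans C4 C5.
have same x y : pos x = pos y -> connect e u0 y -> connect e u0 x.
  by case: HG => pI _ _ /pI ->.
exists u0 => x k; rewrite E0 /= in E1; rewrite E1 /= in E2; rewrite E2 /= in E3.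
rewrite E3 /= in E4; rewrite E4 /= in E5.
case Ex: (pos x) => [[a' b'] []]; case: k => /= -[Ea Eb].
- by apply: (same _ u3) => //; rewrite Ex E3; congr pair; congr pair; lia.
- by apply: (same _ u1) => //; rewrite Ex E1; congr pair; congr pair; lia.
- by apply: (same _ u5) => //; rewrite Ex E5; congr pair; congr pair; lia.
- by apply: (same _ u0) => //; rewrite Ex E0; congr pair; congr pair; lia.
- by apply: (same _ u4) => //; rewrite Ex E4; congr pair; congr pair; lia.
- by apply: (same _ u2) => //; rewrite Ex E2; congr pair; congr pair; lia.
Qed.

Lemma connect_hexagon h x y j k : inside Z h ->
  hx (pos x) j = h -> hx (pos y) k = h -> connect e x y.
Proof.
move=> /corner_connected [u Hu] /Hu Cx /Hu Cy.
by apply: connect_trans Cy; rewrite e_connect_sym.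
Qed.

Lemma exists_pos i : exists x, pos x = zv Z i.
Proof. by case: HG => _ H _; apply/H; left; exact: zv_in. Qed.

Lemma e_zv x y i : pos x = zv Z i -> pos y = zv Z i.+1 -> e x y.
Proof.
move=> Ex Ey; rewrite (@e_nb T e Z pos HZ HG x y (zd Z i)) ?Ex ?nb_zd //.
by apply: edge_on_esd => //; rewrite nb_zd // /edge_on !zv_in // next_zv // eqxx.
Qed.

Lemma connect_zv x y i j : pos x = zv Z i -> pos y = zv Z j -> connect e x y.
Proof.
wlog: x y i j / (i <= j)%N => [H|].
  case/orP: (leq_total i j) => Hij Ex Ey; first exact: (H _ _ _ _ Hij).
  by rewrite e_connect_sym; exact: (H _ _ _ _ Hij).
move/subnK <-; elim: (j - i)%N y => [|d IH] y Ex Ey.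
  by have [pI _ _] := HG; rewrite (pI x y) // Ex Ey.
have [z Ez] := exists_pos (d + i); apply: connect_trans (IH z Ex Ez) _.
exact/connect1/(e_zv Ez Ey).
Qed.

(** Interior hexagons are followed in direction (-1, 1). They are bounded, so an edge of [Z] is
    eventually met, and the corners of each hexagon are connected. *)
Lemma connect_to_cycle x : exists i y, pos y = zv Z i /\ connect e x y.
Proof.
have [k Hk] := pos_inside HZ HG x; move Eh : (hx (pos x) k) Hk => h Hh.
have [N HN] := par_bounded (zv_walk HZ).
have [m Hm] : exists m : nat, h.1 <= m%:Z - N%:Z - 1.
  by exists (`|h.1| + N + 1)%N; move: h.1 => z; lia.
elim: m h x k Eh Hh Hm => [|m IH] h x k Eh Hh Hm.
  by have [] := HN _ Hh; move: Hm; move: h.1 => z; lia.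
have [u Eu] : exists x, pos x = (h.1 - 1, h.2, false).
  by apply/(posP HZ HG); exists D0; rewrite /= subrK -surjective_pairing.
have Ehu : hx (pos u) D0 = h by rewrite Eu /= subrK -surjective_pairing.
have Cxu := connect_hexagon Hh Eh Ehu.
have [He|He] := boolP (edge_on Z (pos u) (nb (pos u) D2)).
  case/and3P: He => /zvP [i _ Ei] _ _; by exists i, u.
have := inside_jump HZ (pos u) D2; rewrite (negbTE He) Ehu Hh addTb => /negbFE H1.
have [|i [y [Ey Cy]]] := IH _ u D1 erefl H1.
  by rewrite Eu /=; move: Hm; move: h.1 => z; lia.
by exists i, y; split=> //; exact: connect_trans Cxu Cy.
Qed.

(** This rules out the default value of [gdist]: every distance is realised by a path. *)
Lemma e_connected x y : connect e x y.
Proof.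
have [i [x' [Ex Cx]]] := connect_to_cycle x.
have [j [y' [Ey Cy]]] := connect_to_cycle y.
apply: connect_trans Cx (connect_trans (connect_zv Ex Ey) _).
by rewrite e_connect_sym.
Qed.

Lemma gdist_triangle x y z : (gdist e x z <= gdist e x y + gdist e y z)%N.
Proof.
have [p [Hp Ep <-]] := gdist_path (e_connected x y).
have [q [Hq Eq <-]] := gdist_path (e_connected y z).
rewrite -size_cat -Eq -Ep -last_cat; apply: gdist_le.
by rewrite cat_path Hp Ep.
Qed.

(* A step of the lattice changes [xcoord] by at most 1, and a zigzag along a cut is
   monotone in it, hence geodesic. *)
Definition xcoord (v : hvertex) : int := v.1.1 - v.1.2.

Lemma path_xcoord x p : path e x p ->
  `|xcoord (pos (last x p)) - xcoord (pos x)| <= (size p)%:Z.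
Proof.
elim: p x => [|y p IH] x /=; first by rewrite subrr.
case/andP => /(eP HZ HG) [k Ek _] /IH.
have : `|xcoord (pos y) - xcoord (pos x)| <= 1.
  by rewrite Ek /xcoord; case: (pos x) => [[a b] []]; case: k {Ek} => /=; lia.
by move: (xcoord _) (xcoord _) (xcoord _) => t1 t2 t3; lia.
Qed.

(** Two neighbouring exterior hexagons are separated by an edge that is not in the graph, so the
    walk never uses it and the parity is the same on both sides. Exterior regions are unbounded, and
    far away the parity is even. *)
Lemma par_outside n (w : nat -> T) h : w n = w 0%N ->
  (forall i, (i < n)%N -> e (w i) (w i.+1)) -> ~~ inside Z h ->
  par n (pos \o w) h = false.
Proof.
move=> Hn He Hh; have Hw : closed_walk n (pos \o w).
  by split=> [|i /He /(eP HZ HG) [k /= -> _]]; [rewrite /= Hn|exact: hadj_nb].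
have E h1 h2 : same_region Z h1 h2 -> ~~ inside Z h1 ->
    par n (pos \o w) h1 = par n (pos \o w) h2.
  elim=> [x y [u [v [/hadjP [k ->]]]]|//|x y z R IH1 _ IH2 Hx].
    move=> Hon; rewrite !is_sideE => s1 s2 Hx.
    have Hs : ~~ esd Z u k.
      have := inside_jump HZ u k; rewrite /esd (negbTE Hon).
      by case/orP: s1 Hx => /eqP ->;
        case: (inside Z (hx u (nx k))) (inside Z (hx u (nx (nx k)))) => [] [].
    have J : par n (pos \o w) (hx u (nx k)) = par n (pos \o w) (hx u (nx (nx k))).
      apply: addb_false_eq; rewrite par_jump // /xsum big1 // => i _.
      apply: contraNF Hs; have := He _ (ltn_ord i); case/(eP HZ HG) => j /= -> Hj.
      case/orP => /andP [/eqP E1].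
        by rewrite -E1 (inj_eq (@nb_inj _)) => /eqP <-.
      move=> /eqP E2; move: Hj; rewrite -(esd_nb _ u k) -E1.
      suff -> : j = k by [].
      by apply: (@nb_inj (pos (w i))); rewrite E2 E1 nbK.
    by case/orP: s1 => /eqP ->; case/orP: s2 => /eqP ->.
  by rewrite IH1 // IH2 // -(same_region_inside HZ R).
have [N HN] := par_bounded Hw.
have [h' R Hh'] := outside_unbounded HZ Hh N; rewrite (E _ _ R Hh).
apply/negP => /HN [+ _]; by move: Hh'; move: h'.1 => z; lia.
Qed.

End Connectivity.

(* The edges of direction [D2] at the positions [a0], ..., [a1] of the line
   [a + b = m] of the lattice. *)
Definition in_cut (m a0 a1 : int) (u v : hvertex) : bool :=
  [&& u.1 == v.1, u.1.1 + u.1.2 == m & a0 <= u.1.1 <= a1].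

Definition is_cut (Z : seq hvertex) (m a0 a1 : int) : Prop :=
  [/\ a0 < a1, forall a, a0 <= a < a1 -> inside Z (a + 1, m - a),
      ~~ inside Z (a0, m - a0 + 1) & ~~ inside Z (a1 + 1, m - a1)].

Section Cut.

Variables (T : finType) (e : rel T) (Z : seq hvertex) (pos : T -> hvertex).
Hypothesis HZ : lattice_cycle Z.
Hypothesis HG : [/\ injective pos,
        forall v, vertex_within Z v <-> exists x, pos x = v
      & forall x y, e x y <-> edge_within Z (pos x) (pos y)].

Variables m a0 a1 : int.
Hypothesis HC : is_cut Z m a0 a1.

Let inC := in_cut m a0 a1.

Definition uncut : rel T := [rel x y | e x y && ~~ inC (pos x) (pos y)].

Lemma in_cutC u v : inC u v = inC v u.
Proof.
by rewrite /inC /in_cut [v.1 == _]eq_sym; case: (eqVneq u.1 v.1) => [->|].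
Qed.

Lemma uncut_sym : symmetric uncut.
Proof. by move=> x y; rewrite /uncut /= (e_sym HZ HG) in_cutC. Qed.

Lemma uncut_connect_sym : connect_sym uncut.
Proof. exact/sym_connect_sym/uncut_sym. Qed.

Lemma in_cutP x y : e x y -> inC (pos x) (pos y) -> exists a s,
  [/\ a0 <= a <= a1, pos x = (a, m - a, s) & pos y = (a, m - a, ~~ s)].
Proof.
case/(eP HZ HG) => k Ey _ /and3P [E /eqP Em Ha].
exists (pos x).1.1, (pos x).2; split=> //.
  by move: Em; case: (pos x) => [[a b] s] /= <-; congr pair; congr pair; lia.
move: E Em; rewrite Ey; case: (pos x) => [[a b] s] /=.
by case: s; case: k {Ey} => /=; rewrite ?xpair_eqE /= => E <-;
  congr pair; congr pair; lia.
Qed.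

(** The cut is the difference of two rays on one line, issued from the exterior hexagons beyond its
    two ends. *)
Lemma odd_cut n (w : nat -> T) : w n = w 0%N ->
  (forall i, (i < n)%N -> e (w i) (w i.+1)) -> xsum n (pos \o w) inC = false.
Proof.
move=> Hn He; case: HC => Ha Hin Hl Hr.
have -> : xsum n (pos \o w) inC = xsum n (pos \o w) (fun u v =>
    crosses (a1 + 1, m - a1) u v (+) crosses (a0, m - a0 + 1) u v).
  apply: eq_bigr => i _; rewrite /inC /in_cut /crosses.
  case: eqP => //= _; move: (pos (w i)).1 => [a b] /=; lia.
by rewrite xsum_add -!/(par _ _ _) !(par_outside HZ HG Hn He).
Qed.

(** A path avoiding the cut, closed by the edge [uv], would cross the cut exactly once. *)
Lemma cut_separates u v : e u v -> inC (pos u) (pos v) -> connect uncut u v = false.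
Proof.
move=> euv Huv; apply/negP => /connectP [p /(pathP u) Hp Ev].
pose w i := nth u (u :: p) i.
have := @odd_cut (size p).+1 w.
have Ew1 : w (size p) = v by rewrite Ev (last_nth u).
have Ew2 : w (size p).+1 = u by rewrite /w nth_default.
rewrite /xsum big_ord_recr /= big1 => [|i _]; last first.
  by have /andP [_ /negbTE] := Hp _ (ltn_ord i).
rewrite Ew1 Ew2 in_cutC Huv => H; suff: true = false by [].
apply: H => // i; rewrite ltnS leq_eqVlt => /orP [/eqP ->|Hi].
  by rewrite Ew1 Ew2 (e_sym HZ HG).
by have /andP [] := Hp _ Hi.
Qed.

Lemma cut_esd a s : a0 <= a <= a1 -> esd Z (a, m - a, s) D2.
Proof.
case: HC => Ha Hin _ _ Hb; rewrite /esd /=.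
have [E|E] := eqVneq a a1; last first.
  by have := Hin a; case: s => /= ->; rewrite ?orbT //; lia.
have := Hin (a - 1); rewrite subrK (_ : m - (a - 1) = m - a + 1); last by lia.
by case: s => /= ->; rewrite ?orbT //; lia.
Qed.

Lemma exists_cut_vertex a s : a0 <= a <= a1 -> exists x, pos x = (a, m - a, s).
Proof.
move=> Hb; apply/(posP HZ HG); have := cut_esd s Hb.
by rewrite /esd; case/orP => H; eexists; exact: H.
Qed.

(* The two sides of a cut are zigzags through the hexagons of the cut. *)
Lemma zigzag_step x y a s : a0 <= a < a1 -> pos x = (a, m - a, s) ->
  pos y = (a + 1, m - (a + 1), s) -> exists2 z, uncut x z & uncut z y.
Proof.
move=> Hb Ex Ey; case: HC => _ /(_ _ Hb) Hh _ _.
pose k := if s then D0 else D1; pose j := if s then D1 else D0.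
have H1 : esd Z (pos x) k.
  by rewrite Ex /esd /k; move: Hh; case: (s) => /= ->; rewrite ?orbT.
have [z Ez exz] := e_ex HZ HG H1.
have Eyz : pos y = nb (pos z) j.
  by rewrite Ez Ex Ey /k /j; case: (s) => /=; congr pair; congr pair; lia.
have H2 : esd Z (pos z) j.
  rewrite Ez Ex /esd /k /j; move: Hh; case: (s) => /= Hh.
    by rewrite Hh.
  by rewrite (_ : m - a - 1 + 1 = m - a) ?Hh ?orbT //; lia.
exists z; apply/andP; split=> //=.
- by rewrite Ez Ex /inC /in_cut /k; case: (s); rewrite /= ?xpair_eqE; lia.
- by rewrite (e_nb HZ HG Eyz).
- by rewrite Eyz Ez Ex /inC /in_cut /k /j; case: (s); rewrite /= ?xpair_eqE; lia.
Qed.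

Lemma zigzag_path x y a (d : nat) s : a0 <= a -> a + d%:Z <= a1 ->
  pos x = (a, m - a, s) -> pos y = (a + d%:Z, m - (a + d%:Z), s) ->
  exists p, [/\ path uncut x p, last x p = y & size p = (2 * d)%N].
Proof.
move=> H0; elim: d y => [|d IH] y H1 Ex Ey.
  exists [::]; split=> //=; have [pI _ _] := HG; apply: pI.
  by rewrite Ex Ey addr0.
have [|z Ez] := @exists_cut_vertex (a + d%:Z) s; first by lia.
have [|p [Hp Ep Sp]] := IH z _ Ex Ez; first by lia.
have [|||t H2 H3] := @zigzag_step z y (a + d%:Z) s; [by lia|by []| |].
  by rewrite Ey; congr pair; congr pair; lia.
exists (p ++ [:: t; y]); split.
- by rewrite cat_path Hp Ep /= H2 H3.
- by rewrite last_cat.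
- by rewrite size_cat Sp /=; lia.
Qed.

Lemma sub_uncut x p : path uncut x p -> path e x p.
Proof. by apply: sub_path => u v /andP []. Qed.

Lemma cut_side x y a b s : a0 <= a <= a1 -> a0 <= b <= a1 ->
  pos x = (a, m - a, s) -> pos y = (b, m - b, s) ->
  connect uncut x y /\ (gdist e x y <= 2 * `|a - b|)%N.
Proof.
wlog: x y a b / a <= b => [H Ha Hb Ex Ey|Hab Ha Hb Ex Ey].
  have [Hab|Hab] := leP a b; first exact: H.
  have [C D] := H y x b a (ltW Hab) Hb Ha Ey Ex.
  split; first by rewrite uncut_connect_sym.
  rewrite (gdist_sym (e_sym HZ HG)); apply: leq_trans D _; lia.
have [d Ed] : exists d : nat, b = a + d%:Z by exists `|b - a|%N; lia.
have [|||| p [Hp Ep Sp]] := @zigzag_path x y a d s; rewrite -?Ed //; try lia.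
split; first by apply/connectP; exists p.
rewrite -Ep; apply: leq_trans (gdist_le (sub_uncut Hp)) _; lia.
Qed.

Section Sides.

Variables u v : T.
Hypotheses (euv : e u v) (Huv : inC (pos u) (pos v)).

Lemma cut_disjoint x : connect uncut x u -> connect uncut x v = false.
Proof.
move=> Cu; apply: contraFF (cut_separates euv Huv); apply: connect_trans.
by rewrite uncut_connect_sym.
Qed.

Lemma cut_cover x : connect uncut x u || connect uncut x v.
Proof.
have /connectP [p Hp Eu] := e_connected HZ HG x u.
elim: p x Hp Eu => [|y p IH] x /=; first by move=> _ <-; rewrite connect0.
case/andP => exy Hp /(IH _ Hp) {IH} H.
have [Hc|Hc] := boolP (inC (pos x) (pos y)); last first.
  have C : connect uncut x y by apply: connect1; rewrite /uncut /= exy.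
  by case/orP: H => H; rewrite (connect_trans C H) ?orbT.
have [a [s [Ha Ea _]]] := in_cutP exy Hc.
have [b [t [Hb Eb Ev]]] := in_cutP euv Huv.
have [E|E] := eqVneq s t; apply/orP; [left|right].
  by rewrite -E in Eb; have [] := cut_side Ha Hb Ea Eb.
have Es : s = ~~ t by move: E; case: (s); case: (t).
by rewrite -Es in Ev; have [] := cut_side Ha Hb Ea Ev.
Qed.

Lemma cut_connectC x : connect uncut x v = ~~ connect uncut x u.
Proof.
have := cut_cover x; case E: (connect uncut x u) => //=.
by rewrite (cut_disjoint E).
Qed.

(** Were [xy] oriented against [uv], a zigzag would join [x] to [v], which is on the other side. *)
Lemma cut_parallel x y : e x y -> connect uncut x u -> ~~ connect uncut y u ->
  exists a b s, [/\ a0 <= a <= a1, a0 <= b <= a1,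
     pos u = (a, m - a, s) /\ pos v = (a, m - a, ~~ s) &
     pos x = (b, m - b, s) /\ pos y = (b, m - b, ~~ s)].
Proof.
move=> exy Cx Cy; have Hc : inC (pos x) (pos y).
  apply: contraNT Cy => H; apply: connect_trans Cx.
  by rewrite uncut_connect_sym; apply: connect1; rewrite /uncut /= exy.
have [b [t [Hb Ex Ey]]] := in_cutP exy Hc.
have [a [s [Ha Eu Ev]]] := in_cutP euv Huv.
have [E|E] := eqVneq s t; first by exists a, b, s; rewrite E in Eu Ev *.
have Es : t = ~~ s by move: E; case: (s); case: (t).
rewrite Es in Ex; have [H _] := cut_side Hb Ha Ex Ev.
by move: (cut_disjoint Cx); rewrite H.
Qed.

Lemma cut_closer x : connect uncut x u -> (gdist e x u < gdist e x v)%N.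
Proof.
move=> Cx; have [p [Hp Ep <-]] := gdist_path (e_connected HZ HG x v).
have [|p1 [y [z [p2 [Ep12 Ey Ay Az eyz]]]]] :=
  @path_crossing T e (fun y => connect uncut y u) x p Hp Cx.
  by rewrite Ep -cut_connectC connect0.
have [a [b [s [Ha Hb [Eu Ev] [Eyp Ez]]]]] := cut_parallel eyz Ay Az.
rewrite Ep12 size_cat /=; rewrite Ep12 cat_path /= in Hp.
case/and3P: Hp => Hp1 _ Hp2.
have D1 : (gdist e x y <= size p1)%N by rewrite -Ey; exact: gdist_le.
have [_ D2] := cut_side Hb Ha Eyp Eu.
(* On the cut [xcoord] is [2 a - m], so the rest of the path, from [z] to [v], is at least as long
   as the zigzag from [y] to [u]; the crossing edge is saved. *)
have := path_xcoord HZ HG Hp2; rewrite Ep12 last_cat /= in Ep.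
rewrite Ep Ev Ez /xcoord /= => D3.
have := gdist_triangle HZ HG x y u; lia.
Qed.

End Sides.

Lemma cut_closerE u v x : e u v -> inC (pos u) (pos v) ->
  (gdist e x u < gdist e x v)%N = connect uncut x u.
Proof.
move=> euv Huv; apply/idP/idP; last exact: cut_closer.
apply: contraTT; rewrite -(cut_connectC euv Huv) -leqNgt => H; apply: ltnW.
by apply: (cut_closer _ _ H); [rewrite (e_sym HZ HG)|rewrite in_cutC].
Qed.

Lemma n_closer_cut u v : e u v -> inC (pos u) (pos v) ->
  n_closer e u v = #|[set x | connect uncut x u]|.
Proof. by move=> euv Huv; apply: eq_card => x; rewrite !inE (cut_closerE _ euv Huv). Qed.

(** The edges of the cut are equidistant from [u] and [v], both distances being the zigzag length
    [2 |a - b|]; hence they are counted on neither side. *)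
Lemma gdist_cut u v x y : e u v -> inC (pos u) (pos v) -> e x y ->
  connect uncut x u -> connect uncut y v ->
  gdist_edge e u (x, y) = gdist_edge e v (x, y).
Proof.
move=> euv Huv exy Cx; rewrite (cut_connectC euv Huv) => Cy.
have [a [b [s [Ha Hb [Eu Ev] [Ex Ey]]]]] := cut_parallel euv Huv exy Cx Cy.
have H x' y' t t' c d : a0 <= c <= a1 -> a0 <= d <= a1 ->
    pos x' = (c, m - c, t) -> pos y' = (d, m - d, t') ->
    (2 * `|c - d| <= gdist e x' y')%N.
  move=> Hc Hd Ex' Ey'; have [p [Hp Ep <-]] := gdist_path (e_connected HZ HG x' y').
  have := path_xcoord HZ HG Hp; rewrite Ep Ex' Ey' /xcoord /=; lia.
have [_ D1] := cut_side Ha Hb Eu Ex; have [_ D2] := cut_side Ha Hb Ev Ey.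
have D3 := H _ _ _ _ _ _ Ha Hb Eu Ex; have D4 := H _ _ _ _ _ _ Ha Hb Ev Ey.
have D5 := H _ _ _ _ _ _ Ha Hb Eu Ey; have D6 := H _ _ _ _ _ _ Ha Hb Ev Ex.
rewrite /gdist_edge /=; lia.
Qed.

Lemma m_closer_cut u v : e u v -> inC (pos u) (pos v) ->
  m_closer e u v = #|[set f in gedges e | connect uncut f.1 u && connect uncut f.2 u]|.
Proof.
move=> euv Huv; apply: eq_card => -[x y]; rewrite !inE /=.
case exy: (e x y) => //=; case: (_ < _)%N => //=.
have Hvu : inC (pos v) (pos u) by rewrite in_cutC.
have evu : e v u by rewrite (e_sym HZ HG).
have E z : (gdist e u z < gdist e v z)%N = connect uncut z u.
  by rewrite !(gdist_sym (e_sym HZ HG) _ z) (cut_closerE _ euv Huv).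
have E' z : (gdist e v z < gdist e u z)%N = connect uncut z v.
  by rewrite !(gdist_sym (e_sym HZ HG) _ z) (cut_closerE _ evu Hvu).
have [Cx|Cx] := boolP (connect uncut x u); have [Cy|Cy] := boolP (connect uncut y u).
- by move: Cx Cy; rewrite -!E /gdist_edge /=; lia.
- rewrite -(cut_connectC euv Huv) in Cy.
  by rewrite (gdist_cut euv Huv exy Cx Cy) ltnn.
- rewrite -(cut_connectC euv Huv) in Cx; rewrite (e_sym HZ HG) in exy.
  have := gdist_cut euv Huv exy Cy Cx; rewrite /gdist_edge /= minnC => ->.
  by rewrite minnC ltnn.
- move: Cx Cy; rewrite -!(cut_connectC euv Huv) -!E' /gdist_edge /=; lia.
Qed.

End Cut.

(** * Counting along the boundary *)

(* The zigzags obtained by deleting the edges of direction [D2] are oriented so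
   that [2 a + s] increases. *)
Definition rdir (v : hvertex) : dir := if v.2 then D0 else D1.
Definition ldir (v : hvertex) : dir := if v.2 then D1 else D0.

(* If [G - wt] at the right neighbour of [v] is [G v], the sum of [wt] over a
   zigzag telescopes to the sum of [ends G wt] over its two end vertices. *)
Definition ends (Z : seq hvertex) (G wt : hvertex -> int) (v : hvertex) : int :=
  (if esd Z v (rdir v) then 0 else G v) - (if esd Z v (ldir v) then 0 else G v - wt v).

(** [2 a + s + 1] numbers the vertices along a zigzag from an arbitrary origin. Similarly, [a + 1]
    in [false_ends] numbers those with [s] false. *)
Definition vertex_ends (Z : seq hvertex) : hvertex -> int :=
  ends Z (fun v => 2 * v.1.1 + (v.2 : nat)%:Z + 1) (fun=> 1).

Definition false_ends (Z : seq hvertex) : hvertex -> int :=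
  ends Z (fun v => v.1.1 + 1) (fun v => (~~ v.2 : nat)%:Z).

(* Every edge has one end [v] with [v.2 = false]; such a [v] has degree 3, or 2 if
   it is deficient. *)
Definition edge_ends (Z : seq hvertex) (v : hvertex) : int :=
  3 * false_ends Z v - (deficient Z v && ~~ v.2 : nat)%:Z.

(** Step [t] joins vertices [t] and [t + 1], and steps are numbered from 1, which leaves 0 to mean
    no step. The arc between steps [lo] and [hi] then consists of the vertices [lo + 1], ..., [hi],
    a difference of two prefixes. *)
Definition vsum (Z : seq hvertex) (t : nat) : int :=
  \sum_(i < t) vertex_ends Z (zv Z i.+1).

Definition esum (Z : seq hvertex) (t : nat) : int :=
  \sum_(i < t) edge_ends Z (zv Z i.+1).

Lemma sum_arc (F : nat -> int) x y t : (x <= y)%N -> (y <= t)%N ->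
  \sum_(i < t | (x <= i < y)%N) F i = \sum_(i < y) F i - \sum_(i < x) F i.
Proof.
move=> Hxy Hyt; rewrite -!(big_mkord xpredT) -(big_mkord (fun i => x <= i < y)%N).
rewrite (big_cat_nat (n := x) (m := 0) (p := y)) //= addrAC subrr add0r.
rewrite (big_cat_nat (n := x)) //=; last exact: leq_trans Hyt.
rewrite (big_cat_nat (n := y) (m := x)) //=.
rewrite big_nat_cond big_pred0 => [|i]; last by lia.
rewrite add0r [X in _ + X]big_nat_cond [X in _ + X]big_pred0 => [|i]; last by lia.
by rewrite addr0 big_nat_cond [RHS]big_nat_cond; apply: eq_bigl => i; lia.
Qed.

Section Counting.

Variables (T : finType) (e : rel T) (Z : seq hvertex) (pos : T -> hvertex).
Hypothesis HZ : lattice_cycle Z.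
Hypothesis HG : [/\ injective pos,
        forall v, vertex_within Z v <-> exists x, pos x = v
      & forall x y, e x y <-> edge_within Z (pos x) (pos y)].

Let n := size Z.

Lemma sum_nb (R : nmodType) (g : hvertex -> R) x k :
  \sum_(y | (pos y == nb (pos x) k) && e x y) g (pos y) =
  if esd Z (pos x) k then g (nb (pos x) k) else 0.
Proof.
rewrite (eq_bigr (fun=> g (nb (pos x) k))) => [|y /andP [/eqP -> //]].
transitivity (\sum_(y in [set y | (pos y == nb (pos x) k) && e x y]) g (nb (pos x) k)).
  by apply: eq_bigl => y; rewrite inE.
by rewrite sumr_const (esd_card HZ HG); case: (esd _ _ _).
Qed.

Lemma rdirP v w : (w == nb v (rdir v)) = (v == nb w (ldir w)).
Proof.
apply/eqP/eqP => ->; first by case: v => [[a b] []] /=; congr pair; congr pair; lia.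
by case: w => [[a b] []] /=; congr pair; congr pair; lia.
Qed.

Lemma sum_shift (A : pred T) (f : hvertex -> int) :
  (forall x y, e x y -> pos y = nb (pos x) (rdir (pos x)) -> A x = A y) ->
  \sum_(x | A x) (if esd Z (pos x) (rdir (pos x)) then f (nb (pos x) (rdir (pos x))) else 0) =
  \sum_(y | A y) (if esd Z (pos y) (ldir (pos y)) then f (pos y) else 0).
Proof.
move=> HA; under eq_bigr => x _ do rewrite -sum_nb.
transitivity (\sum_x \sum_(y | [&& A y, pos y == nb (pos x) (rdir (pos x)) & e x y])
    f (pos y)).
  rewrite big_mkcond; apply: eq_bigr => x _; case Ax: (A x).
    apply: eq_bigl => y; case: eqP => [E|]; rewrite ?andbF //=.
    by case exy: (e x y); rewrite ?andbF // -(HA _ _ exy E) Ax.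
  rewrite big_pred0 // => y; case: eqP => [E|]; rewrite ?andbF //=.
  by case exy: (e x y); rewrite ?andbF // -(HA _ _ exy E) Ax.
rewrite (exchange_big_dep A) /=; last by move=> x y _ /andP [].
apply: eq_bigr => y Ay.
rewrite -(sum_nb (fun=> f (pos y))); apply: eq_bigl => x.
by rewrite Ay rdirP (e_sym HZ HG).
Qed.

(** A discrete Green formula. [A] has to be respected only by edges of directions [D0] and [D1], so
    it may be one side of a cut. *)
Lemma green (A : pred T) (G wt : hvertex -> int) :
  (forall x y, e x y -> pos y = nb (pos x) (rdir (pos x)) -> A x = A y) ->
  (forall v, G (nb v (rdir v)) - wt (nb v (rdir v)) = G v) ->
  \sum_(x | A x) wt (pos x) = \sum_(x | A x) ends Z G wt (pos x).
Proof.
move=> HA HW; apply/eqP; rewrite -subr_eq0 -sumrB.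
under eq_bigr => x _.
  have -> : wt (pos x) - ends Z G wt (pos x) =
      (if esd Z (pos x) (rdir (pos x)) then
         G (nb (pos x) (rdir (pos x))) - wt (nb (pos x) (rdir (pos x))) else 0) -
      (if esd Z (pos x) (ldir (pos x)) then G (pos x) - wt (pos x) else 0).
    by rewrite /ends HW; case: (esd _ _ _); case: (esd _ _ _); lia.
  over.
by rewrite sumrB (sum_shift (fun v => G v - wt v) HA) subrr.
Qed.

Lemma esd_deficient v k : ~~ esd Z v k -> deficient Z v.
Proof. by rewrite /deficient; case: k => /negbTE ->; rewrite ?andbF. Qed.

Lemma ends0 G wt v : ~~ deficient Z v -> ends Z G wt v = 0.
Proof.
move=> H; rewrite /ends.
have E k : esd Z v k by apply: contraNT H; exact: esd_deficient.
by rewrite !E subrr.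
Qed.

Lemma deficient_on_cycle x : deficient Z (pos x) -> pos x \in Z.
Proof.
rewrite /deficient !negb_and => /or3P [] H; exact: (missing_on_cycle HZ HG H).
Qed.

Variable zt : nat -> T.
Hypothesis Hzt : forall i, pos (zt i) = zv Z i.

Lemma sum_cycle (A : pred T) (F : hvertex -> int) :
  (forall v, ~~ deficient Z v -> F v = 0) ->
  \sum_(x | A x) F (pos x) = \sum_(i < n | A (zt i.+1)) F (zv Z i.+1).
Proof.
move=> HF; have n0 : (0 < n)%N by exact: size_cycle_gt0.
transitivity (\sum_(x | A x) \sum_(i < n | x == zt i.+1) F (pos x)).
  apply: eq_bigr => x _; have [H|H] := boolP (pos x \in Z); last first.
    rewrite HF; last by apply: contra H; exact: deficient_on_cycle.
    by rewrite big1.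
  have [j Hj Ej] := zvP H.
  (* Vertex [j] of the cycle is summed at the index [j - 1] modulo [n]. *)
  have Hi : ((j + n.-1) %% n < n)%N by rewrite ltn_mod.
  rewrite (big_pred1 (Ordinal Hi)) // => i /=.
  have [pI _ _] := HG; rewrite -(inj_eq pI) Hzt Ej zv_eq //.
  have Eq : ((j + n.-1) %% n + 1 = j %[mod n])%N.
    by rewrite modnDml -addnA addn1 prednK // modnDr.
  rewrite -val_eqE /= -[i.+1]addn1 -Eq eqn_modDr (modn_small Hi).
  by rewrite (modn_small (ltn_ord i)) eq_sym.
rewrite (exchange_big_dep (fun i : 'I_n => A (zt i.+1))) /=; last first.
  by move=> x i Ax /eqP <-.
apply: eq_bigr => i Ai; rewrite -Hzt (big_pred1 (zt i.+1)) // => x /=.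
by case: eqP => [->|]; rewrite ?Ai ?andbF.
Qed.

(** The lattice is bipartite, so an edge can be listed from its [false] end instead of from its end
    of smaller rank. *)
Lemma sum_gedges (R : nmodType) (F : T -> T -> R) : (forall x y, F x y = F y x) ->
  \sum_(f in gedges e) F f.1 f.2 = \sum_(x | ~~ (pos x).2) \sum_(y | e x y) F x y.
Proof.
move=> FC; transitivity (\sum_x \sum_y
    if e x y && (enum_rank x < enum_rank y)%N then F x y else 0).
  rewrite pair_big /= big_mkcond; apply: eq_bigr => -[x y] _ /=.
  by rewrite inE.
have side x y : e x y -> (pos y).2 = ~~ (pos x).2.
  by case/(eP HZ HG) => k -> _; rewrite nb_side.
transitivity (\sum_x \sum_y
   ((if [&& e x y, (enum_rank x < enum_rank y)%N & ~~ (pos x).2] then F x y else 0) +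
    (if [&& e x y, (enum_rank x < enum_rank y)%N & (pos x).2] then F x y else 0))).
  apply: eq_bigr => x _; apply: eq_bigr => y _.
  by case: (e x y); case: (_ < _)%N; case: (pos x).2; rewrite /= ?addr0 ?add0r.
under eq_bigr => x _ do rewrite big_split.
rewrite big_split /= [X in _ + X]exchange_big /= -big_split [RHS]big_mkcond /=.
apply: eq_bigr => x _; rewrite -big_split /= [in RHS]big_mkcond /=.
case Px: (pos x).2 => /=.
  rewrite big1 // => y _; rewrite !andbF add0r.
  by case: ifP => // /and3P [/side]; rewrite Px; case: (pos y).2.
apply: eq_bigr => y _; rewrite andbT (e_sym HZ HG y x).
case exy: (e x y); rewrite /= ?addr0 //.
rewrite (side _ _ exy) Px andbT; case: (ltngtP (enum_rank x) (enum_rank y)) => H.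
- by rewrite addr0.
- by rewrite add0r FC.
- by move: (side _ _ exy); rewrite (enum_rank_inj (val_inj H)); case: (_.2).
Qed.

End Counting.

(** * Degree sum and sides of one cut *)

Definition at_step (Z : seq hvertex) (m a : int) (j : nat) : Prop :=
  [/\ (0 < j <= size Z)%N, zd Z j = D2 & (zv Z j).1 = (a, m - a)].

Lemma Posz_sum (I : Type) (r : seq I) (P : pred I) (F : I -> nat) :
  (\sum_(i <- r | P i) F i)%:Z = \sum_(i <- r | P i) (F i)%:Z.
Proof. exact: (big_morph Posz PoszD (erefl (Posz 0))). Qed.

Section CutCount.

Variables (T : finType) (e : rel T) (Z : seq hvertex) (pos : T -> hvertex).
Hypothesis HZ : lattice_cycle Z.
Hypothesis HG : [/\ injective pos,
        forall v, vertex_within Z v <-> exists x, pos x = v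
      & forall x y, e x y <-> edge_within Z (pos x) (pos y)].
Variable zt : nat -> T.
Hypothesis Hzt : forall i, pos (zt i) = zv Z i.

Let n := size Z.

Lemma deg_false_sum (A : pred T) :
  (forall x y, e x y -> pos y = nb (pos x) (rdir (pos x)) -> A x = A y) ->
  \sum_(x | ~~ (pos x).2 && A x) (gdeg e x)%:Z =
  \sum_(i < n | A (zt i.+1)) edge_ends Z (zv Z i.+1).
Proof.
move=> HA; rewrite -(sum_cycle HZ HG Hzt A (F := edge_ends Z)); last first.
  by move=> v Hv; rewrite /edge_ends /false_ends ends0 // (negbTE Hv) mulr0 subr0.
rewrite /edge_ends /false_ends sumrB -mulr_sumr -(green HZ HG HA); last first.
  by case=> [[a b] []]; rewrite /rdir /=; lia.
rewrite big_andbC big_mkcondr /= mulr_sumr -sumrB; apply: eq_bigr => x _.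
by have := gdegE HZ HG x; case: (pos x).2; case: (deficient _ _) => /=; lia.
Qed.

Lemma card_gedges : #|gedges e|%:Z = esum Z n.
Proof.
have := @deg_false_sum predT (fun _ _ _ _ => erefl); rewrite -[RHS]/(esum Z n) => <-.
rewrite -sum1_card Posz_sum (sum_gedges HZ HG (F := fun _ _ => 1%:Z)) //.
under [RHS]eq_bigl do rewrite andbT.
apply: eq_bigr => x _; rewrite /gdeg -sum1_card Posz_sum.
by apply: eq_bigl => y; rewrite inE.
Qed.

Lemma card_vertices : #|T|%:Z = vsum Z n.
Proof.
rewrite /vsum -(sum_cycle HZ HG Hzt predT (F := vertex_ends Z)); last exact: ends0.
rewrite -(green HZ HG) //; last by case=> [[a b] []]; rewrite /rdir /=; lia.
by rewrite -sum1_card Posz_sum.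
Qed.

Variables m a0 a1 : int.
Hypothesis HC : is_cut Z m a0 a1.

Let inC := in_cut m a0 a1.
Let unc := uncut e pos m a0 a1.

Lemma sum_cut (H : hvertex -> hvertex -> int) :
  \sum_(x | ~~ (pos x).2) \sum_(y | e x y && inC (pos x) (pos y)) H (pos x) (pos y) =
  \sum_(k < `|a1 - a0 + 1|)
     H (a0 + k%:Z, m - (a0 + k%:Z), false) (a0 + k%:Z, m - (a0 + k%:Z), true).
Proof.
have [Ha _ _ _] := HC; set c := `|_|%N.
have Hc k : (k < c)%N -> a0 <= a0 + k%:Z <= a1 by rewrite /c; lia.
have [g Hg] : exists g : 'I_c -> T, forall k, pos (g k) = (a0 + k%:Z, m - (a0 + k%:Z), false).
  apply: (@fin_all_exists 'I_c (fun=> T) (fun k x => pos x = (a0 + k%:Z, m - (a0 + k%:Z), false))).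
  by move=> k; exact: (exists_cut_vertex HZ HG HC false (Hc _ (ltn_ord k))).
have gI : injective g.
  by move=> k l E; apply/val_inj; have := Hg k; rewrite E Hg => -[] /=; lia.
transitivity (\sum_(x in g @: 'I_c) H (pos x) (nb (pos x) D2)); last first.
  by rewrite big_imset /=; [apply: eq_bigr => k _; rewrite Hg|move=> ? ? _ _; exact: gI].
rewrite big_mkcond [RHS]big_mkcond; apply: eq_bigr => x _.
case: imsetP => [[k _ ->]|Hn].
  rewrite Hg /= -Hg -[RHS]addr0.
  have Hk := Hc _ (ltn_ord k).
  transitivity (\sum_(y | (pos y == nb (pos (g k)) D2) && e (g k) y) H (pos (g k)) (pos y)).
    apply: eq_bigl => y; rewrite andbC; case exy: (e _ _); rewrite ?andbF // !andbT.
    case/(eP HZ HG): exy => j -> _; rewrite (inj_eq (@nb_inj _)) -(inj_eq (can_inj codeK)) Hg /inC /in_cut.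
    by case: j; rewrite /= ?xpair_eqE; lia.
  rewrite (sum_nb HZ HG (fun v => H (pos (g k)) v)) Hg (cut_esd HZ HC) //.
  by rewrite addr0.
case: ifPn => // Px; rewrite big_pred0 // => y; apply/negbTE/negP => /andP [exy].
case/(in_cutP HZ HG exy) => a [s [Hs Ex _]]; apply: Hn.
have Hk : (`|a - a0| < c)%N by rewrite /c; lia.
exists (Ordinal Hk) => //; have [pI _ _] := HG; apply: pI; rewrite Hg /= Ex.
by move: Px; rewrite Ex /= => /negbTE ->; congr pair; congr pair; lia.
Qed.

(** The degree sum over the cut. An inner edge lies between two interior hexagons, so no edge is
    missing at its ends; only the extreme edges, at steps [j0] and [j1], can contribute less than
    6. *)
Definition cut_weight (j0 j1 : nat) : int := 6 * (a1 - a0 + 1)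
  - (deficient Z (zv Z j0) : nat)%:Z - (deficient Z (zv Z j0.+1) : nat)%:Z
  - (deficient Z (zv Z j1) : nat)%:Z - (deficient Z (zv Z j1.+1) : nat)%:Z.

Lemma at_stepS a j : at_step Z m a j -> exists s,
  zv Z j = (a, m - a, s) /\ zv Z j.+1 = (a, m - a, ~~ s).
Proof.
case=> _ Hd E; exists (zv Z j).2; rewrite -(nb_zd HZ) Hd -E.
by case: (zv Z j) => [[? ?] []].
Qed.

Lemma sum_cut_weight j0 j1 : at_step Z m a0 j0 -> at_step Z m a1 j1 ->
  \sum_(x | ~~ (pos x).2) \sum_(y | e x y && inC (pos x) (pos y))
     (gdeg e x + gdeg e y)%:Z = cut_weight j0 j1.
Proof.
move=> /at_stepS [s0 [E0 E0']] /at_stepS [s1 [E1 E1']].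
have [Ha Hin _ _] := HC.
pose D a : int := (deficient Z (a, m - a, false) : nat)%:Z + (deficient Z (a, m - a, true) : nat)%:Z.
pose H u v : int := 6 - (deficient Z u : nat)%:Z - (deficient Z v : nat)%:Z.
transitivity (\sum_(x | ~~ (pos x).2) \sum_(y | e x y && inC (pos x) (pos y)) H (pos x) (pos y)).
  apply: eq_bigr => x _; apply: eq_bigr => y _; rewrite /H.
  by have := gdegE HZ HG x; have := gdegE HZ HG y; lia.
rewrite sum_cut.
have [c Ec] : exists c : nat, a1 - a0 + 1 = c.+2%:Z by exists (absz (a1 - a0 - 1)%R); lia.
transitivity (\sum_(k < c.+2) (6 - D (a0 + k%:Z))).
  by rewrite Ec; apply: eq_bigr => k _; rewrite /H /D -addrA -opprD.
rewrite big_ord_recl big_ord_recr /= (eq_bigr (fun=> 6)); last first.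
  move=> k _; rewrite /bump /= add1n; suff -> : D (a0 + k.+1%:Z) = 0 by rewrite subr0.
  have Hk := ltn_ord k.
  have I1 := Hin (a0 + k.+1%:Z); have I2 := Hin (a0 + k%:Z).
  rewrite /D /deficient /esd /=.
  rewrite (_ : a0 + k%:Z + 1 = a0 + k.+1%:Z) in I2; last by lia.
  rewrite (_ : m - (a0 + k%:Z) = m - (a0 + k.+1%:Z) + 1) in I2; last by lia.
  by rewrite I1 ?I2 ?orbT //; lia.
rewrite sumr_const card_ord addr0.
rewrite (_ : a0 + (bump 0 c)%:Z = a1); last by rewrite /bump; lia.
have DE a s : (deficient Z (a, m - a, s) : nat)%:Z + (deficient Z (a, m - a, ~~ s) : nat)%:Z = D a.
  by rewrite /D; case: s => //=; rewrite addrC.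
have := DE a0 s0; have := DE a1 s1; rewrite -E0 -E0' -E1 -E1' /cut_weight Ec.
move: (deficient _ _ : nat) (deficient _ _ : nat) (deficient _ _ : nat)
   (deficient _ _ : nat) (D _) (D _) => d1 d2 d3 d4 d5 d6; lia.
Qed.

Lemma card_cut : \sum_(x | ~~ (pos x).2) \sum_(y | e x y && inC (pos x) (pos y)) 1 =
  a1 - a0 + 1.
Proof. by rewrite (sum_cut (fun _ _ => 1)) sumr_const card_ord; have [] := HC; lia. Qed.

Section Side.

Variable r : T.

Let A := fun x => connect unc x r.

Lemma side_uncut x y : unc x y -> A x = A y.
Proof.
move=> Hxy; apply: (same_connect (uncut_connect_sym HZ HG m a0 a1)); exact: connect1.
Qed.

Lemma side_rdir x y : e x y -> pos y = nb (pos x) (rdir (pos x)) -> A x = A y.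
Proof.
move=> exy Ey; apply: side_uncut; rewrite /unc /uncut /= exy Ey /in_cut.
by case: (pos x) => [[a b] []]; rewrite /= ?xpair_eqE; lia.
Qed.

Lemma side_cut x y : e x y -> (A x != A y) = inC (pos x) (pos y).
Proof.
move=> exy; have [Hc|Hc] := boolP (inC (pos x) (pos y)); last first.
  by rewrite (side_uncut (x := x) (y := y)) ?eqxx // /unc /uncut /= exy.
have := cut_cover HZ HG HC exy Hc r; have := cut_disjoint HZ HG HC exy Hc (x := r).
rewrite /A !(uncut_connect_sym HZ HG m a0 a1 _ r).
by case: (connect _ r x) => [/(_ isT) ->|_ /= ->].
Qed.

Definition side_vertices : nat := #|[set x | A x]|.
Definition coside_vertices : nat := #|[set x | ~~ A x]|.
Definition side_edges : nat := #|[set f in gedges e | A f.1 && A f.2]|.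
Definition coside_edges : nat := #|[set f in gedges e | ~~ A f.1 && ~~ A f.2]|.

Lemma closer_sides x y : e x y -> inC (pos x) (pos y) ->
  [/\ n_closer e x y = side_vertices, n_closer e y x = coside_vertices,
      m_closer e x y = side_edges & m_closer e y x = coside_edges] \/
  [/\ n_closer e y x = side_vertices, n_closer e x y = coside_vertices,
      m_closer e y x = side_edges & m_closer e x y = coside_edges].
Proof.
move=> exy Hc; have eyx : e y x by rewrite (e_sym HZ HG).
have Hc' : inC (pos y) (pos x) by rewrite /inC in_cutC.
have key u v : e u v -> inC (pos u) (pos v) -> A u ->
    [/\ n_closer e u v = side_vertices, n_closer e v u = coside_vertices,
      m_closer e u v = side_edges & m_closer e v u = coside_edges].
  move=> euv Hu Au; have evu : e v u by rewrite (e_sym HZ HG).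
  have Hu' : inC (pos v) (pos u) by rewrite /inC in_cutC.
  have E z : connect unc z u = A z.
    rewrite /A !(uncut_connect_sym HZ HG m a0 a1 z).
    exact: (same_connect (uncut_connect_sym HZ HG m a0 a1)).
  have E' z : connect unc z v = ~~ A z by rewrite (cut_connectC HZ HG HC euv Hu) E.
  rewrite (n_closer_cut HZ HG HC euv Hu) (n_closer_cut HZ HG HC evu Hu').
  rewrite (m_closer_cut HZ HG HC euv Hu) (m_closer_cut HZ HG HC evu Hu').
  by split; apply: eq_card => z; rewrite !inE ?E ?E'.
have [Ax|Ax] := boolP (A x); [left|right]; first exact: key.
by apply: key => //; move: Hc; rewrite -(side_cut exy) (negbTE Ax); case: (A y).
Qed.

Lemma side_vertices_total : (side_vertices + coside_vertices)%N = #|T|.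
Proof.
rewrite -(cardsC [set x | A x]); congr addn.
by apply: eq_card => x; rewrite !inE.
Qed.

Lemma card_gedges_sum (P : rel T) : (forall x y, P x y = P y x) ->
  #|[set f in gedges e | P f.1 f.2]|%:Z =
  \sum_(x | ~~ (pos x).2) \sum_(y | e x y) (P x y : nat)%:Z.
Proof.
move=> PC; rewrite -(sum_gedges HZ HG (F := fun x y => (P x y : nat)%:Z)); last first.
  by move=> x y; rewrite PC.
rewrite -sum1_card Posz_sum [RHS]big_mkcond [LHS]big_mkcond; apply: eq_bigr => f _.
by rewrite [in LHS]in_set; case: (f \in gedges e) => //=; case: (P _ _).
Qed.

Lemma side_edges_total :
  side_edges%:Z + coside_edges%:Z + (a1 - a0 + 1) = esum Z n.
Proof.
rewrite -card_cut -card_gedges.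
have E1 : side_edges%:Z = _ :=
  card_gedges_sum (P := fun x y => A x && A y) (fun x y => andbC _ _).
have E2 : coside_edges%:Z = _ :=
  card_gedges_sum (P := fun x y => ~~ A x && ~~ A y) (fun x y => andbC _ _).
have E3 : #|gedges e|%:Z = \sum_(x | ~~ (pos x).2) \sum_(y | e x y) 1.
  rewrite -(sum_gedges HZ HG (F := fun _ _ => 1%:Z)) //.
  by rewrite -sum1_card Posz_sum.
rewrite E1 E2 E3 -!big_split /=; apply: eq_bigr => x _.
rewrite [X in _ + _ + X]big_mkcondr /= -!big_split /=; apply: eq_bigr => y exy.
by rewrite -(side_cut exy); case: (A x); case: (A y).
Qed.

(** The degrees of the [false] vertices of a side count the edges within it, and also the edges of
    the cut when their [false] ends are on this side; the latter are subtracted. The hypothesis on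
    [inC], with one vertex twice, says that [a] is a position of the cut. *)
Lemma side_edgesE a : inC (a, m - a, (pos r).2) (a, m - a, (pos r).2) ->
  pos r = (a, m - a, (pos r).2) ->
  side_edges%:Z = \sum_(i < n | A (zt i.+1)) edge_ends Z (zv Z i.+1)
    - (~~ (pos r).2 : nat)%:Z * (a1 - a0 + 1).
Proof.
move=> Ha Er; rewrite -deg_false_sum; last exact: side_rdir.
have -> : side_edges%:Z = _ :=
  card_gedges_sum (P := fun x y => A x && A y) (fun x y => andbC _ _).
rewrite -card_cut.
rewrite mulr_sumr; apply/eqP; rewrite -subr_eq opprK; apply/eqP.
rewrite big_mkcondr /= -big_split /=; apply: eq_bigr => x Px.
rewrite mulr_sumr big_mkcondr /= -big_split /=.
transitivity (\sum_(y | e x y) (A x : nat)%:Z).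
  apply: eq_bigr => y exy; rewrite -(side_cut exy).
  have [Hc|] := boolP (inC (pos x) (pos y)); last first.
    by rewrite -(side_cut exy) negbK => /eqP ->; case: (A y).
  have := side_cut exy; rewrite Hc.
  have [b [s [Hb Ex Ey]]] := in_cutP HZ HG exy Hc.
  move: Px; rewrite Ex /= => Es.
  have Ha' : a0 <= a <= a1 by case/and3P: Ha.
  case Er2: (pos r).2; rewrite Er2 in Er.
    rewrite (negbTE Es) in Ey; have [C _] := cut_side HZ HG HC Hb Ha' Ey Er.
    by rewrite /A C; case: (connect _ x r).
  rewrite (negbTE Es) in Ex; have [C _] := cut_side HZ HG HC Hb Ha' Ex Er.
  by rewrite /A C; case: (connect _ y r).
rewrite sumr_const; case: (A x) => /=; last by rewrite mul0rn.
rewrite -[LHS]/(#|_|%:R : int) natz /gdeg; congr Posz.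
by apply: eq_card => y; rewrite inE.
Qed.

End Side.

End CutCount.

(** * A side of a cut meets the cycle in an arc *)

Section Arc.

Variables (T : finType) (e : rel T) (Z : seq hvertex) (pos : T -> hvertex).
Hypothesis HZ : lattice_cycle Z.
Hypothesis HG : [/\ injective pos,
        forall v, vertex_within Z v <-> exists x, pos x = v
      & forall x y, e x y <-> edge_within Z (pos x) (pos y)].
Variable zt : nat -> T.
Hypothesis Hzt : forall i, pos (zt i) = zv Z i.

Let n := size Z.

Lemma step_uniq (u v : hvertex) i j : (0 < i <= n)%N -> (0 < j <= n)%N ->
  same_edge u v (zv Z i) (zv Z i.+1) -> same_edge u v (zv Z j) (zv Z j.+1) -> i = j.
Proof.
have n0 : (0 < n)%N by exact: size_cycle_gt0.
have per k : zv Z (k %% n) = zv Z k /\ zv Z (k %% n).+1 = zv Z k.+1.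
  split; first exact: zv_mod.
  by rewrite -[LHS]zv_mod -[RHS]zv_mod -(addn1 (k %% n)) -(addn1 k) modnDml.
have [Ei Ei'] := per i; have [Ej Ej'] := per j.
rewrite -Ei -Ei' -Ej -Ej' => Hi Hj Si Sj.
have := same_edge_uniq HZ (ltn_pmod i n0) (ltn_pmod j n0) Si Sj.
have E k : (0 < k <= n)%N -> (k %% n)%N = if k == n then 0%N else k.
  by case: eqP => [->|] *; rewrite ?modnn // modn_small //; lia.
by rewrite !E //; do 2 case: eqP; lia.
Qed.

Variables m a0 a1 : int.
Hypothesis HC : is_cut Z m a0 a1.
Variables j0 j1 : nat.
Hypotheses (H0 : at_step Z m a0 j0) (H1 : at_step Z m a1 j1).

Let inC := in_cut m a0 a1.
Let unc := uncut e pos m a0 a1.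
Let lo := minn j0 j1.
Let hi := maxn j0 j1.

Lemma at_step_in_cut j : j = j0 \/ j = j1 -> inC (zv Z j) (zv Z j.+1).
Proof.
have [Ha _ _ _] := HC.
case=> ->; [have [s [-> ->]] := at_stepS HZ H0|have [s [-> ->]] := at_stepS HZ H1];
  by rewrite /inC /in_cut /= eqxx; lia.
Qed.

(** An inner edge of the cut has two interior sides, whereas an edge of [Z] has only one. *)
Lemma step_in_cut i : (0 < i <= n)%N -> inC (zv Z i) (zv Z i.+1) -> i = j0 \/ i = j1.
Proof.
move=> Hi Hc; have [Ha Hin Hl Hr] := HC.
have := Hc; rewrite -!Hzt => Hc'.
have [a [s [Hs E E']]] := in_cutP HZ HG (e_zv HZ HG (Hzt i) (Hzt i.+1)) Hc'.
rewrite !Hzt in E E'.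
have on : edge_on Z (zv Z i) (zv Z i.+1).
  by rewrite /edge_on !zv_in // next_zv // eqxx.
have Ed : zd Z i = D2.
  by apply: (@nb_inj (zv Z i)); rewrite nb_zd // E' E; case: (s).
have on' : edge_on Z (zv Z i) (nb (zv Z i) D2) by rewrite -Ed nb_zd.
have J := inside_jump HZ (zv Z i) D2; rewrite on' E in J.
have J' : inside Z (a + 1, m - a) (+) inside Z (a, m - a + 1).
  by move: J; case: (s) => /=; rewrite // addbC.
have [H0i [s0 [E0 E0']]] : (0 < j0 <= n)%N /\ _ := conj (let: And3 h _ _ := H0 in h) (at_stepS HZ H0).
have [H1i [s1 [E1 E1']]] : (0 < j1 <= n)%N /\ _ := conj (let: And3 h _ _ := H1 in h) (at_stepS HZ H1).
have [Ea|Na] := eqVneq a a0; last have [Ea|Na'] := eqVneq a a1.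
- left; apply: (step_uniq (u := (a, m - a, false)) (v := (a, m - a, true)) Hi H0i).
    by rewrite /same_edge E E'; case: (s); rewrite !eqxx ?orbT.
  by rewrite /same_edge E0 E0' Ea; case: (s0); rewrite !eqxx ?orbT.
- right; apply: (step_uniq (u := (a, m - a, false)) (v := (a, m - a, true)) Hi H1i).
    by rewrite /same_edge E E'; case: (s); rewrite !eqxx ?orbT.
  by rewrite /same_edge E1 E1' Ea; case: (s1); rewrite !eqxx ?orbT.
- have I1 := Hin a; have I2 := Hin (a - 1).
  rewrite subrK (_ : m - (a - 1) = m - a + 1) in I2; last by lia.
  by move: J'; rewrite I1 ?I2 //; lia.
Qed.

Lemma arc_connect i j : (0 < i <= j)%N -> (j <= n.+1)%N ->
  (forall k, (i <= k < j)%N -> k != j0 /\ k != j1) -> connect unc (zt i) (zt j).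
Proof.
case/andP => i0 /subnK <-; elim: (j - i)%N => [|d IH]; first by rewrite connect0.
move=> Hd Hk; have C : connect unc (zt i) (zt (d + i)).
  by apply: IH => [|k Hk']; [lia|apply: Hk; lia].
apply: connect_trans C (connect1 _).
rewrite /unc /uncut /= (e_zv HZ HG (Hzt _) (Hzt _)) !Hzt /=.
have [N0 N1] := Hk (d + i)%N ltac:(lia).
apply: contra N0 => /step_in_cut [|->|E]; [lia|by []|by rewrite E eqxx in N1].
Qed.

Lemma lo_hi : [/\ (0 < lo)%N, (lo < hi)%N, (hi <= n)%N & forall k, (k == lo) || (k == hi) = (k == j0) || (k == j1)].
Proof.
have [Ha _ _ _] := HC; case: H0 H1 => h0 _ E0 [h1 _ E1].
have N : j0 != j1 by apply: contraTN Ha => /eqP E; move: E0; rewrite E E1 => -[] ->; rewrite ltxx.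
by rewrite /lo /hi; split; lia.
Qed.

(** Without steps [lo] and [hi] the cycle falls into two arcs. Each is connected off the cut, and
    the ends of step [lo] are separated by it. *)
Lemma arc_side i : (i < n)%N ->
  connect unc (zt i.+1) (zt lo.+1) = (lo <= i < hi)%N.
Proof.
move=> Hi; have [l0 lh hn Hk] := lo_hi.
have nk k : k != lo -> k != hi -> k != j0 /\ k != j1.
  by move=> N1 N2; have := Hk k; rewrite (negbTE N1) (negbTE N2) => /esym/norP.
have sym := uncut_connect_sym HZ HG m a0 a1.
have [Hlo|Hlo] := boolP (lo <= i < hi)%N.
  rewrite sym; apply: arc_connect; [lia|lia|move=> k Hk'; apply: nk; lia].
have sep : connect unc (zt lo) (zt lo.+1) = false.
  apply: (cut_separates HZ HG HC); first exact: (e_zv HZ HG (Hzt _) (Hzt _)).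
  rewrite !Hzt; apply: at_step_in_cut.
  by have := Hk lo; rewrite eqxx => /esym/orP [] /eqP ->; [left|right].
suff C : connect unc (zt i.+1) (zt lo).
  by apply: contraFF sep; apply: connect_trans; rewrite sym.
have [Hl|Hl] := ltnP i lo.
  by apply: arc_connect; [lia|lia|move=> k Hk'; apply: nk; lia].
(* Beyond [hi] the arc continues through vertex [n + 1], which is vertex 1, up to [lo]. *)
have C1 : connect unc (zt i.+1) (zt n.+1).
  by apply: arc_connect; [lia|lia|move=> k Hk'; apply: nk; lia].
have E : zt n.+1 = zt 1%N.
  have [pI _ _] := HG; apply: pI; rewrite !Hzt -[LHS]zv_mod -[RHS]zv_mod.
  by rewrite -addn1 modnDl.
apply: connect_trans C1 _; rewrite E.
by apply: arc_connect; [lia|lia|move=> k Hk'; apply: nk; lia].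
Qed.

Definition arc_vertices : int := vsum Z hi - vsum Z lo.

Definition arc_edges : int :=
  esum Z hi - esum Z lo - (~~ (zv Z lo.+1).2 : nat)%:Z * (a1 - a0 + 1).

Lemma sum_side (F : nat -> int) :
  \sum_(i < n | connect unc (zt i.+1) (zt lo.+1)) F i =
  \sum_(i < hi) F i - \sum_(i < lo) F i.
Proof.
have [l0 lh hn _] := lo_hi.
rewrite -(@sum_arc F lo hi n) //; last exact: ltnW lh.
by apply: eq_bigl => i; rewrite arc_side.
Qed.

Let A := connect unc ^~ (zt lo.+1).

Lemma arc_verticesE :
  (side_vertices e pos m a0 a1 (zt lo.+1))%:Z = arc_vertices /\
  (coside_vertices e pos m a0 a1 (zt lo.+1))%:Z = vsum Z n - arc_vertices.
Proof.
have E : (side_vertices e pos m a0 a1 (zt lo.+1))%:Z = arc_vertices.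
  rewrite /arc_vertices -(sum_side (fun i => vertex_ends Z (zv Z i.+1))).
  rewrite -(sum_cycle HZ HG Hzt A (F := vertex_ends Z)); last exact: ends0.
  rewrite -(green HZ HG).
  - rewrite /side_vertices -sum1_card Posz_sum; apply: eq_bigl => x.
    by rewrite inE.
  - by move=> x y exy Exy; exact: (side_rdir HZ HG m a0 a1 (zt lo.+1) exy Exy).
  - by case=> [[a b] []]; rewrite /rdir /=; lia.
split=> //; rewrite -(card_vertices HZ HG Hzt) -E.
by rewrite -(side_vertices_total e pos m a0 a1 (zt lo.+1)); lia.
Qed.

Lemma arc_edgesE :
  (side_edges e pos m a0 a1 (zt lo.+1))%:Z = arc_edges /\
  (coside_edges e pos m a0 a1 (zt lo.+1))%:Z = esum Z n - (a1 - a0 + 1) - arc_edges.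
Proof.
have [l0 lh hn Hk] := lo_hi; have [Ha _ _ _] := HC.
have E : (side_edges e pos m a0 a1 (zt lo.+1))%:Z = arc_edges.
  have [a [s [Hs Er]]] : exists a s, a0 <= a <= a1 /\ zv Z lo.+1 = (a, m - a, s).
    have := Hk lo; rewrite eqxx => /esym/orP [] /eqP ->.
      by have [s [_ ->]] := at_stepS HZ H0; exists a0, (~~ s); split=> //; lia.
    by have [s [_ ->]] := at_stepS HZ H1; exists a1, (~~ s); split=> //; lia.
  rewrite (side_edgesE HZ HG Hzt HC (a := a)); last by rewrite Hzt Er.
    by rewrite Hzt (sum_side (fun i => edge_ends Z (zv Z i.+1))).
  by rewrite /in_cut /= eqxx Hs andbT; apply/eqP; lia.
split=> //; have := side_edges_total HZ HG Hzt HC (zt lo.+1).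
by rewrite E => <-; lia.
Qed.

(** [P] stands for the term of any of the four indices. Its symmetry is used because the [false]
    ends of the cut may be on either side. *)
Lemma cut_contribution (P : int -> int -> int -> int -> int) :
  (forall n1 n2 m1 m2, P n1 n2 m1 m2 = P n2 n1 m2 m1) ->
  \sum_(x | ~~ (pos x).2) \sum_(y | e x y && inC (pos x) (pos y))
     (gdeg e x + gdeg e y)%:Z * P (n_closer e x y)%:Z (n_closer e y x)%:Z
                                  (m_closer e x y)%:Z (m_closer e y x)%:Z =
  cut_weight Z a0 a1 j0 j1 *
    P arc_vertices (vsum Z n - arc_vertices)
      arc_edges (esum Z n - (a1 - a0 + 1) - arc_edges).
Proof.
move=> PC; have [<- <-] := arc_verticesE; have [<- <-] := arc_edgesE.
rewrite -(sum_cut_weight HZ HG HC H0 H1) mulr_suml; apply: eq_bigr => x _.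
rewrite mulr_suml; apply: eq_bigr => y /andP [exy Hc].
have [[-> -> -> ->]//|[-> -> -> ->]] := closer_sides HZ HG HC (zt lo.+1) exy Hc.
by rewrite PC.
Qed.

End Arc.

(** * Matching the boundary edges of the cuts *)

Definition apos (Z : seq hvertex) (t : nat) : int := (zv Z t).1.1.
Definition line (Z : seq hvertex) (t : nat) : int := (zv Z t).1.1 + (zv Z t).1.2.

(* [st.1] maps each line to its unmatched step (0 if there is none), and [st.2] lists
   the matched pairs. *)
Definition sweep_step (Z : seq hvertex) (st : (int -> nat) * seq (nat * nat)) (t : nat) :
    (int -> nat) * seq (nat * nat) :=
  let l := line Z t in
  if st.1 l == 0%N then (fun k => if k == l then t else st.1 k, st.2)
  else (fun k => if k == l then 0%N else st.1 k, rcons st.2 (st.1 l, t)).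

Definition sweep (Z : seq hvertex) (L : seq nat) := foldl (sweep_step Z) (fun=> 0%N, [::]) L.

(** A weak order of positions suffices: steps at equal positions lie on different lines and do not
    interact. *)
Definition sweepable (Z : seq hvertex) (L : seq nat) : Prop :=
  [/\ uniq L, forall t, (t \in L) = (0 < t <= size Z)%N && (zd Z t == D2)
    & pairwise (fun s t => apos Z s <= apos Z t) L].

Definition before (Z : seq hvertex) (k a : int) (L : seq nat) : nat :=
  count (fun t => (line Z t == k) && (apos Z t < a)) L.

Definition covering (Z : seq hvertex) (k a : int) (prs : seq (nat * nat)) : nat :=
  count (fun p => (line Z p.2 == k) && (apos Z p.1 <= a <= apos Z p.2)) prs.

Definition cut_pair (Z : seq hvertex) (p : nat * nat) : Prop :=
  [/\ is_cut Z (line Z p.2) (apos Z p.1) (apos Z p.2),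
      at_step Z (line Z p.2) (apos Z p.1) p.1 & at_step Z (line Z p.2) (apos Z p.2) p.2].

Section Sweep.

Variable Z : seq hvertex.
Hypothesis HZ : lattice_cycle Z.
Variable L : seq nat.
Hypothesis HL : sweepable Z L.

Let n := size Z.

Lemma xor_odd_count (f : pred nat) s : \big[addb/false]_(t <- s) f t = odd (count f s).
Proof.
elim: s => [|t s IH]; first by rewrite big_nil.
by rewrite big_cons IH /= oddD; case: (f t).
Qed.

(** Only steps of direction [D2] cross the ray of [h], so the parity can be counted during the
    sweep. *)
Lemma inside_before h : inside Z h = odd (before Z (h.1 + h.2 - 1) h.1 L).
Proof.
pose f t := crosses h (zv Z t) (zv Z t.+1).
have n0 : (0 < n)%N by exact: size_cycle_gt0.
have -> : inside Z h = \big[addb/false]_(t <- iota 1 n) f t.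
  rewrite /inside /par /xsum -/n -(prednK n0) big_ord_recl.
  rewrite -[iota 1 _]/(index_iota 1 n.-1.+2) big_nat_recr //= big_add1 /= big_mkord addbC.
  congr addb; rewrite prednK // /f.
  have -> : zv Z n = zv Z 0 by rewrite -[LHS]zv_mod -/n modnn.
  have -> // : zv Z n.+1 = zv Z 1.
  by rewrite -[LHS]zv_mod -[RHS]zv_mod -/n -[n.+1]addn1 modnDl.
have [uL mL _] := HL.
have pL : perm_eq L [seq t <- iota 1 n | zd Z t == D2].
  apply: uniq_perm => // [|t]; first exact/filter_uniq/iota_uniq.
  by rewrite mL mem_filter mem_iota andbC add1n ltnS.
rewrite xor_odd_count /before (permP pL) count_filter; congr odd; apply: eq_count => t /=.
rewrite /f /crosses -[zv Z t.+1](nb_zd HZ) /line /apos.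
by case: (zv Z t) => [[a b] s]; case: (zd Z t); case: s; rewrite /= ?xpair_eqE;
  rewrite -(inj_eq (can_inj codeK)) /=; lia.
Qed.

Lemma sweepable_at_step t : t \in L -> at_step Z (line Z t) (apos Z t) t.
Proof.
have [_ -> _] := HL; case/andP => Ht /eqP Hd; split=> //.
rewrite /line /apos; case: (zv Z t).1 => a b /=; congr pair; lia.
Qed.

Lemma apos_inj s t : s \in L -> t \in L -> line Z s = line Z t ->
  apos Z s = apos Z t -> s = t.
Proof.
move=> /sweepable_at_step Hs /sweepable_at_step Ht El Ea.
have [hs _ _] := Hs; have [ht _ _] := Ht.
have [s0 [E0 E0']] := at_stepS HZ Hs; have [s1 [E1 E1']] := at_stepS HZ Ht.
apply: (step_uniq HZ (u := (apos Z s, line Z s - apos Z s, false))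
  (v := (apos Z s, line Z s - apos Z s, true)) hs ht).
  by rewrite /same_edge E0 E0'; case: (s0); rewrite !eqxx ?orbT.
by rewrite /same_edge E1 E1' El Ea; case: (s1); rewrite !eqxx ?orbT.
Qed.

Lemma sweep_order L1 t L2 s : L = L1 ++ t :: L2 -> line Z s = line Z t ->
  (s \in L1 -> apos Z s < apos Z t) /\ (s \in L2 -> apos Z t < apos Z s).
Proof.
move=> EL El; have [uL _ pL] := HL.
have inL r : (r \in L1) || (r == t) || (r \in L2) -> r \in L.
  by rewrite EL mem_cat inE orbA.
have neq : (s \in L1) || (s \in L2) -> apos Z s != apos Z t.
  move=> Hs; apply/eqP => Ea; have Est : s = t.
    apply: apos_inj El Ea; apply: inL; last by rewrite eqxx orbT.
    by case/orP: Hs => ->; rewrite ?orbT.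
  move: uL; rewrite EL cat_uniq /= negb_or -Est; move: Hs.
  by case: (s \in L1); case: (s \in L2); rewrite ?andbF.
move: pL; rewrite EL pairwise_cat /= allrel_consr => /and4P [/andP [a1 _] _ a2 _].
split=> Hs; rewrite lt_neqAle ?[_ == apos Z s]eq_sym neq ?Hs ?orbT //=.
  exact: (allP a1).
exact: (allP a2).
Qed.

(** A line has an unmatched step when it was met an odd number of times, and that step is its
    rightmost so far. An edge is in the span of a pair, or not before the unmatched step, exactly
    when one of its two hexagons has an odd count, and then only once. Between paired steps the
    count is odd, so a pair delimits a cut. *)
Lemma sweep_invariant L1 L2 : L = L1 ++ L2 -> let st := sweep Z L1 in
  [/\ forall k, (if st.1 k == 0%N then ~~ odd (count (fun t => line Z t == k) L1) else
        [&& odd (count (fun t => line Z t == k) L1), st.1 k \in L1, line Z (st.1 k) == k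
          & all (fun s => (line Z s == k) ==> (apos Z s <= apos Z (st.1 k))) L1]),
      forall k a, (covering Z k a st.2 + ((st.1 k != 0) && (apos Z (st.1 k) <= a)%R))%N =
        odd (before Z k a L1) || odd (before Z k (a + 1) L1)
    & forall p, p \in st.2 -> cut_pair Z p].
Proof.
elim/last_ind: L1 L2 => [|L1 t IH] L2; first by [].
rewrite cat_rcons => EL; have := IH _ EL; rewrite /sweep foldl_rcons -/(sweep Z L1).
case: (sweep Z L1) => pend prs /= [I1 I2 I3].
have Ht : t \in L by rewrite EL mem_cat inE eqxx orbT.
have t0 : t != 0%N by have [_ mL _] := HL; move: Ht; rewrite mL lt0n => /andP [/andP []].
set l := line Z t; pose N := count (fun s => line Z s == l) L1.
have Hlate a : apos Z t <= a -> before Z l a L1 = N.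
  move=> Ha; apply: eq_in_count => s Hs /=; case: eqP => //= El.
  by have [/(_ Hs) H _] := sweep_order EL El; exact: lt_le_trans H Ha.
have Hcat k a : before Z k a (rcons L1 t) = (before Z k a L1 + ((l == k) && (apos Z t < a)%R))%N.
  by rewrite /before -cats1 count_cat /= addn0.
have Hcnt k : count (fun s => line Z s == k) (rcons L1 t) =
    (count (fun s => line Z s == k) L1 + (l == k))%N.
  by rewrite -cats1 count_cat /= addn0.
rewrite /sweep_step /= -/l; have := I1 l; rewrite -/N.
case: ifPn => [/eqP Ep oN|Hp /and4P [oN p1 /eqP p2 /allP p3]]; split=> //=.
- move=> k; rewrite Hcnt; have [->|Nk] := eqVneq k l.
    rewrite (negbTE t0) -/N addn1 /= oN mem_rcons inE !eqxx /= all_rcons eqxx lexx /=.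
    apply/allP => s Hs; apply/implyP => /eqP El.
    by have [/(_ Hs) H _] := sweep_order EL El; exact: ltW.
  rewrite addn0; have := I1 k; case: ifP => // _ /and4P [-> q2 -> q4].
  by rewrite mem_rcons inE q2 orbT all_rcons q4 /= eq_sym (negbTE Nk).
- move=> k a; have := I2 k a; rewrite !Hcat.
  have [->|Nk] := eqVneq k l; last by rewrite !addn0.
  rewrite Ep t0 /= addn0.
  have [Ha|Ha] := leP (apos Z t) a; last first.
    by rewrite (_ : apos Z t < a + 1 = false) ?addn0 //; lia.
  rewrite !Hlate //; last by lia.
  rewrite orbb (negbTE oN) => ->; rewrite ltzD1 Ha /= !oddD (negbTE oN) /=.
  by rewrite orbT.
- move=> k; rewrite Hcnt; have [->|Nk] := eqVneq k l.
    by rewrite eqxx -/N addn1 /= oN.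
  rewrite addn0; have := I1 k; case: ifP => // _ /and4P [-> q2 -> q4].
  by rewrite mem_rcons inE q2 orbT all_rcons q4 /= eq_sym (negbTE Nk).
- move=> k a; have := I2 k a; rewrite !Hcat /covering -cats1 count_cat /= !addn0 -/l.
  have [->|Nk] := eqVneq k l; last by rewrite !addn0.
  rewrite Hp /= addn0.
  have [Ha|Ha] := leP (apos Z t) a; last first.
    by rewrite (ltW Ha) andbT (_ : apos Z t < a + 1 = false) ?addn0 //; lia.
  have Hpa : apos Z (pend l) <= a.
    apply: le_trans Ha; apply: ltW.
    by have [/(_ p1) H _] := sweep_order EL p2.
  rewrite !Hlate //; last by lia.
  rewrite orbb oN Hpa ltzD1 Ha !oddD oN /= => E.
  rewrite (_ : count _ prs = 0%N); last by move: E; lia.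
  by case: (ltgtP (apos Z t) a) Ha.
- move=> p; rewrite mem_rcons inE => /orP [/eqP ->|]; last exact: I3.
  have Hp1 : pend l \in L by rewrite EL mem_cat p1.
  have S0 := sweepable_at_step Hp1; have S1 := sweepable_at_step Ht.
  rewrite p2 in S0; split=> //; rewrite /= -/l.
  have Hin a : apos Z (pend l) <= a < apos Z t -> inside Z (a + 1, l - a).
    case/andP => A1 A2; rewrite inside_before /=.
    rewrite (_ : a + 1 + (l - a) - 1 = l); last by lia.
    rewrite /before EL count_cat /= -/l eqxx /= ltzD1 leNgt A2 add0n.
    rewrite (_ : count _ L1 = N); last first.
      apply: eq_in_count => s Hs /=; case: eqP => //= /eqP El.
      by rewrite ltzD1; apply: le_trans A1; move: (p3 _ Hs); rewrite El.
    rewrite (_ : count _ L2 = 0%N) ?addn0 //.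
    apply/eqP; rewrite -leqn0 leqNgt -has_count; apply/hasPn => s Hs /=.
    apply/negP => /andP [/eqP El]; have [_ /(_ Hs) H] := sweep_order EL El.
    by rewrite ltzD1 leNgt (lt_trans A2 H).
  have Hlt : apos Z (pend l) < apos Z t by have [/(_ p1)] := sweep_order EL p2.
  have on s : s \in L -> line Z s = l ->
      inside Z (apos Z s + 1, l - apos Z s) (+) inside Z (apos Z s, l - apos Z s + 1).
    move=> Hs El; have Ss := sweepable_at_step Hs; rewrite El in Ss.
    have [_ Ed _] := Ss; have [b [E E']] := at_stepS HZ Ss.
    have on : edge_on Z (zv Z s) (zv Z s.+1).
      by rewrite /edge_on !zv_in // next_zv // eqxx.
    move: on; rewrite -[zv Z s.+1](nb_zd HZ) Ed -inside_jump // E.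
    by case: (b) => /=; rewrite // addbC.
  split=> //.
  + by have := on _ Hp1 p2; rewrite Hin ?lexx.
  + have := on _ Ht erefl; have := Hin (apos Z t - 1); rewrite subrK -/l.
    rewrite (_ : l - (apos Z t - 1) = l - apos Z t + 1); last by lia.
    move=> ->; last by lia.
    by rewrite addbT.
Qed.

End Sweep.

Section SweepSum.

Variables (T : finType) (e : rel T) (Z : seq hvertex) (pos : T -> hvertex).
Hypothesis HZ : lattice_cycle Z.
Hypothesis HG : [/\ injective pos,
        forall v, vertex_within Z v <-> exists x, pos x = v
      & forall x y, e x y <-> edge_within Z (pos x) (pos y)].
Variable L : seq nat.
Hypothesis HL : sweepable Z L.

Let n := size Z.

(** A hexagon to the right of all of [Z] is exterior, so each line meets [Z] an even number of
    times. *)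
Lemma sweep_unmatched k : (sweep Z L).1 k = 0%N.
Proof.
have [I1 _ _] := sweep_invariant HZ HL (esym (cats0 L)).
have := I1 k; case: eqP => // _ /and4P [Hodd _ _ _].
have [M HM] := zv_bounded HZ.
have := inside_before HZ HL (M%:Z + 1, k - M%:Z); rewrite /=.
rewrite (_ : M%:Z + 1 + (k - M%:Z) - 1 = k); last by lia.
rewrite /inside par_far_right //; last 2 first.
- exact: zv_walk.
- by move=> i _ /=; have /andP [_] := HM i; rewrite ltzD1.
rewrite /before (@eq_count _ _ (fun t => line Z t == k)) ?Hodd // => t /=.
by have /andP [_] := HM t; rewrite /apos ltzD1 => ->; rewrite andbT.
Qed.

Lemma covering_sweep k a s : covering Z k a (sweep Z L).2 = esd Z (a, k - a, s) D2.
Proof.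
have [_ I2 _] := sweep_invariant HZ HL (esym (cats0 L)).
have := I2 k a; rewrite sweep_unmatched addn0 => ->; congr nat_of_bool.
have H1 := inside_before HZ HL (a, k - a + 1); have H2 := inside_before HZ HL (a + 1, k - a).
rewrite /= (_ : a + (k - a + 1) - 1 = k) in H1; last by lia.
rewrite /= (_ : a + 1 + (k - a) - 1 = k) in H2; last by lia.
by rewrite -H1 -H2 /esd; case: s => //=; rewrite orbC.
Qed.

Lemma sweep_pairs p : p \in (sweep Z L).2 -> cut_pair Z p.
Proof. by have [_ _] := sweep_invariant HZ HL (esym (cats0 L)); apply. Qed.

(** By [covering_sweep] every edge of direction [D2] lies in the cut of exactly one pair. *)
Lemma sweep_sum (R : nmodType) (F : T -> T -> R) :
  \sum_(x | ~~ (pos x).2) \sum_(y | e x y && ((pos x).1 == (pos y).1)) F x y =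
  \sum_(p <- (sweep Z L).2) \sum_(x | ~~ (pos x).2)
    \sum_(y | e x y && in_cut (line Z p.2) (apos Z p.1) (apos Z p.2) (pos x) (pos y)) F x y.
Proof.
rewrite exchange_big /=; apply: eq_bigr => x _.
under [RHS]eq_bigr => p _ do rewrite big_mkcondr /=.
rewrite exchange_big /= big_mkcondr /=; apply: eq_bigr => y exy.
rewrite -big_mkcond /= big_const_seq iter_addr addr0.
have [k Ey Hk] := eP HZ HG exy; case: eqP => [Exy|Nxy]; last first.
  by rewrite (@eq_count _ _ pred0) ?count_pred0 // => p; rewrite /in_cut; case: eqP.
have Ek : k = D2.
  by move: Exy; rewrite Ey; case: (pos x) => [[a b] []]; case: k {Ey Hk} => //= -[]; lia.
rewrite Ek in Hk; case Ex: (pos x) => [[a b] s].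
have := covering_sweep (a + b) a s.
rewrite (_ : a + b - a = b); last by lia.
rewrite -Ex Hk /covering => C; rewrite -[LHS]mulr1n; congr (_ *+ _).
rewrite -[LHS]C; apply: eq_count => p.
by rewrite /in_cut -Exy eqxx Ex /= eq_sym.
Qed.

End SweepSum.

(* Each direction of edges becomes direction [D2] in one of the three rotations. *)
Lemma sum_directions (T : finType) (e : rel T) (Z : seq hvertex) (pos : T -> hvertex)
    (R : nmodType) (F : T -> T -> R) :
  lattice_cycle Z ->
  [/\ injective pos,
        forall v, vertex_within Z v <-> exists x, pos x = v
      & forall x y, e x y <-> edge_within Z (pos x) (pos y)] ->
  (forall x y, F x y = F y x) ->
  let S (q : T -> hvertex) :=
    \sum_(x | ~~ (q x).2) \sum_(y | e x y && ((q x).1 == (q y).1)) F x y in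
  \sum_(f in gedges e) F f.1 f.2 = S pos + S (rho \o pos) + S (rho \o (rho \o pos)).
Proof.
move=> HZ HG FC S; rewrite (sum_gedges HZ HG FC) /S.
have rho2 v : (rho v).2 = v.2 by case: v => [[a b] s].
under [X in _ + X + _]eq_bigl => x do rewrite /= rho2.
under [X in _ + _ + X]eq_bigl => x do rewrite /= !rho2.
rewrite -!big_split /=; apply: eq_bigr => x _.
rewrite !big_mkcondr /= -!big_split /=; apply: eq_bigr => y /(eP HZ HG) [k -> _].
have E v j : ((v.1 == (nb v j).1) = (code j == 2%N)).
  by case: v => [[a b] []]; case: j; rewrite /= ?xpair_eqE; lia.
have Er v j : rho (nb v j) = nb (rho v) (nx (nx j)) by rewrite nb_rho nx3.
by rewrite !Er !E; case: k; rewrite /= ?addr0 ?add0r.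
Qed.

(** * Programs over stores *)

(* A store is a family of arrays indexed by [int]; scalars are kept at index 0.
   Stores live in the cells with negative addresses, and the input in the others
   is never overwritten. *)
Definition store : Type := nat -> int -> int.

Inductive sexp : Type :=
  | SConst of int
  | SGet of nat & sexp
  | SInput of sexp
  | SAdd of sexp & sexp
  | SSub of sexp & sexp
  | SMul of sexp & sexp
  | SLeq of sexp & sexp.

Fixpoint seval (inp : memory) (s : store) (x : sexp) : int :=
  match x with
  | SConst z => z
  | SGet k i => s k (seval inp s i)
  | SInput i => inp `|seval inp s i|
  | SAdd x1 x2 => seval inp s x1 + seval inp s x2
  | SSub x1 x2 => seval inp s x1 - seval inp s x2
  | SMul x1 x2 => seval inp s x1 * seval inp s x2
  | SLeq x1 x2 => if seval inp s x1 <= seval inp s x2 then 1 else 0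
  end.

(** Loops are excluded so that [srun] is a total function and the running time is bounded by the
    text alone. *)
Inductive sprog : Type :=
  | SSkip
  | SSet of nat & sexp & sexp
  | SSeq of sprog & sprog
  | SIf of sexp & sprog & sprog.

Definition supd (s : store) (k : nat) (i z : int) : store :=
  fun k' i' => if (k' == k) && (i' == i) then z else s k' i'.

Fixpoint srun (inp : memory) (p : sprog) (s : store) : store :=
  match p with
  | SSkip => s
  | SSet k i x => supd s k (seval inp s i) (seval inp s x)
  | SSeq p1 p2 => srun inp p2 (srun inp p1 s)
  | SIf x p1 p2 => if seval inp s x != 0 then srun inp p1 s else srun inp p2 s
  end.

(* [i (2 i + 1)] maps [int] injectively to the triangular numbers, and
   [s ^ 2 + k] with [k <= s] determines [s] and [k]. *)
Definition address (k : nat) (i : int) : int :=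
  - 1 - ((k%:Z + i * (2 * i + 1)) * (k%:Z + i * (2 * i + 1)) + k%:Z).

Lemma address_lt0 k i : address k i < 0.
Proof.
by rewrite /address; move: (k%:Z + i * (2 * i + 1)) => t; nia.
Qed.

Lemma address_inj k k' i i' : (address k i == address k' i') = (k' == k) && (i' == i).
Proof.
apply/eqP/andP => [|[/eqP -> /eqP ->] //]; rewrite /address.
have tri j : 0 <= j * (2 * j + 1) :> int by nia.
have := tri i; have := tri i'; set t' := i' * _; set t := i * _ => H' H E.
have Es : k%:Z + t = k'%:Z + t'.
  case: (ltgtP (k%:Z + t) (k'%:Z + t')) => // L; exfalso; nia.
have Ek : k%:Z = k'%:Z by move: E; rewrite Es; lia.
have Et : t = t' by lia.
split; apply/eqP; first by case: Ek.
have /eqP : (i' - i) * (2 * (i' + i) + 1) = t' - t by rewrite /t /t'; ring.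
by rewrite Et subrr mulf_eq0 subr_eq0 => /orP [/eqP //|/eqP]; lia.
Qed.

Definition address_exp (k : nat) (x : exp) : exp :=
  let s := Add (Const k%:Z) (Mul x (Add (Mul (Const 2) x) (Const 1))) in
  Defs.Sub (Const (- 1)) (Add (Mul s s) (Const k%:Z)).

(** The factor [2 [0 <= i] - 1] turns the index of [SInput] into its absolute value, so that reading
    the input never hits the cells of the store. *)
Fixpoint compile_exp (x : sexp) : exp :=
  match x with
  | SConst z => Const z
  | SGet k i => Read (address_exp k (compile_exp i))
  | SInput i => let i' := compile_exp i in
      Read (Mul i' (Defs.Sub (Mul (Const 2) (Leq (Const 0) i')) (Const 1)))
  | SAdd x1 x2 => Add (compile_exp x1) (compile_exp x2)
  | SSub x1 x2 => Defs.Sub (compile_exp x1) (compile_exp x2)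
  | SMul x1 x2 => Mul (compile_exp x1) (compile_exp x2)
  | SLeq x1 x2 => Leq (compile_exp x1) (compile_exp x2)
  end.

Fixpoint compile (p : sprog) : program :=
  match p with
  | SSkip => Skip
  | SSet k i x => Write (address_exp k (compile_exp i)) (compile_exp x)
  | SSeq p1 p2 => Seq (compile p1) (compile p2)
  | SIf x p1 p2 => If (compile_exp x) (compile p1) (compile p2)
  end.

Fixpoint time_bound (p : program) : nat :=
  match p with
  | Skip => 1
  | Write a1 a2 => (exp_time a1 + exp_time a2).+1
  | Seq p1 p2 => time_bound p1 + time_bound p2
  | If a p1 p2 => (exp_time a + maxn (time_bound p1) (time_bound p2)).+1
  | While _ _ => 0
  end.

Definition represents (inp : memory) (m : memory) (s : store) : Prop :=
  (forall k i, m (address k i) = s k i) /\ forall j, 0 <= j -> m j = inp j.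

Section Run.

Variable inp : memory.

Lemma eval_compile m s x : represents inp m s -> eval m (compile_exp x) = seval inp s x.
Proof.
move=> [H1 H2]; elim: x => [z|k i IH|i IH|x1 IH1 x2 IH2|x1 IH1 x2 IH2|x1 IH1 x2 IH2|x1 IH1 x2 IH2] /=;
  rewrite ?IH1 ?IH2 //.
  by rewrite IH -H1.
rewrite IH; set v := seval inp s i.
have -> : v * (2 * (if 0 <= v then 1 else 0) - 1) = `|v| by case: ifP; lia.
exact: H2.
Qed.

Lemma exec_compile p m s : represents inp m s -> exists t m',
  [/\ exec (compile p) m t m', (t <= time_bound (compile p))%N
    & represents inp m' (srun inp p s)].
Proof.
elim: p m s => [|k i x|p1 IH1 p2 IH2|x p1 IH1 p2 IH2] m s R.
- by exists 1%N, m; split=> //; constructor.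
- eexists; eexists; split; [exact: ExecWrite|by []|].
  have Ea : eval m (address_exp k (compile_exp i)) = address k (seval inp s i).
    by rewrite /= !(eval_compile _ R).
  rewrite Ea (eval_compile _ R) /=; case: R => R1 R2; split=> [k' i'|j Hj].
    by rewrite /update address_inj R1 /supd [k == _]eq_sym [_ == i']eq_sym.
  by rewrite /update; case: eqP => [E|_]; [move: (address_lt0 k (seval inp s i)); lia|exact: R2].
- have [t1 [m1 [E1 T1 R1]]] := IH1 _ _ R; have [t2 [m2 [E2 T2 R2]]] := IH2 _ _ R1.
  exists (t1 + t2)%N, m2; split; [exact: ExecSeq E1 E2|exact: leq_add|by []].
- rewrite /=; case: ifPn => Hx; rewrite -(eval_compile _ R) in Hx.
    have [t [m' [E1 T1 R1]]] := IH1 _ _ R; exists (exp_time (compile_exp x) + t).+1, m'.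
    split=> //; first exact: ExecIfTrue.
    by rewrite ltnS leq_add2l (leq_trans T1) // leq_maxl.
  have [t [m' [E1 T1 R1]]] := IH2 _ _ R; exists (exp_time (compile_exp x) + t).+1, m'.
  split=> //; first by apply: ExecIfFalse E1; apply/eqP; rewrite -[_ == _]negbK.
  by rewrite ltnS leq_add2l (leq_trans T1) // leq_maxr.
Qed.

(** A total-correctness triple with time budget [c]. *)
Definition reach (P : program) (s : store) (c : nat) (Q : store -> Prop) : Prop :=
  forall m, represents inp m s -> exists t m' s',
    [/\ exec P m t m', (t <= c)%N, represents inp m' s' & Q s'].

Lemma reach_block p s c Q : (time_bound (compile p) <= c)%N -> Q (srun inp p s) ->
  reach (compile p) s c Q.
Proof.
move=> Hc HQ m R; have [t [m' [E T R']]] := exec_compile p R.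
by exists t, m', (srun inp p s); split=> //; exact: leq_trans Hc.
Qed.

Lemma reach_seq P1 P2 s c1 c2 Q1 Q2 : reach P1 s c1 Q1 ->
  (forall s', Q1 s' -> reach P2 s' c2 Q2) -> reach (Seq P1 P2) s (c1 + c2) Q2.
Proof.
move=> H1 H2 m R; have [t1 [m1 [s1 [E1 T1 R1 HQ1]]]] := H1 _ R.
have [t2 [m2 [s2 [E2 T2 R2 HQ2]]]] := H2 _ HQ1 _ R1.
by exists (t1 + t2)%N, m2, s2; split=> //; [exact: ExecSeq E1 E2|exact: leq_add].
Qed.

Lemma reach_weaken P s c c' Q Q' : reach P s c Q -> (c <= c')%N ->
  (forall s', Q s' -> Q' s') -> reach P s c' Q'.
Proof.
move=> H Hc HQ m R; have [t [m' [s' [E T R' /HQ Q'']]]] := H _ R.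
by exists t, m', s'; split=> //; exact: leq_trans Hc.
Qed.

Definition loop (x : sexp) (p : sprog) : program := While (compile_exp x) (compile p).

Definition loop_cost (x : sexp) (p : sprog) : nat :=
  (exp_time (compile_exp x) + time_bound (compile p)).+1.

(** The loop makes exactly [N] rounds; the additional unit in [N.+1] pays for the failing test. *)
Lemma reach_loop x p s N (Inv : nat -> store -> Prop) : Inv 0%N s ->
  (forall j s', (j < N)%N -> Inv j s' -> Inv j.+1 (srun inp p s')) ->
  (forall j s', (j <= N)%N -> Inv j s' -> (seval inp s' x != 0) = (j < N)%N) ->
  reach (loop x p) s (N.+1 * loop_cost x p) (Inv N).
Proof.
move=> H0 HS Hx; set C := loop_cost x p.
suff H d j s' : (j + d)%N = N -> Inv j s' -> reach (loop x p) s' (d.+1 * C) (Inv N).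
  exact: H (add0n N) H0.
elim: d j s' => [|d IH] j s' Ej HI m R.
  have E : j = N by rewrite -Ej addn0.
  exists (exp_time (compile_exp x)).+1, m, s'; rewrite -E; split=> //.
    apply: ExecWhileFalse; rewrite (eval_compile _ R).
    by apply/eqP; rewrite -[_ == _]negbK (Hx j) // E ?ltnn.
  by rewrite mul1n /C /loop_cost ltnS leq_addr.
have Hj : (j < N)%N by lia.
have [t1 [m1 [E1 T1 R1]]] := exec_compile p R.
have [||t2 [m2 [s2 [E2 T2 R2 HQ]]]] := IH j.+1 (srun inp p s') _ _ m1 R1.
- by lia.
- exact: HS.
exists (exp_time (compile_exp x) + t1 + t2).+1, m2, s2; split=> //.
  apply: ExecWhileTrue E1 E2; rewrite (eval_compile _ R) (Hx j) //; exact: ltnW.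
rewrite [(d.+2 * C)%N]mulSn; apply: leq_trans (_ : C + t2 <= _)%N; last by rewrite leq_add2l.
by rewrite -addSn leq_add2r /C /loop_cost ltnS leq_add2l.
Qed.

End Run.

(** * Reading the cycle *)

Definition beq (x y : int) : int := ((x == y) : nat)%:Z.

Definition dircode (Z : seq hvertex) (i : nat) : int := (code (zd Z i))%:Z.

Section Reading.

Variable Z : seq hvertex.
Hypothesis HZ : lattice_cycle Z.

Let n := size Z.

(** A step changes the first coordinate by 1 for [D0], the second for [D1] and neither for [D2]. *)
Lemma dircodeE i : dircode Z i =
  2 - 2 * (((zv Z i.+1).1.1 - (zv Z i).1.1) * ((zv Z i.+1).1.1 - (zv Z i).1.1))
    - ((zv Z i.+1).1.2 - (zv Z i).1.2) * ((zv Z i.+1).1.2 - (zv Z i).1.2).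
Proof.
rewrite /dircode -[zv Z i.+1](nb_zd HZ); case: (zv Z i) => [[a b] s].
by case: s; case: (zd Z i) => /=; ring.
Qed.

Lemma dircode_eq2 i : beq (dircode Z i) 2 = (zd Z i == D2 : nat)%:Z.
Proof. by rewrite /beq /dircode -(inj_eq (can_inj codeK)); case: (zd Z i). Qed.

(** Two hexagons flank the incoming step. The third shares the parity of the one from which it is
    separated by the third edge, as that edge is not on [Z]. *)
Lemma hexagons_turn i : let v := zv Z i.+1 in let p := zd Z i in
  let o := inside Z (lft Z 0) in
  [/\ inside Z (hx v (nx (nx p))) = o, inside Z (hx v (nx p)) = ~~ o
    & inside Z (hx v p) = (zd Z i.+1 != nx p) (+) ~~ o].
Proof.
move=> v p o; have Hl : inside Z (hx v (nx (nx p))) = o.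
  by rewrite /o (inside_lft HZ 0 i) lftS.
have Hr : inside Z (hx v (nx p)) = ~~ o.
  by rewrite /o (inside_lft HZ 0 i) -inside_lft_rgt // rgtS.
split=> //; case: (zd_cases HZ i) => E; rewrite E -/p.
  have := inside_jump HZ v (nx (nx p)); rewrite (negbTE (third_edge HZ E)) nx3 Hr eqxx /=.
  by move=> /addb_false_eq ->.
have := inside_jump HZ v (nx p); rewrite (negbTE (third_edge' HZ E)) nx3 Hl.
move=> /addb_false_eq <-; rewrite -/p (_ : nx (nx p) != nx p) ?addTb ?negbK //.
by case: (p).
Qed.

(** The codes of the three directions add up to 3, so [r] is the code of the third edge, which is
    missing when [d = 1]. It points to the right along the zigzag when [r + s = 1], to the left when
    [r = s]. The two tests in [d] say that [q] follows [p] cyclically. *)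
Lemma turn_formulas i : let v := zv Z i.+1 in
  let p := dircode Z i in let q := dircode Z i.+1 in let r := 3 - p - q in
  let d := beq (beq (q - p) 1 + beq (q - p) (- 2)) (inside Z (lft Z 0) : nat)%:Z in
  let a := v.1.1 in let s := (v.2 : nat)%:Z in
  [/\ (deficient Z v : nat)%:Z = d,
      vertex_ends Z v = d * (beq (r + s) 1 * (2 * a + s + 1) - beq r s * (2 * a + s))
    & edge_ends Z v = 3 * (d * (beq (r + s) 1 * (a + 1) - beq r s * (a + s))) - d * (1 - s)].
Proof.
move=> v p q r d a s; have [H1 H2 H3] := hexagons_turn i.
rewrite /d /r /p /q /dircode; move: H1 H2 H3; rewrite -/v.
rewrite /edge_ends /vertex_ends /false_ends /ends /deficient /esd /rdir /ldir.
rewrite -(inj_eq (can_inj codeK)).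
have := zd_cases HZ i; move: (zd Z i) (zd Z i.+1) => k j.
rewrite /s -/a; case: (v.2); case: (inside Z (lft Z 0)).
all: case: k => -[] -> /= -> -> ->; rewrite /beq /=; split; lia.
Qed.

(** No step precedes one of least position, so the hexagon on its low side is exterior. Which side
    of [Z] this is depends only on the kind of its initial vertex. *)
Lemma orientation L t : sweepable Z L -> t \in L ->
  (forall s, s \in L -> apos Z t <= apos Z s) -> inside Z (lft Z 0) = ~~ (zv Z t).2.
Proof.
move=> HL Ht Hmin; rewrite (inside_lft HZ 0 t).
have [_ Ed _] := sweepable_at_step HZ HL Ht.
have out b : inside Z (apos Z t, b) = false.
  rewrite (inside_before HZ HL) /before (@eq_in_count _ _ pred0) ?count_pred0 // => s Hs /=.
  by rewrite ltNge Hmin // andbF.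
have := inside_lft_rgt HZ t; rewrite /lft /rgt Ed; have := out.
rewrite /apos; case: (zv Z t) => [[a b] []] /= H; rewrite ?H //.
by case: (inside _ _).
Qed.

Lemma sweepable_neq0 L : sweepable Z L -> L != [::].
Proof.
move=> HL; apply/eqP => E; have := inside_lft_rgt HZ 0.
by rewrite !(inside_before HZ HL) E.
Qed.

(** * Buckets *)

(** The bound [q] serves twice: for the list after [q] insertions, and for the rest of a list being
    read, since below its head [t] remains [bucket a t.-1]. *)
Definition bucket (a : int) (q : nat) : seq nat :=
  [seq t <- iota 1 q | (zd Z t == D2) && (apos Z t == a)].

Lemma bucketS a q : bucket a q.+1 =
  if (zd Z q.+1 == D2) && (apos Z q.+1 == a) then rcons (bucket a q) q.+1 else bucket a q.
Proof.
have E : iota 1 (q + 1) = iota 1 q ++ [:: q.+1] by rewrite iotaD add1n.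
rewrite addn1 in E; rewrite /bucket E filter_cat /=.
by case: ifP; rewrite ?cats1 ?cats0.
Qed.

Lemma mem_bucket a q t :
  (t \in bucket a q) = [&& (0 < t <= q)%N, zd Z t == D2 & apos Z t == a].
Proof. by rewrite mem_filter mem_iota add1n ltnS andbC. Qed.

Lemma bucket_last a q : last 0%N (bucket a q) != 0%N ->
  let t := last 0%N (bucket a q) in
  bucket a q = rcons (bucket a t.-1) t /\ t \in bucket a q.
Proof.
elim: q => [//|q IH]; rewrite bucketS; case: ifP => // _ _ /=.
by rewrite last_rcons mem_rcons mem_head.
Qed.

Lemma bucket_last0 a q : last 0%N (bucket a q) = 0%N -> bucket a q = [::].
Proof.
move: (mem_bucket a q 0); case/lastP: (bucket a q) => // s t; rewrite last_rcons => H E.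
by move: H; rewrite E mem_rcons mem_head.
Qed.

(** Buckets are reversed because a linked list returns the latest insertion first. *)
Definition events (a : int) (k : nat) : seq nat :=
  flatten [seq rev (bucket (a + j%:Z) n) | j <- iota 0 k].

Lemma eventsS a k : events a k.+1 = events a k ++ rev (bucket (a + k%:Z) n).
Proof. by rewrite /events -addn1 iotaD map_cat flatten_cat /= cats0. Qed.

Lemma mem_events a k t : (t \in events a k) =
  [&& (0 < t <= n)%N, zd Z t == D2 & a <= apos Z t < a + k%:Z].
Proof.
elim: k => [|k IH]; first by rewrite /events /= in_nil; lia.
by rewrite eventsS mem_cat mem_rev mem_bucket IH; case: (_ < _ <= _)%N; case: (_ == D2) => //=; lia.
Qed.

Lemma uniq_events a k : uniq (events a k).
Proof.
elim: k => [//|k IH]; rewrite eventsS cat_uniq IH rev_uniq filter_uniq ?iota_uniq // andbT.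
apply/hasPn => t; rewrite mem_rev mem_bucket mem_events => /and3P [_ _ /eqP ->].
by rewrite !negb_and; apply/orP; right; apply/orP; right; lia.
Qed.

Lemma size_events a k : (size (events a k) <= n)%N.
Proof.
rewrite -[n in X in (_ <= X)%N](size_iota 1); apply: uniq_leq_size (uniq_events a k) _ => t.
by rewrite mem_events mem_iota => /and3P [H _ _]; lia.
Qed.

Lemma sweepable_events a k :
  (forall t, (t <= n)%N -> a <= apos Z t < a + k%:Z) -> sweepable Z (events a k).
Proof.
move=> Hb; split; first exact: uniq_events.
  move=> t; rewrite mem_events; case: (boolP (0 < t <= n)%N) => //= /andP [_ Ht].
  by rewrite Hb // andbT.
elim: k {Hb} => [//|k IH]; rewrite eventsS pairwise_cat IH /=; apply/andP; split.
  apply/allrelP => s t; rewrite mem_events mem_rev mem_bucket.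
  by move=> /and3P [_ _ H] /and3P [_ _ /eqP ->]; lia.
apply: (@sub_in_pairwise _ (mem (rev (bucket (a + k%:Z) n))) (fun _ _ => true)).
- move=> s t; rewrite /= ?inE !mem_rev !mem_bucket => /and3P [_ _ /eqP E1] /and3P [_ _ /eqP E2].
  by rewrite E1 E2.
- exact/allP.
- by elim: (rev _) => //= x l ->; rewrite all_predT.
Qed.

Lemma apos_bounds t : (t <= n)%N -> apos Z 0 - n%:Z <= apos Z t <= apos Z 0 + n%:Z.
Proof.
suff H : `|apos Z t - apos Z 0| <= t%:Z by lia.
elim: t => [|t IH]; first by rewrite subrr.
have : `|apos Z t.+1 - apos Z t| <= 1.
  rewrite /apos -[zv Z t.+1](nb_zd HZ); case: (zv Z t) => [[a b] s].
  by case: s; case: (zd Z t) => /=; lia.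
by lia.
Qed.

End Reading.

(** * The program *)

Declare Scope sexp_scope.
Delimit Scope sexp_scope with sx.
Bind Scope sexp_scope with sexp.
Notation "x + y" := (SAdd x y) : sexp_scope.
Notation "x - y" := (SSub x y) : sexp_scope.
Notation "x * y" := (SMul x y) : sexp_scope.
Notation "x <= y" := (SLeq x y) : sexp_scope.
Notation "# z" := (SConst z%Z) (at level 0, z at level 0, format "# z") : sexp_scope.
Notation "k '$[' x ]" := (SGet k x) (at level 1, x at level 50, format "k '$[' x ]") : sexp_scope.
Notation "k '$'" := (SGet k (SConst 0)) (at level 1, format "k '$'") : sexp_scope.
Notation "k '@@' x <~ y" := (SSet k x%sx y%sx) (at level 70, x at level 60, y at level 60) : sexp_scope.
Notation "k <~ y" := (SSet k (SConst 0) y%sx) (at level 70, y at level 60) : sexp_scope.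
Notation "p ;; q" := (SSeq p q) (at level 75, right associativity) : sexp_scope.

Definition SEq (x y : sexp) : sexp := SMul (SLeq x y) (SLeq y x).

Lemma seval_SEq inp s x y : seval inp s (SEq x y) = beq (seval inp s x) (seval inp s y).
Proof. by rewrite /= /beq; case: ltgtP. Qed.

(* [ro]: whether the interior is on the left of the cycle; [rp], [rq], [rr]: directions
   of the edges into and out of a vertex and of its third edge; [ra]: position of the
   bucket being scanned; [rt]: current step; [rt0]: the step matched with it. *)
Notation rn := 0%N.
Notation ri := 1%N.
Notation rbest := 2%N.
Notation ro := 3%N.
Notation rp := 4%N.
Notation rq := 5%N.
Notation rr := 6%N.
Notation rx := 7%N.
Notation ry := 8%N.
Notation ra := 9%N.
Notation rt := 10%N.
Notation rt0 := 11%N.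
Notation rl := 12%N.
Notation rc := 13%N.
Notation rw := 14%N.
Notation rn1 := 15%N.
Notation rm1 := 16%N.
Notation rwSz := 17%N.
Notation rwPIv := 18%N.
Notation rwSze := 19%N.
Notation rwPI := 20%N.
(* [aA], [aB], [aS]: the vertices of the cycle; [aD]: their deficiencies; [aV], [aE]:
   [vsum] and [esum]; [ahead], [anext]: linked lists of the steps of direction [D2] at
   each position; [apend]: the unmatched step of each line, or 0. *)
Notation aA := 21%N.
Notation aB := 22%N.
Notation aS := 23%N.
Notation aD := 24%N.
Notation aV := 25%N.
Notation aE := 26%N.
Notation ahead := 27%N.
Notation anext := 28%N.
Notation apend := 29%N.

Local Open Scope sexp_scope.

(** The cycle is rotated while it is read: with [c = - a - b - s], iterating [rho] sends [(a, b)] to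
    [(b, c)] and then to [(c, a)]. *)
Definition coordinates (d : nat) : sexp * sexp :=
  let a := SInput (rx$ + #1) in let b := SInput (rx$ + #2) in
  let c := #0 - a - b - SInput (rx$ + #3) in
  match d with 0 => (a, b) | 1 => (b, c) | _ => (c, a) end%N.

(** Vertices up to [n + 2] are stored so that no later loop wraps around: the prefix loop reads
    vertex [i + 1] for [i <= n + 1]. As [n > 2], one subtraction of [n] reduces the index. *)
Definition copy_cond : sexp := ri$ <= rn$ + #2.

Definition copy_body (d : nat) : sprog :=
  rx <~ #3 * (ri$ - rn$ * (rn$ <= ri$)) ;;
  aA @@ ri$ <~ (coordinates d).1 ;;
  aB @@ ri$ <~ (coordinates d).2 ;;
  aS @@ ri$ <~ SInput (rx$ + #3) ;;
  ri <~ ri$ + #1.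

Definition isD2 (i : sexp) : sexp :=
  SEq aA$[i] aA$[i + #1] * SEq aB$[i] aB$[i + #1].

Definition orient_cond : sexp := ri$ <= rn$.

Definition orient_body : sprog :=
  SIf (isD2 (ri$))
    (SIf ((rbest$ <= #0) + (aA$[ri$] + #1 <= aA$[rbest$])) (rbest <~ ri$) SSkip)
    SSkip ;;
  ri <~ ri$ + #1.

Definition step_code (i : sexp) : sexp :=
  #2 - #2 * ((aA$[i + #1] - aA$[i]) * (aA$[i + #1] - aA$[i]))
     - (aB$[i + #1] - aB$[i]) * (aB$[i + #1] - aB$[i]).

Definition prefix_cond : sexp := ri$ <= rn$ + #1.

Definition prefix_body : sprog :=
  rp <~ step_code (ri$ - #1) ;;
  rq <~ step_code (ri$) ;;
  rr <~ #3 - rp$ - rq$ ;;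
  rx <~ SEq (rr$ + aS$[ri$]) #1 ;;
  ry <~ SEq (rr$) aS$[ri$] ;;
  aD @@ ri$ <~ SEq (SEq (rq$ - rp$) #1 + SEq (rq$ - rp$) #(-2)) (ro$) ;;
  aV @@ ri$ <~ aV$[ri$ - #1] + aD$[ri$] *
    (rx$ * (#2 * aA$[ri$] + aS$[ri$] + #1) - ry$ * (#2 * aA$[ri$] + aS$[ri$])) ;;
  aE @@ ri$ <~ aE$[ri$ - #1] + (#3 * (aD$[ri$] *
    (rx$ * (aA$[ri$] + #1) - ry$ * (aA$[ri$] + aS$[ri$]))) - aD$[ri$] * (#1 - aS$[ri$])) ;;
  SIf ((ri$ <= rn$) * SEq (rq$) #2)
    (anext @@ ri$ <~ ahead$[aA$[ri$]] ;; ahead @@ aA$[ri$] <~ ri$) SSkip ;;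
  ri <~ ri$ + #1.

(** Each round opens a bucket or processes a step. Positions span at most [2 n + 1] values and there
    are at most [n] steps, so [4 n + 1] rounds suffice; spare rounds open empty buckets. *)
Definition sweep_cond : sexp := ri$ <= #4 * rn$.

Definition match_body : sprog :=
  rt0 <~ apend$[rl$] ;;
  apend @@ rl$ <~ #0 ;;
  SIf (rt$ <= rt0$) (rx <~ rt$ ;; ry <~ rt0$) (rx <~ rt0$ ;; ry <~ rt$) ;;
  rc <~ aA$[rt$] - aA$[rt0$] + #1 ;;
  rw <~ #6 * rc$ - aD$[rt0$] - aD$[rt0$ + #1] - aD$[rt$] - aD$[rt$ + #1] ;;
  rn1 <~ aV$[ry$] - aV$[rx$] ;;
  rm1 <~ aE$[ry$] - aE$[rx$] - (#1 - aS$[rx$ + #1]) * rc$ ;;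
  rwSz <~ rwSz$ + rw$ * (rn1$ * (aV$[rn$] - rn1$)) ;;
  rwPIv <~ rwPIv$ + rw$ * (rn1$ + (aV$[rn$] - rn1$)) ;;
  rwSze <~ rwSze$ + rw$ * (rm1$ * (aE$[rn$] - rc$ - rm1$)) ;;
  rwPI <~ rwPI$ + rw$ * (rm1$ + (aE$[rn$] - rc$ - rm1$)).

Definition sweep_body : sprog :=
  SIf (rt$ <= #0)
    (ra <~ ra$ + #1 ;; rt <~ ahead$[ra$] ;; ahead @@ ra$ <~ #0)
    (rl <~ aA$[rt$] + aB$[rt$] ;;
     SIf (apend$[rl$] <= #0) (apend @@ rl$ <~ rt$) match_body ;;
     rt <~ anext$[rt$]) ;;
  ri <~ ri$ + #1.

Definition start_copy : sprog := ri <~ #0.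
Definition start_orient : sprog := ri <~ #1 ;; rbest <~ #0.
Definition start_prefix : sprog :=
  ro <~ #1 - aS$[rbest$] ;; ri <~ #1 ;; aV @@ #0 <~ #0 ;; aE @@ #0 <~ #0.
Definition start_sweep : sprog := ra <~ aA$[#0] - rn$ - #1 ;; rt <~ #0 ;; ri <~ #0.

Definition direction_program (d : nat) : program :=
  Seq (compile start_copy)
  (Seq (loop copy_cond (copy_body d))
  (Seq (compile start_orient)
  (Seq (loop orient_cond orient_body)
  (Seq (compile start_prefix)
  (Seq (loop prefix_cond prefix_body)
  (Seq (compile start_sweep)
       (loop sweep_cond sweep_body))))))).

Close Scope sexp_scope.

(** * Invariants of the loops *)

Lemma nat_of_boolP (b : bool) : ((b : nat)%:Z != 0) = b.
Proof. by case: b. Qed.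

Lemma srun_if inp x p q s : srun inp (SIf x p q) s =
  if seval inp s x != 0 then srun inp p s else srun inp q s.
Proof. by []. Qed.

Lemma srun_seq inp p q s : srun inp (SSeq p q) s = srun inp q (srun inp p s).
Proof. by []. Qed.

Lemma srun_set inp k i x s : srun inp (SSet k i x) s = supd s k (seval inp s i) (seval inp s x).
Proof. by []. Qed.

Lemma srun_scalar inp k x s : srun inp (SSet k (SConst 0) x) s = supd s k 0 (seval inp s x).
Proof. by []. Qed.

Lemma seval_SAdd inp s x y : seval inp s (SAdd x y) = seval inp s x + seval inp s y.
Proof. by []. Qed.

Lemma seval_SMul inp s x y : seval inp s (SMul x y) = seval inp s x * seval inp s y.
Proof. by []. Qed.

Definition index_term (k : nat) (n1 n2 m1 m2 : int) : int :=
  match k with 0%N => n1 * n2 | 1%N => n1 + n2 | 2%N => m1 * m2 | _ => m1 + m2 end.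

Definition contribution (Z : seq hvertex) (k : nat) (p : nat * nat) : int :=
  let c := apos Z p.2 - apos Z p.1 + 1 in
  let n1 := arc_vertices Z p.1 p.2 in
  let m1 := arc_edges Z (apos Z p.1) (apos Z p.2) p.1 p.2 in
  cut_weight Z (apos Z p.1) (apos Z p.2) p.1 p.2 *
    index_term k n1 (vsum Z (size Z) - n1) m1 (esum Z (size Z) - c - m1).

Lemma sweep_mem Z L1 l : ((sweep Z L1).1 l == 0)%N || ((sweep Z L1).1 l \in L1).
Proof.
elim/last_ind: L1 => // L1 t; rewrite /sweep foldl_rcons -/(sweep Z L1).
case: (sweep Z L1) => pend prs /= IH; rewrite /sweep_step mem_rcons inE /=.
by case: ifP => _ /=; case: (l == line Z t); rewrite ?eqxx ?orbT //;
  case/orP: IH => ->; rewrite ?orbT.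
Qed.

Section Loops.

Variables (inp : memory) (Z : seq hvertex).
Hypothesis HZ : lattice_cycle Z.

Let n := size Z.

(** The state between two directions: the tables that must start at 0 are 0, and [acc] holds the
    totals of the directions already treated. *)
Definition clean (acc : nat -> int) (s : store) : Prop :=
  [/\ s rn 0 = n%:Z, (forall a, s ahead a = 0), (forall l, s apend l = 0) &
      [/\ s rwSz 0 = acc 0%N, s rwPIv 0 = acc 1%N, s rwSze 0 = acc 2%N & s rwPI 0 = acc 3%N]].

Definition copied (N : nat) (s : store) : Prop := forall i, (i < N)%N ->
  [/\ s aA i%:Z = (zv Z i).1.1, s aB i%:Z = (zv Z i).1.2 & s aS i%:Z = ((zv Z i).2 : nat)%:Z].

Lemma orient_loop acc s : clean acc s -> copied n.+3 s -> s ri 0 = 1 -> s rbest 0 = 0 ->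
  reach inp (loop orient_cond orient_body) s (n.+1 * loop_cost orient_cond orient_body)
    (fun s' => [/\ clean acc s', copied n.+3 s' & exists b : nat,
       [/\ s' rbest 0 = b%:Z, (0 < b <= n)%N, zd Z b = D2 &
           forall t, (0 < t <= n)%N -> zd Z t = D2 -> apos Z b <= apos Z t]]).
Proof.
move=> Hc Ha Hi Hb.
pose Inv j s' := [/\ clean acc s', copied n.+3 s', s' ri 0 = j.+1%:Z & exists b : nat,
  [/\ s' rbest 0 = b%:Z, (b <= j)%N, b != 0%N -> zd Z b = D2 &
      forall t, (0 < t <= j)%N -> zd Z t = D2 -> b != 0%N /\ apos Z b <= apos Z t]].
have H : reach inp (loop orient_cond orient_body) s (n.+1 * loop_cost orient_cond orient_body) (Inv n).
  apply: (reach_loop (Inv := Inv)).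
  - by split=> //; exists 0%N; split=> // t; case: t.
  - move=> j s' Hj [C1 C2 C3 [b [B1 B2 B3 B4]]].
    have E : seval inp s' (isD2 (SGet ri (SConst 0))) = (zd Z j.+1 == D2 : nat)%:Z.
      rewrite /isD2 seval_SMul !seval_SEq /= C3.
      rewrite (_ : j.+1%:Z + 1 = j.+2%:Z); last by lia.
      have [|-> -> _] := C2 j.+1; first by lia.
      have [|-> -> _] := C2 j.+2; first by lia.
      rewrite -(inj_eq (can_inj codeK)) -[zv Z j.+2](nb_zd HZ).
      by rewrite /beq; case: (zv Z j.+1) => [[a b'] []]; case: (zd Z j.+1) => /=; lia.
    rewrite /orient_body srun_seq srun_if E nat_of_boolP.
    have [Ed|Nd] := eqVneq (zd Z j.+1) D2.
      rewrite srun_if; case: ifPn => Hcmp.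
        split=> //=; rewrite /supd /= ?C3; first by lia.
        exists j.+1; split=> // t Ht Hd; split=> //.
        have [Et|Nt] := eqVneq t j.+1; first by rewrite Et.
        have [|b0 Hle] := B4 t _ Hd; first by lia.
        apply: le_trans Hle; move: Hcmp; rewrite /= C3 B1.
        have [|-> _ _] := C2 j.+1; first by lia.
        have [|-> _ _] := C2 b; first by lia.
        by rewrite -/(apos Z b) -/(apos Z j.+1); do 2 case: ifP => //; lia.
      split=> //=; rewrite /supd /= ?C3; first by lia.
      exists b; split=> //; first by lia.
      move: Hcmp; rewrite /= C3 B1.
      have [|-> _ _] := C2 j.+1; first by lia.
      have [|-> _ _] := C2 b; first by lia.
      rewrite -/(apos Z b) -/(apos Z j.+1) => Hcmp t Ht Hd.
      have [Et|Nt] := eqVneq t j.+1.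
        by rewrite Et; move: Hcmp; do 2 case: ifP => //; lia.
      by apply: B4 => //; lia.
    split=> //=; rewrite /supd /= ?C3; first by lia.
    exists b; split=> //; first by lia.
    move=> t Ht Hd; apply: B4 => //.
    by have [Et|Nt] := eqVneq t j.+1; [move: Nd; rewrite -Et Hd|lia].
  - move=> j s' Hj [[C1 _ _ _] _ C3 _]; rewrite /= C1 C3.
    by rewrite lez_nat; case: ltnP.
apply: (reach_weaken H) => // s' [H1 H2 _ [b [B1 B2 B3 B4]]]; split=> //.
have n0 := size_cycle_gt0 HZ.
have HL : sweepable Z (events Z (apos Z 0 - n%:Z) (n + n).+1).
  by apply: (sweepable_events HZ) => t Ht; have := apos_bounds HZ Ht; rewrite -/n; lia.
have [t Ht] : exists t, t \in events Z (apos Z 0 - n%:Z) (n + n).+1.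
  have := sweepable_neq0 HZ HL; case: (events _ _ _) => // t l _.
  by exists t; rewrite mem_head.
have [_ mL _] := HL; move: Ht; rewrite mL => /andP [Ht /eqP Hd].
have [b0 _] := B4 t Ht Hd; exists b; split=> //; [by rewrite lt0n b0|exact: B3|].
by move=> t' Ht' /(B4 _ Ht') [].
Qed.

(** The hypothesis on reading hides the rotation: [Z] is the rotated cycle, while [inp] remains the
    original input. *)
Lemma copy_loop d acc s : clean acc s -> s ri 0 = 0 ->
  (forall i s', (i < n.+3)%N -> s' rx 0 = 3 * (i%:Z - n%:Z * (if n%:Z <= i%:Z then 1 else 0)) ->
     [/\ seval inp s' (coordinates d).1 = (zv Z i).1.1,
         seval inp s' (coordinates d).2 = (zv Z i).1.2
       & seval inp s' (SInput (rx$ + #3)%sx) = ((zv Z i).2 : nat)%:Z]) ->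
  reach inp (loop copy_cond (copy_body d)) s (n.+4 * loop_cost copy_cond (copy_body d))
    (fun s' => clean acc s' /\ copied n.+3 s').
Proof.
move=> Hc Hi Hread.
pose Inv j s' := [/\ clean acc s', copied j s' & s' ri 0 = j%:Z].
have H : reach inp (loop copy_cond (copy_body d)) s
    (n.+4 * loop_cost copy_cond (copy_body d)) (Inv n.+3).
  apply: (reach_loop (Inv := Inv)); first by split.
  - move=> j s' Hj [C1 C2 C3]; have [C10 _ _ _] := C1.
    rewrite /copy_body srun_seq srun_scalar; set v := seval _ _ _.
    have Ev : v = 3 * (j%:Z - n%:Z * (if n%:Z <= j%:Z then 1 else 0)) by rewrite /v /= C3 C10.
    set s1 := supd _ _ _ _.
    have [R1 R2 R3] := Hread j s1 Hj Ev.
    rewrite srun_seq srun_set R1; set s2 := supd _ _ _ _.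
    have [_ R2' _] := Hread j s2 Hj Ev.
    rewrite srun_seq srun_set R2'; set s3 := supd _ _ _ _.
    have [_ _ R3'] := Hread j s3 Hj Ev.
    rewrite srun_seq [srun inp (SSet aS _ _) s3]srun_set R3' srun_scalar.
    split=> //=; last by rewrite /s3 /s2 /s1 /supd /= C3; lia.
    move=> i; rewrite ltnS leq_eqVlt /s3 /s2 /s1 /supd /= C3 eqz_nat => /orP [/eqP ->|Hi'].
      by rewrite eqxx.
    by rewrite (ltn_eqF Hi'); apply: C2.
  - move=> j s' Hj [[C1 _ _ _] _ C3]; rewrite /= C1 C3.
    by case: ifP; lia.
by apply: (reach_weaken H) => // s' [].
Qed.

Lemma seval_step_code s i t : copied n.+3 s -> seval inp s i = t%:Z -> (t.+1 < n.+3)%N ->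
  seval inp s (step_code i) = dircode Z t.
Proof.
move=> C Ei Ht; rewrite /= Ei dircodeE // (_ : t%:Z + 1 = t.+1%:Z); last by lia.
have [-> -> _] := C _ Ht.
by have [-> -> _] := C _ (ltnW Ht).
Qed.

Definition prefixes (N : nat) (s : store) : Prop := forall i, (i <= N)%N ->
  [/\ (0 < i)%N -> s aD i%:Z = (deficient Z (zv Z i) : nat)%:Z, s aV i%:Z = vsum Z i
    & s aE i%:Z = esum Z i].

Definition chained (N : nat) (s : store) : Prop :=
  forall t, (0 < t <= N)%N -> zd Z t = D2 ->
    s anext t%:Z = (last 0%N (bucket Z (apos Z t) t.-1))%:Z.

Definition frame (acc : nat -> int) (s : store) : Prop :=
  [/\ s rn 0 = n%:Z, s rwSz 0 = acc 0%N, s rwPIv 0 = acc 1%N, s rwSze 0 = acc 2%N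
    & s rwPI 0 = acc 3%N].

Lemma prefix_loop acc s : clean acc s -> copied n.+3 s -> s ri 0 = 1 ->
  s ro 0 = (inside Z (lft Z 0) : nat)%:Z -> s aV 0 = 0 -> s aE 0 = 0 ->
  reach inp (loop prefix_cond prefix_body) s (n.+2 * loop_cost prefix_cond prefix_body)
    (fun s' => [/\ frame acc s' /\ (forall l, s' apend l = 0), copied n.+3 s',
       prefixes n.+1 s', chained n s' & forall a, s' ahead a = (last 0%N (bucket Z a n))%:Z]).
Proof.
move=> [Hc1 Hc2 Hc3 [Hc4 Hc5 Hc6 Hc7]] Ha Hi Ho HV HE.
pose Inv j s' := [/\ frame acc s' /\ (forall l, s' apend l = 0),
  copied n.+3 s' /\ s' ri 0 = j.+1%:Z, prefixes j s',
  chained (minn j n) s' /\ (forall a, s' ahead a = (last 0%N (bucket Z a (minn j n)))%:Z)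
  & s' ro 0 = (inside Z (lft Z 0) : nat)%:Z].
have H : reach inp (loop prefix_cond prefix_body) s
    (n.+2 * loop_cost prefix_cond prefix_body) (Inv n.+1).
  apply: (reach_loop (Inv := Inv)).
  - split=> //.
      by case=> [|i] // _; split=> //; rewrite ?HV ?HE /vsum /esum big_ord0.
    by split=> [t|a]; rewrite min0n ?Hc2 //; case: t.
  - move=> j s' Hj [[C1 C2] [C3 C4] C5 [C6 C7] C8].
    have Cj := C3 j ltac:(lia); have [Aj Bj Sj] := C3 j.+1 ltac:(lia).
    have [F1 F2 F3] := turn_formulas HZ j.
    have [_ V0 E0] := C5 j (leqnn j).
    have Ej : j.+1%:Z - 1 = j%:Z by lia.
    rewrite /prefix_body srun_seq srun_scalar (@seval_step_code _ _ j) //; last 2 first.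
    + by rewrite /= C4.
    + by lia.
    set s1 := supd _ _ _ _.
    rewrite srun_seq srun_scalar (@seval_step_code s1 _ j.+1) //.
    set s2 := supd _ _ _ _.
    pose r : int := 3 - dircode Z j - dircode Z j.+1.
    have Er : seval inp s2 (#3 - rp$ - rq$)%sx = r by [].
    rewrite srun_seq srun_scalar Er; set s3 := supd _ _ _ _.
    pose sj : int := ((zv Z j.+1).2 : nat)%:Z; pose aj : int := (zv Z j.+1).1.1.
    have Ex : seval inp s3 (SEq (rr$ + aS$[ri$]) #1)%sx = beq (r + sj) 1.
      by rewrite seval_SEq /= /s3 /s2 /s1 /supd /= C4 Sj.
    rewrite srun_seq srun_scalar Ex; set s4 := supd _ _ _ _.
    have Ey : seval inp s4 (SEq (rr$) aS$[ri$])%sx = beq r sj.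
      by rewrite seval_SEq /= /s4 /s3 /s2 /s1 /supd /= C4 Sj.
    rewrite srun_seq srun_scalar Ey; set s5 := supd _ _ _ _.
    have Ei5 : seval inp s5 (ri$)%sx = j.+1%:Z by exact: C4.
    have ED : seval inp s5 (SEq (SEq (rq$ - rp$) #1 + SEq (rq$ - rp$) #(-2)) (ro$))%sx =
        (deficient Z (zv Z j.+1) : nat)%:Z.
      by rewrite F1 seval_SEq seval_SAdd !seval_SEq /= /s5 /s4 /s3 /s2 /s1 /supd /= C8.
    rewrite srun_seq srun_set Ei5 ED; set s6 := supd _ _ _ _.
    have Ei6 : seval inp s6 (ri$)%sx = j.+1%:Z by exact: C4.
    have vS : vsum Z j.+1 = vsum Z j + vertex_ends Z (zv Z j.+1) by rewrite /vsum big_ord_recr.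
    have eS : esum Z j.+1 = esum Z j + edge_ends Z (zv Z j.+1) by rewrite /esum big_ord_recr.
    rewrite srun_seq srun_set Ei6; set v := seval _ _ _.
    have {v} -> : v = vsum Z j.+1.
      rewrite /v vS F2 -F1 /= /s6 /s5 /s4 /s3 /s2 /s1 /supd /= C4 eqxx Ej V0 Aj Sj.
      by rewrite -/sj -/aj.
    set s7 := supd _ _ _ _; have Ei7 : seval inp s7 (ri$)%sx = j.+1%:Z by exact: C4.
    rewrite srun_seq srun_set Ei7; set v := seval _ _ _.
    have {v} -> : v = esum Z j.+1.
      rewrite /v eS F3 -F1 /= /s7 /s6 /s5 /s4 /s3 /s2 /s1 /supd /= C4 eqxx Ej E0 Aj Sj.
      by rewrite -/sj -/aj.
    set s8 := supd _ _ _ _; rewrite srun_seq srun_if.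
    have C10 : s' rn 0 = n%:Z by case: C1.
    have -> : seval inp s8 ((ri$ <= rn$) * SEq (rq$) #2)%sx =
        ((j < n)%N && (zd Z j.+1 == D2) : nat)%:Z.
      rewrite seval_SMul seval_SEq [X in _ * X](dircode_eq2 Z j.+1).
      rewrite /= /s8 /s7 /s6 /s5 /s4 /s3 /s2 /s1 /supd /= C4 C10.
      by rewrite lez_nat; case: (j < n)%N; rewrite ?mul1r ?mul0r.
    rewrite nat_of_boolP.
    have Cp s9 : (forall i, s9 aD i = s8 aD i) -> (forall i, s9 aV i = s8 aV i) ->
        (forall i, s9 aE i = s8 aE i) -> prefixes j.+1 s9.
      move=> G1 G2 G3 i; rewrite G1 G2 G3 leq_eqVlt /s8 /s7 /s6 /supd /= eqz_nat.
      case/orP => [/eqP ->|Hi']; first by rewrite eqxx.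
      by rewrite (ltn_eqF Hi'); apply: C5.
    rewrite srun_scalar; case: ifPn => Hc.
      have {Hc} [Hjn /eqP Hd] := andP Hc.
      rewrite srun_seq [srun inp (SSet anext _ _) s8]srun_set.
      have -> : seval inp s8 (ri$)%sx = j.+1%:Z by exact: C4.
      have -> : seval inp s8 (ahead$[aA$[ri$]])%sx = s' ahead aj.
        by rewrite /= /s8 /s7 /s6 /s5 /s4 /s3 /s2 /s1 /supd /= C4 Aj.
      set s9 := supd s8 _ _ _; rewrite srun_set.
      have -> : seval inp s9 (ri$)%sx = j.+1%:Z by exact: C4.
      have -> : seval inp s9 (aA$[ri$])%sx = aj.
        by rewrite /= /s9 /s8 /s7 /s6 /s5 /s4 /s3 /s2 /s1 /supd /= C4 Aj.
      have mj : minn j n = j by lia.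
      have mj1 : minn j.+1 n = j.+1 by lia.
      split=> //=.
      - by split=> //; rewrite [LHS](_ : _ = s' ri 0 + 1) // C4; lia.
      - exact: Cp.
      - rewrite mj1; split=> [t Ht Hdt|a]; rewrite /s9 /supd /=.
          rewrite eqz_nat; have [->|Nt] := eqVneq t j.+1; first by rewrite C7 mj.
          by apply: C6 => //; rewrite mj; lia.
        rewrite bucketS Hd eqxx /= /apos -/aj [aj == a]eq_sym.
        case: eqP => [->|_]; first by rewrite last_rcons.
        by have := C7 a; rewrite mj.
    split=> //=.
    - by split=> //; rewrite [LHS](_ : _ = s' ri 0 + 1) // C4; lia.
    - exact: Cp.
    - have [Hjn|Hjn] := ltnP j n; last first.
        by rewrite (_ : minn j.+1 n = minn j n); last by lia.
      have mj : minn j n = j by lia.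
      have mj1 : minn j.+1 n = j.+1 by lia.
      rewrite Hjn /= in Hc; rewrite mj1; split=> [t Ht Hdt|a].
        apply: C6 => //; rewrite mj.
        by have [Et|Nt] := eqVneq t j.+1; [move: Hc; rewrite -Et Hdt|lia].
      by rewrite bucketS (negbTE Hc) /=; have := C7 a; rewrite mj.
  - move=> j s' Hj [[[C1 _ _ _ _] _] [_ C4] _ _ _]; rewrite /= C1 C4.
    by case: ifP; lia.
apply: (reach_weaken H) => // s' [C1 [C3 _] C5 [C6 C7] _].
by rewrite (_ : minn n.+1 n = n) in C6 C7; [split|lia].
Qed.

Definition arrays (s : store) : Prop :=
  [/\ s rn 0 = n%:Z, copied n.+3 s, prefixes n.+1 s & chained n s].

Lemma match_run s t p0 l : arrays s -> s rt 0 = t%:Z -> s rl 0 = l -> s apend l = p0%:Z ->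
  (0 < t <= n)%N -> (0 < p0 <= n)%N -> let s' := srun inp match_body s in
  [/\ forall k i, k \in [:: rn; ri; ra; rt; aA; aB; aS; aD; aV; aE; ahead; anext] ->
        s' k i = s k i,
      forall l', s' apend l' = if l' == l then 0 else s apend l'
    & [/\ s' rwSz 0 = s rwSz 0 + contribution Z 0 (p0, t),
          s' rwPIv 0 = s rwPIv 0 + contribution Z 1 (p0, t),
          s' rwSze 0 = s rwSze 0 + contribution Z 2 (p0, t)
        & s' rwPI 0 = s rwPI 0 + contribution Z 3 (p0, t)]].
Proof.
move=> [C1 C2 C3 _] Ht Hl Hp bt bp.
rewrite /match_body srun_seq srun_scalar.
have -> : seval inp s (apend$[rl$])%sx = p0%:Z by rewrite /= Hl.
set s1 := supd _ _ _ _; rewrite srun_seq srun_set.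
have -> : seval inp s1 (rl$)%sx = l by exact: Hl.
have -> : seval inp s1 (#0)%sx = 0 by [].
set s2 := supd _ _ _ _; rewrite srun_seq.
set s4 := srun inp (SIf _ _ _) s2.
have E4 k i : k != rx -> k != ry -> s4 k i = s2 k i.
  move=> /negbTE Nx /negbTE Ny; rewrite /s4 srun_if; case: ifP => _;
    by rewrite srun_seq !srun_scalar /supd Nx Ny.
have [Ex Ey] : s4 rx 0 = (minn p0 t)%:Z /\ s4 ry 0 = (maxn p0 t)%:Z.
  rewrite /s4 srun_if /= /s2 /s1 /supd /= Ht lez_nat.
  by case: leqP => H /=; split=> //=; rewrite ?Ht.
have bx : (0 < minn p0 t <= n)%N by lia.
have by_ : (0 < maxn p0 t <= n)%N by lia.
have A4 i : (i <= n.+1)%N -> [/\ (0 < i)%N -> s4 aD i%:Z = (deficient Z (zv Z i) : nat)%:Z,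
    s4 aV i%:Z = vsum Z i & s4 aE i%:Z = esum Z i] by move=> Hi; rewrite !E4 //; exact: C3.
have B4 i : (i <= n.+1)%N -> s4 aA i%:Z = apos Z i /\ s4 aS i%:Z = ((zv Z i).2 : nat)%:Z.
  by move=> Hi; rewrite !E4 //; have [] := C2 i ltac:(lia).
have Et : s4 rt 0 = t%:Z by rewrite E4.
have Ep : s4 rt0 0 = p0%:Z by rewrite E4.
pose c : int := apos Z t - apos Z p0 + 1.
pose w := cut_weight Z (apos Z p0) (apos Z t) p0 t.
pose n1 := arc_vertices Z p0 t.
pose m1 := arc_edges Z (apos Z p0) (apos Z t) p0 t.
rewrite srun_seq srun_scalar.
have -> : seval inp s4 (aA$[rt$] - aA$[rt0$] + #1)%sx = c.
  have [B1 _] := B4 t ltac:(lia); have [B2 _] := B4 p0 ltac:(lia).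
  by rewrite /= Et Ep B1 B2.
set s5 := supd _ _ _ _; rewrite srun_seq srun_scalar.
have -> : seval inp s5 (#6 * rc$ - aD$[rt0$] - aD$[rt0$ + #1] - aD$[rt$] - aD$[rt$ + #1])%sx = w.
  have [B1 _ _] := A4 t ltac:(lia); have [B2 _ _] := A4 p0 ltac:(lia).
  have [B3 _ _] := A4 t.+1 ltac:(lia); have [B4' _ _] := A4 p0.+1 ltac:(lia).
  rewrite /= /s5 /supd /= Et Ep.
  rewrite (_ : p0%:Z + 1%Z = p0.+1%:Z); last by lia.
  rewrite (_ : t%:Z + 1%Z = t.+1%:Z); last by lia.
  by rewrite B1 ?B2 ?B3 ?B4' //; lia.
set s6 := supd _ _ _ _; rewrite srun_seq srun_scalar.
have -> : seval inp s6 (aV$[ry$] - aV$[rx$])%sx = n1.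
  have [_ B1 _] := A4 (minn p0 t) ltac:(lia); have [_ B2 _] := A4 (maxn p0 t) ltac:(lia).
  by rewrite /= /s6 /s5 /supd /= Ex Ey B1 B2.
set s7 := supd _ _ _ _; rewrite srun_seq srun_scalar.
have -> : seval inp s7 (aE$[ry$] - aE$[rx$] - (#1 - aS$[rx$ + #1]) * rc$)%sx = m1.
  have [_ _ B1] := A4 (minn p0 t) ltac:(lia); have [_ _ B2] := A4 (maxn p0 t) ltac:(lia).
  have [_ B3] := B4 (minn p0 t).+1 ltac:(lia).
  rewrite /= /s7 /s6 /s5 /supd /= Ex Ey B1 B2.
  rewrite (_ : (minn p0 t)%:Z + 1%Z = (minn p0 t).+1%:Z); last by lia.
  by rewrite B3 /m1 /arc_edges -/c; case: (zv Z (minn p0 t).+1).2.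
set s8 := supd _ _ _ _.
have [_ Vn En] := A4 n ltac:(lia).
have C1' : s4 rn 0 = n%:Z by rewrite E4.
pose f k := s4 (rwSz + k)%N 0 + w * index_term k n1 (vsum Z n - n1) m1 (esum Z n - c - m1).
rewrite srun_seq srun_scalar.
have -> : seval inp s8 (rwSz$ + rw$ * (rn1$ * (aV$[rn$] - rn1$)))%sx = f 0%N.
  rewrite /f /index_term -Vn -C1'; exact: erefl.
set s9 := supd _ _ _ _; rewrite srun_seq srun_scalar.
have -> : seval inp s9 (rwPIv$ + rw$ * (rn1$ + (aV$[rn$] - rn1$)))%sx = f 1%N.
  rewrite /f /index_term -Vn -C1'; exact: erefl.
set s10 := supd _ _ _ _; rewrite srun_seq [srun inp (SSet rwSze _ _) s10]srun_scalar.
have -> : seval inp s10 (rwSze$ + rw$ * (rm1$ * (aE$[rn$] - rc$ - rm1$)))%sx = f 2%N.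
  rewrite /f /index_term -En -C1'; exact: erefl.
set s11 := supd s10 _ _ _; rewrite srun_scalar.
have -> : seval inp s11 (rwPI$ + rw$ * (rm1$ + (aE$[rn$] - rc$ - rm1$)))%sx = f 3%N.
  rewrite /f /index_term -En -C1'; exact: erefl.
set s12 := supd _ _ _ _.
have E12 k i : k \notin [:: rc; rw; rn1; rm1; rwSz; rwPIv; rwSze; rwPI] -> s12 k i = s4 k i.
  rewrite !inE !negb_or => H; rewrite /s12 /s11 /s10 /s9 /s8 /s7 /s6 /s5 /supd.
  by case/and5P: H => /negbTE -> /negbTE -> /negbTE -> /negbTE -> /and4P [];
    do 4 move=> /negbTE ->.
split.
- move=> k i H; rewrite E12; last by apply: contraL H; rewrite !inE;
    do 8?[case/orP => [/eqP -> //|]]; move/eqP => ->.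
  by move: H; rewrite !inE => H; rewrite E4; do ?[case/orP: H => [/eqP -> //|H]]; rewrite ?(eqP H).
- by move=> l'; rewrite E12 // E4.
- by split; rewrite -[LHS]/(f _) /f E4.
Qed.

End Loops.

Lemma srun_if0 inp x p q s : seval inp s x = 0 -> srun inp (SIf x p q) s = srun inp q s.
Proof. by rewrite srun_if => ->; rewrite eqxx. Qed.

Lemma srun_if1 inp x p q s : seval inp s x = 1 -> srun inp (SIf x p q) s = srun inp p s.
Proof. by rewrite srun_if => ->. Qed.

(** * Correctness of the sweep *)

Section SweepLoop.

Variables (inp : memory) (Z : seq hvertex).
Hypothesis HZ : lattice_cycle Z.

Let n := size Z.

Let a0 : int := apos Z 0 - n%:Z.

(* [k] buckets have been opened; [done] lists the processed steps, and
   [bucket Z (a0 - 1 + k) q] is what remains of the last bucket. *)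
Definition sweep_state (acc : nat -> int) (s : store) (k : nat) (done : seq nat) (q : nat) : Prop :=
  [/\ arrays Z s, s ra 0 = a0 - 1 + k%:Z,
      (q <= n)%N /\ s rt 0 = (last 0%N (bucket Z (a0 - 1 + k%:Z) q))%:Z,
      events Z a0 k = done ++ rev (bucket Z (a0 - 1 + k%:Z) q) &
      [/\ forall a, s ahead a = if a <= a0 - 1 + k%:Z then 0 else (last 0%N (bucket Z a n))%:Z,
          forall l, s apend l = ((sweep Z done).1 l)%:Z &
          [/\ s rwSz 0 = acc 0%N + \sum_(p <- (sweep Z done).2) contribution Z 0 p,
              s rwPIv 0 = acc 1%N + \sum_(p <- (sweep Z done).2) contribution Z 1 p,
              s rwSze 0 = acc 2%N + \sum_(p <- (sweep Z done).2) contribution Z 2 p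
            & s rwPI 0 = acc 3%N + \sum_(p <- (sweep Z done).2) contribution Z 3 p]]].

Lemma sweep_state_open acc s k done q : sweep_state acc s k done q -> s rt 0 = 0 ->
  sweep_state acc (srun inp sweep_body s) k.+1 done n /\ srun inp sweep_body s ri 0 = s ri 0 + 1.
Proof.
move=> [S1 S2 [S3 S4] S5 [S6 S7 S8]] Ht.
have Eb : bucket Z (a0 - 1 + k%:Z) q = [::].
  by apply: bucket_last0; move: S4; rewrite Ht; lia.
have Ek : a0 - 1 + k.+1%:Z = a0 - 1 + k%:Z + 1 by lia.
have Ek' : a0 - 1 + k.+1%:Z = a0 + k%:Z by lia.
have El : seval inp s (rt$ <= #0)%sx = 1 by rewrite /= Ht.
rewrite /sweep_body srun_seq srun_if El /= -[_ 1%N 0 + _]/(s ri 0 + 1).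
set s1 := supd _ ra _ _; set s2 := supd s1 _ _ _.
have E2 : s2 ra 0 = a0 - 1 + k.+1%:Z by rewrite /s2 /s1 /supd /= S2 Ek.
have E1 : s1 ra 0 = a0 - 1 + k.+1%:Z by exact: E2.
have Eh : s1 ahead (s1 ra 0) = (last 0%N (bucket Z (a0 - 1 + k.+1%:Z) n))%:Z.
  rewrite E1 [s1 ahead _]S6; case: ifP => //; lia.
split; last by [].
split=> //=.
- by rewrite eventsS S5 Eb cats0 Ek'.
- split=> //= a; rewrite {1}/supd /= {1}/supd /= -[_ ra 0]/(s2 ra 0) E2.
  case: eqP => [->|Na]; first by rewrite lexx.
  by rewrite -[LHS]/(s ahead a) S6; do 2 case: ifP => //; lia.
Qed.

Lemma sweep_state_step acc s k done q t : sweep_state acc s k done q -> s rt 0 = t%:Z ->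
  t != 0%N -> sweep_state acc (srun inp sweep_body s) k (rcons done t) t.-1 /\
    srun inp sweep_body s ri 0 = s ri 0 + 1.
Proof.
move=> [S1 S2 [S3 S4] S5 [S6 S7 [W1 W2 W3 W4]]] Ht t0.
have [R1 R2 R3 R4] := S1.
set a := a0 - 1 + k%:Z in S2 S4 S5 S6 *.
have Et : last 0%N (bucket Z a q) = t by move: S4; rewrite Ht => -[].
have [Eb Mb] : bucket Z a q = rcons (bucket Z a t.-1) t /\ t \in bucket Z a q.
  by have := @bucket_last Z a q; rewrite Et; apply.
move: Mb; rewrite mem_bucket => /and3P [Hq /eqP Hd /eqP Ha].
have Htn : (0 < t <= n)%N by lia.
have El : seval inp s (rt$ <= #0)%sx = 0 by rewrite /= Ht lez_nat leqn0 (negbTE t0).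
have Ev : events Z a0 k = rcons done t ++ rev (bucket Z a t.-1).
  by rewrite S5 Eb rev_rcons cat_rcons.
have Edone r : r \in done -> (0 < r <= n)%N.
  move=> Hr; have : r \in events Z a0 k by rewrite S5 mem_cat Hr.
  by rewrite mem_events // => /and3P [].
rewrite /sweep_body srun_seq (srun_if0 _ _ El) srun_seq srun_seq.
set l := line Z t.
have -> : srun inp (rl <~ aA$[rt$] + aB$[rt$])%sx s = supd s rl 0 l.
  by rewrite srun_scalar /= Ht; have [-> -> _] := R2 t ltac:(lia).
set s1 := supd s _ _ _; set s2 := srun inp (SIf _ _ _) s1.
have key : [/\ forall k i, k \in [:: rn; ri; ra; rt; aA; aB; aS; aD; aV; aE; ahead; anext] ->
        s2 k i = s k i,
      forall l', s2 apend l' = ((sweep Z (rcons done t)).1 l')%:Z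
    & [/\ s2 rwSz 0 = acc 0%N + \sum_(p <- (sweep Z (rcons done t)).2) contribution Z 0 p,
          s2 rwPIv 0 = acc 1%N + \sum_(p <- (sweep Z (rcons done t)).2) contribution Z 1 p,
          s2 rwSze 0 = acc 2%N + \sum_(p <- (sweep Z (rcons done t)).2) contribution Z 2 p
        & s2 rwPI 0 = acc 3%N + \sum_(p <- (sweep Z (rcons done t)).2) contribution Z 3 p]].
  have := sweep_mem Z done l; have Sl := S7 l.
  have Ec : seval inp s1 (apend$[rl$] <= #0)%sx = if (sweep Z done).1 l == 0%N then 1 else 0.
    by rewrite /= -[s1 rl 0]/l -[s1 apend l]/(s apend l) Sl lez_nat leqn0.
  rewrite /sweep foldl_rcons -/(sweep Z done) /sweep_step -/l; move: Ec.
  case: eqP => [E0 Ec _|/eqP N0 Ec /= Hp].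
    rewrite /s2 (srun_if1 _ _ Ec) srun_set.
    rewrite -[seval _ _ (SGet rl _)]/l -[seval _ _ (SGet rt _)]/(s rt 0) Ht.
    split=> //=.
      move=> k' i; rewrite !inE => H; rewrite /s1 /supd.
      by do ?[case/orP: H => [/eqP -> //|H]]; rewrite ?(eqP H).
    by move=> l'; rewrite {1}/supd /=; case: ifP => // _; rewrite -S7.
  rewrite /s2 (srun_if0 _ _ Ec).
  set p0 := (sweep Z done).1 l in N0 Hp Sl *.
  have Hp0 := Edone _ Hp.
  have [M1 M2 [M3 M4 M5 M6]] := @match_run inp Z HZ s1 t p0 l S1 Ht erefl Sl Htn Hp0.
  move: M1 M2 M3 M4 M5 M6; move: (srun inp match_body s1) => s5 M1 M2 M3 M4 M5 M6.
  split=> /=.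
  - move=> k' i H; rewrite M1 //; move: H; rewrite !inE => H; rewrite /s1 /supd.
    by do ?[case/orP: H => [/eqP -> //|H]]; rewrite ?(eqP H).
  - by move=> l'; rewrite M2; case: ifP => // _; exact: S7.
  - by rewrite M3 M4 M5 M6 !big_rcons !addrA; split; congr (_ + _).
have [K1 K2 K3] := key.
have Enext : seval inp s2 (anext$[rt$])%sx = (last 0%N (bucket Z a t.-1))%:Z.
  by rewrite /= !K1 // Ht R4 // Ha.
rewrite [srun inp (SSet rt _ _) s2]srun_scalar Enext srun_scalar; set s3 := supd _ ri _ _.
have E3 k' i : k' \in [:: rn; ra; aA; aB; aS; aD; aV; aE; ahead; anext] -> s3 k' i = s k' i.
  rewrite !inE => H; rewrite -K1; last first.
    by move: H; rewrite !inE; do 9?[case/orP => [-> //|]]; rewrite ?orbT // => ->; rewrite ?orbT.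
  by rewrite /s3 /supd; do ?[case/orP: H => [/eqP -> //|H]]; rewrite ?(eqP H).
split; last by rewrite -(K1 ri).
split=> //.
- split; first by rewrite E3.
  + by move=> i Hi; rewrite !E3 //; exact: R2.
  + by move=> i Hi; rewrite !E3 //; exact: R3.
  + by move=> i Hi Hi'; rewrite E3 //; exact: R4.
- by rewrite E3.
- by split=> //; lia.
- by split=> // b; rewrite E3 // S6.
Qed.

Lemma sweep_loop acc s : frame Z acc s -> (forall l, s apend l = 0) ->
  arrays Z s -> (forall a, s ahead a = (last 0%N (bucket Z a n))%:Z) ->
  s ra 0 = apos Z 0 - n%:Z - 1 -> s rt 0 = 0 -> s ri 0 = 0 ->
  reach inp (loop sweep_cond sweep_body) s ((4 * n).+2 * loop_cost sweep_cond sweep_body)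
    (fun s' => exists L, sweepable Z L /\
       clean Z (fun k => acc k + \sum_(p <- (sweep Z L).2) contribution Z k p) s').
Proof.
move=> [F1 F2 F3 F4 F5] Hp Ha Hh Hra Hrt Hri.
have Hbound t : (t <= n)%N -> a0 <= apos Z t <= a0 + (n + n)%N%:Z.
  by move=> Ht; have := apos_bounds HZ Ht; rewrite /a0 -/n; lia.
have empty a q : (q <= n)%N -> a < a0 \/ a0 + (n + n)%N%:Z < a -> bucket Z a q = [::].
  move=> Hq Ha0; case E : (bucket Z a q) => [//|t r].
  have : t \in bucket Z a q by rewrite E mem_head.
  rewrite mem_bucket => /and3P [Ht _ /eqP Et].
  have := Hbound t ltac:(lia); rewrite Et; case: Ha0; lia.
pose Inv j s' := s' ri 0 = j%:Z /\ exists k done q,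
  j = (k + size done)%N /\ sweep_state acc s' k done q.
have H : reach inp (loop sweep_cond sweep_body) s
    ((4 * n).+2 * loop_cost sweep_cond sweep_body) (Inv (4 * n).+1).
  apply: (reach_loop (Inv := Inv)).
  - split=> //; exists 0%N, [::], 0%N; split=> //; split=> //.
    + by rewrite Hra /a0; lia.
    + split=> // [a|]; last by rewrite !big_nil !addr0.
      by rewrite Hh; case: ifP => // H; rewrite empty //; left; lia.
  - move=> j s' Hj [Hj1 [k [done [q [Ej S]]]]].
    have [_ _ [_ Srt] _ _] := S.
    have [Et|Nt] := eqVneq (last 0%N (bucket Z (a0 - 1 + k%:Z) q)) 0%N.
      rewrite Et in Srt; have [S' Eri] := sweep_state_open S Srt.
      split; first by rewrite Eri Hj1; lia.
      by exists k.+1, done, n; split; [lia|].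
    have [S' Eri] := sweep_state_step S Srt Nt.
    split; first by rewrite Eri Hj1; lia.
    by exists k, (rcons done (last 0%N (bucket Z (a0 - 1 + k%:Z) q))); eexists;
      split; [rewrite size_rcons; lia|exact: S'].
  - move=> j s' Hj [Hj1 [k [done [q [_ [[C1 _ _ _] _ _ _ _]]]]]].
    by rewrite /= Hj1 C1; case: ifP; lia.
apply: (reach_weaken H) => // s' [_ [k [done [q [Ej S]]]]].
have [[R1 _ _ _] _ [Hq _] Ev [S6 S7 S8]] := S.
(* [k + size done = 4 n + 1] and at most [n] steps are done, so the current bucket lies beyond all
   positions of [Z]. *)
have Hk : (n + n < k.-1)%N.
  have := size_events HZ a0 k; rewrite Ev size_cat -/n => Hs.
  have := size_cycle HZ; rewrite -/n; lia.
rewrite empty // ?cats0 in Ev; last by right; lia.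
have HL : sweepable Z done.
  rewrite -Ev; apply: (sweepable_events HZ) => t Ht; have := Hbound t Ht; lia.
exists done; split=> //; split=> //.
- by move=> a; rewrite S6; case: ifP => // H'; rewrite empty //; right; lia.
- by move=> l; rewrite S7 (sweep_unmatched HZ HL).
Qed.

End SweepLoop.

(** The factors 3, 2, 2 and 5 absorb the round counts [n + 4], [n + 1], [n + 2] and [4 n + 2], since
    [n >= 3]. *)
Definition direction_cost (d : nat) : nat :=
  (time_bound (compile start_copy) + 3 * loop_cost copy_cond (copy_body d) +
   time_bound (compile start_orient) + 2 * loop_cost orient_cond orient_body +
   time_bound (compile start_prefix) + 2 * loop_cost prefix_cond prefix_body +
   time_bound (compile start_sweep) + 5 * loop_cost sweep_cond sweep_body)%N.

Lemma direction_run inp Z d acc s : lattice_cycle Z -> clean Z acc s ->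
  (forall i s', (i < (size Z).+3)%N ->
     s' rx 0 = 3 * (i%:Z - (size Z)%:Z * (if (size Z)%:Z <= i%:Z then 1 else 0)) ->
     [/\ seval inp s' (coordinates d).1 = (zv Z i).1.1,
         seval inp s' (coordinates d).2 = (zv Z i).1.2
       & seval inp s' (SInput (rx$ + #3)%sx) = ((zv Z i).2 : nat)%:Z]) ->
  reach inp (direction_program d) s (direction_cost d * size Z)
    (fun s' => exists L, sweepable Z L /\
       clean Z (fun k => acc k + \sum_(p <- (sweep Z L).2) contribution Z k p) s').
Proof.
move=> HZ Hc Hread; have n2 := size_cycle HZ; set n := size Z in n2 *.
pose total := (time_bound (compile start_copy) + (n.+4 * loop_cost copy_cond (copy_body d) +
  (time_bound (compile start_orient) + (n.+1 * loop_cost orient_cond orient_body +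
  (time_bound (compile start_prefix) + (n.+2 * loop_cost prefix_cond prefix_body +
  (time_bound (compile start_sweep) +
   (4 * n).+2 * loop_cost sweep_cond sweep_body)))))))%N.
apply: (reach_weaken (c := total)); last 2 first.
- rewrite /total /direction_cost.
  move: (time_bound _) (loop_cost _ _) (time_bound _) (loop_cost _ _) (time_bound _)
    (loop_cost _ _) (time_bound _) (loop_cost _ _) => b1 b2 b3 b4 b5 b6 b7 b8.
  by clear -n2; nia.
- by move=> s' H; exact: H.
apply: (reach_seq (Q1 := fun s' => clean Z acc s' /\ s' ri 0 = 0)).
  by apply: reach_block.
move=> s1 [D1 I1]; apply: reach_seq; first exact: (copy_loop HZ D1 I1 Hread).
move=> s2 [D2 A2].
apply: (reach_seq (Q1 := fun s' => [/\ clean Z acc s', copied Z n.+3 s', s' ri 0 = 1 & s' rbest 0 = 0])).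
  by apply: reach_block.
move=> s3 [D3 A3 I3 B3]; apply: reach_seq; first exact: (orient_loop HZ D3 A3 I3 B3).
move=> s4 [D4 A4 [b [Eb Hb Hd Hmin]]].
have HL : sweepable Z (events Z (apos Z 0 - n%:Z) (n + n).+1).
  by apply: (sweepable_events HZ) => t Ht; have := apos_bounds HZ Ht; rewrite -/n; lia.
have Ho : inside Z (lft Z 0) = ~~ (zv Z b).2.
  have [_ mL _] := HL; apply: (orientation HZ HL); first by rewrite mL Hb Hd eqxx.
  by move=> t; rewrite mL => /andP [Ht /eqP Hdt]; exact: Hmin.
apply: (reach_seq (Q1 := fun s' => [/\ clean Z acc s', copied Z n.+3 s',
   s' ri 0 = 1 /\ s' ro 0 = (inside Z (lft Z 0) : nat)%:Z, s' aV 0 = 0 & s' aE 0 = 0])).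
  apply: reach_block => //; split=> //; split=> //.
  have [_ _ Sb] := A4 b ltac:(lia).
  by rewrite Ho -[LHS]/(1 - s4 aS (s4 rbest 0)) Eb Sb; case: (zv Z b).2.
move=> s5 [D5 A5 [I5 O5] V5 E5]; apply: reach_seq.
  exact: (prefix_loop HZ D5 A5 I5 O5 V5 E5).
move=> s6 [[D6 P6] A6 X6 C6 H6].
apply: (reach_seq (Q1 := fun s' => [/\ frame Z acc s', forall l, s' apend l = 0, arrays Z s',
   forall a, s' ahead a = (last 0%N (bucket Z a n))%:Z &
   [/\ s' ra 0 = apos Z 0 - n%:Z - 1, s' rt 0 = 0 & s' ri 0 = 0]])).
  apply: reach_block => //; have [R _ _ _ _] := D6; split=> //; split=> //.
  by have [A0 _ _] := A6 0%N isT; rewrite -[LHS]/(s6 aA 0 - s6 rn 0 - 1) R A0.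
move=> s7 [D7 P7 A7 H7 [Ra Rt Ri]].
exact: (sweep_loop HZ D7 P7 A7 H7 Ra Rt Ri).
Qed.

Lemma zv_map_rho Z i : (0 < size Z)%N -> zv (map rho Z) i = rho (zv Z i).
Proof.
move=> H; rewrite /zv size_map (nth_map (0, 0, false)) ?ltn_mod //.
Qed.

Lemma cycle_input_read Z i : (i < size Z)%N ->
  [/\ cycle_input Z (3 * i + 1)%N%:Z = (nth (0, 0, false) Z i).1.1,
      cycle_input Z (3 * i + 2)%N%:Z = (nth (0, 0, false) Z i).1.2
    & cycle_input Z (3 * i + 3)%N%:Z = ((nth (0, 0, false) Z i).2 : nat)%:Z].
Proof.
move=> Hi; rewrite (addnS _ 0) (addnS _ 1) (addnS _ 2) /=.
elim: Z i Hi => [//|v Z IH] [|i] Hi; first by rewrite muln0.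
have [H1 H2 H3] := IH i Hi.
by rewrite (_ : (3 * i.+1)%N = (3 * i).+3) ?addSn; [split|lia].
Qed.

Lemma coordinates_read Z d i s : lattice_cycle Z -> (d < 3)%N -> (i < (size Z).+3)%N ->
  s rx 0 = 3 * (i%:Z - (size Z)%:Z * (if (size Z)%:Z <= i%:Z then 1 else 0)) ->
  let v := iter d rho (zv Z i) in
  [/\ seval (cycle_input Z) s (coordinates d).1 = v.1.1,
      seval (cycle_input Z) s (coordinates d).2 = v.1.2
    & seval (cycle_input Z) s (SInput (rx$ + #3)%sx) = (v.2 : nat)%:Z].
Proof.
move=> HZ Hd Hi Hs; have n2 := size_cycle HZ.
have Hm : (i %% size Z < size Z)%N by rewrite ltn_mod; lia.
have {}Hs : s rx 0 = (3 * (i %% size Z))%N%:Z.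
  rewrite Hs lez_nat; case: leqP => Hn.
    rewrite (_ : i = (i - size Z + size Z)%N) ?modnDr ?modn_small; lia.
  by rewrite modn_small //; lia.
have [R1 R2 R3] := cycle_input_read Hm; rewrite -/(zv Z i) in R1 R2 R3.
have E k : `|(3 * (i %% size Z))%N%:Z + k%:Z| = (3 * (i %% size Z) + k)%N%:Z :> int by lia.
have In (k : nat) : seval (cycle_input Z) s (SInput (SAdd (SGet rx (SConst 0)) (SConst k%:Z))) =
    cycle_input Z (3 * (i %% size Z) + k)%N%:Z by rewrite -E -Hs.
have {}R1 := etrans (In 1%N) R1; have {}R2 := etrans (In 2%N) R2.
have {}R3 := etrans (In 3%N) R3.
have Rc : seval (cycle_input Z) s (#0 - SInput (rx$ + #1) - SInput (rx$ + #2) - SInput (rx$ + #3))%sx =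
    0 - (zv Z i).1.1 - (zv Z i).1.2 - ((zv Z i).2 : nat)%:Z by rewrite -R1 -R2 -R3.
case: d Hd => [|[|[|d]]] // _; rewrite /coordinates /fst /snd;
  split; rewrite ?Rc ?R1 ?R2 ?R3; case: (zv Z i) => [[a b] t] /=; lia.
Qed.

(** * Correctness *)

Lemma index_termC k n1 n2 m1 m2 : index_term k n1 n2 m1 m2 = index_term k n2 n1 m2 m1.
Proof. by case: k => [|[|[|k]]] /=; rewrite (mulrC, addrC). Qed.

Definition index_summand (T : finType) (e : rel T) (k : nat) (x y : T) : int :=
  (gdeg e x + gdeg e y)%:Z * index_term k (n_closer e x y)%:Z (n_closer e y x)%:Z
                                          (m_closer e x y)%:Z (m_closer e y x)%:Z.

Lemma index_summandC (T : finType) (e : rel T) k x y :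
  index_summand e k x y = index_summand e k y x.
Proof. by rewrite /index_summand addnC index_termC. Qed.

Lemma direction_sum (T : finType) (e : rel T) (Z : seq hvertex) (pos : T -> hvertex) L k :
  lattice_cycle Z ->
  [/\ injective pos,
        forall v, vertex_within Z v <-> exists x, pos x = v
      & forall x y, e x y <-> edge_within Z (pos x) (pos y)] ->
  sweepable Z L ->
  \sum_(x | ~~ (pos x).2) \sum_(y | e x y && ((pos x).1 == (pos y).1)) index_summand e k x y =
  \sum_(p <- (sweep Z L).2) contribution Z k p.
Proof.
move=> HZ HG HL; rewrite (sweep_sum HZ HG HL); apply: eq_big_seq => p Hp.
have ex i : exists x, pos x == zv Z i.
  by have [x Ex] := exists_pos HZ HG i; exists x; apply/eqP.
have Hzt i : pos (xchoose (ex i)) = zv Z i := eqP (xchooseP (ex i)).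
have [HC H0 H1] := sweep_pairs HZ HL Hp.
exact: (cut_contribution HZ HG Hzt HC H0 H1 (@index_termC k)).
Qed.

Definition output : program :=
  Seq (Write (Const 0) (compile_exp (rwSz$)%sx))
  (Seq (Write (Const 1) (compile_exp (rwPIv$)%sx))
  (Seq (Write (Const 2) (compile_exp (rwSze$)%sx))
       (Write (Const 3) (compile_exp (rwPI$)%sx)))).

(** Writing cells 0 to 3 overwrites the input but not the store, whose addresses are negative. *)
Lemma output_run inp m s : represents inp m s -> exists t m',
  [/\ exec output m t m', (t <= time_bound output)%N
    & [/\ m' 0 = s rwSz 0, m' 1 = s rwPIv 0, m' 2 = s rwSze 0 & m' 3 = s rwPI 0]].
Proof.
move=> [R _].
have E k m0 : (forall i, i < 0 -> m0 i = m i) ->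
    eval m0 (compile_exp (SGet k (SConst 0))) = s k 0.
  by move=> H; rewrite -R -H ?address_lt0.
have U m0 (i z : int) : 0 <= i -> (forall j, j < 0 -> m0 j = m j) ->
    forall j, j < 0 -> update m0 i z j = m j.
  by move=> Hi H j Hj; rewrite /update; case: eqP => [Eij|_]; [lia|exact: H].
have W k (i : int) m0 : (forall j, j < 0 -> m0 j = m j) ->
    exec (Write (Const i) (compile_exp (SGet k (SConst 0)))) m0
      (exp_time (Const i) + exp_time (compile_exp (SGet k (SConst 0)))).+1
      (update m0 i (s k 0)).
  by move=> H; rewrite -(E k m0 H); exact: ExecWrite.
have U1 := U m 0 (s rwSz 0) isT (fun _ _ => erefl).
have U2 := U _ 1 (s rwPIv 0) isT U1; have U3 := U _ 2 (s rwSze 0) isT U2.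
eexists; eexists; split.
- apply: ExecSeq (W rwSz 0 m (fun _ _ => erefl)) _.
  apply: ExecSeq (W rwPIv 1 _ U1) _; apply: ExecSeq (W rwSze 2 _ U2) _.
  exact: (W rwPI 3 _ U3).
- by [].
- by rewrite /update.
Qed.

Definition index_program : program :=
  Seq (Seq (compile (rn <~ SInput #0)%sx)
        (Seq (direction_program 0) (Seq (direction_program 1) (direction_program 2))))
      output.

Lemma clean_size Z Z' acc s : size Z = size Z' -> clean Z acc s -> clean Z' acc s.
Proof. by rewrite /clean => ->. Qed.

(* One program, with one constant c, computes the four indices of every
   benzenoid system from its boundary cycle, in time at most c |Z|. *)
Theorem theorem4p4 :
  exists (p : program) (c : nat),
    forall (T : finType) (e : rel T) (Z : seq hvertex),
      benzenoid_system e Z ->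
      exists (t : nat) (m : memory),
        [/\ exec p (cycle_input Z) t m,
            (t <= c * size Z)%N
          & [/\ m 0 = (wSz e)%:Z, m 1 = (wPIv e)%:Z,
                m 2 = (wSze e)%:Z & m 3 = (wPI e)%:Z]].
Proof.
pose c0 := time_bound (compile (rn <~ SInput #0)%sx).
exists index_program, (c0 + (direction_cost 0 + (direction_cost 1 +
  (direction_cost 2 + time_bound output))))%N => T e Z [HZ [pos HG]].
have n0 := size_cycle_gt0 HZ.
have [HZ1 HG1] := benzenoid_rho HZ HG.
have [HZ2 HG2] := benzenoid_rho HZ1 HG1.
pose Z1 := map rho Z; pose Z2 := map rho Z1.
have sZ1 : size Z1 = size Z by rewrite size_map.
have sZ2 : size Z2 = size Z by rewrite size_map.
pose inp := cycle_input Z; pose s0 : store := fun _ _ => 0.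
(* Negative cells of the input hold 0, so the initial memory represents the zero store. *)
have R0 : represents inp inp s0.
  by split=> // k i; rewrite /inp; have := address_lt0 k i; case: (address k i).
have read d i s : (d < 3)%N -> (i < (size Z).+3)%N -> _ :=
  fun Hd Hi => @coordinates_read Z d i s HZ Hd Hi.
have run0 : reach inp (compile (rn <~ SInput #0)%sx) s0 c0 (clean Z (fun=> 0)).
  by apply: reach_block.
have run : reach inp (Seq (compile (rn <~ SInput #0)%sx)
    (Seq (direction_program 0) (Seq (direction_program 1) (direction_program 2)))) s0
    (c0 + (direction_cost 0 * size Z + (direction_cost 1 * size Z + direction_cost 2 * size Z)))
    (fun s => exists L0 L1 L2, [/\ sweepable Z L0, sweepable Z1 L1, sweepable Z2 L2 &
       clean Z (fun k => 0 + \sum_(p <- (sweep Z L0).2) contribution Z k p +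
          \sum_(p <- (sweep Z1 L1).2) contribution Z1 k p +
          \sum_(p <- (sweep Z2 L2).2) contribution Z2 k p) s]).
  apply: reach_seq run0 _ => s1 C1.
  apply: reach_seq; first by apply: (direction_run HZ C1) => i s Hi; exact: read.
  move=> s2 [L0 [HL0 C2]]; have {}C2 := clean_size (esym sZ1) C2.
  apply: reach_seq.
    rewrite -sZ1; apply: (direction_run HZ1 C2) => i s; rewrite sZ1 zv_map_rho // => Hi.
    exact: (read 1%N).
  move=> s3 [L1 [HL1 C3]]; have {}C3 := clean_size (etrans sZ1 (esym sZ2)) C3.
  rewrite -sZ2; apply: (reach_weaken (direction_run HZ2 C3 _)) => //.
    move=> i s; rewrite sZ2 zv_map_rho ?sZ1 // zv_map_rho // => Hi; exact: (read 2).
  move=> s4 [L2 [HL2 C4]]; exists L0, L1, L2; split=> //.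
  exact: clean_size sZ2 C4.
have [t [m [s [E1 T1 R1 [L0 [L1 [L2 [HL0 HL1 HL2 [_ _ _ [W0 W1 W2 W3]]]]]]]]]] := run _ R0.
have [t' [m' [E2 T2 [M0 M1 M2 M3]]]] := output_run R1.
exists (t + t')%N, m'.
have total k : \sum_(f in gedges e) index_summand e k f.1 f.2 =
    0 + \sum_(p <- (sweep Z L0).2) contribution Z k p +
    \sum_(p <- (sweep Z1 L1).2) contribution Z1 k p +
    \sum_(p <- (sweep Z2 L2).2) contribution Z2 k p.
  rewrite (sum_directions HZ HG (index_summandC e k)) add0r.
  by rewrite (direction_sum k HZ HG HL0) (direction_sum k HZ1 HG1 HL1) (direction_sum k HZ2 HG2 HL2).
split.
- exact: ExecSeq E1 E2.
- apply: leq_trans (leq_add T1 T2) _; clear -n0.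
  move: (size Z) c0 (direction_cost 0) (direction_cost 1) (direction_cost 2) (time_bound output) n0.
  by move=> n a b c d f n0; nia.
- rewrite M0 M1 M2 M3 W0 W1 W2 W3 -!total.
  by split; rewrite /wSz /wPIv /wSze /wPI Posz_sum; apply: eq_bigr => f _;
     rewrite /index_summand /index_term PoszM ?PoszM ?PoszD.
Qed.
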